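(* Let $p$ be a prime and $n\ge1$. For any $\boldsymbol a=(a_1,\dots,a_n)\in\mathbb{Z}_p^n$ and $h\in\mathbb{Z}_p$, the matrix power series $\mathsf U(h,\boldsymbol a,z)$ (the $q\to1$ limit of the $q$-deformed intertwiner, defined in the context) takes values in $\mathsf{GL}_n(E_p)$ and gives a Frobenius intertwiner from the hypergeometric system with parameters $(a_1,\dots,a_n,h,z^p)$ to the hypergeometric system with parameters $(pa_1,\dots,pa_n,ph,z)$. The constant term of this intertwiner is the operator of multiplication by the cohomology class $$\mathsf U(h,\boldsymbol a,0)=\prod_{j=1}^n\frac{\Gamma_p(px+ph-pa_j)}{\Gamma_p(px-pa_j)\,\Gamma_p(ph)},$$ where $\Gamma_p$ is the Morita $p$-adic gamma function.
   Context: $\Gamma_p:\mathbb{Z}_p\to\mathbb{Z}_p^\times$ is Morita's gamma function: the continuous extension of $\Gamma_p(m)=(-1)^m\prod_{0<i<m,\,p\nmid i}i$, $m\in\mathbb{N}$. Hypergeometric system. Let $D=z\frac{d}{dz}$. The hypergeometric equation with parameters $(a_1,\dots,a_n,h,z)$ is $PF=0$ with $P=z\prod_{i=1}^n(D+h-a_i)-\prod_{i=1}^n(D-a_i)$; the system is the companion first-order system for the vector $(F,DF,\dots,D^{n-1}F)^T$. The system with parameters $(a_1,\dots,a_n,h,z^p)$ is the companion system, for the vectors $(G,DG,\dots,D^{n-1}G)^T$ with the same $D=z\frac d{dz}$, satisfied by $G(z)=F(z^p)$ where $F$ solves the equation with parameters $(a_1,\dots,a_n,h)$. A Frobenius intertwiner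 is a matrix in $\mathsf{GL}_n(E_p)$ which by left multiplication maps solution vectors of the latter system to solution vectors of the system with parameters $(pa_1,\dots,pa_n,ph,z)$. Definition of $\mathsf U$. With $(b)_d=b(b+1)\cdots(b+d-1)$ let $$f_j(h,\boldsymbol a,z)=\sum_{d\ge0}\Big(\prod_{k=1}^n\frac{(a_j-a_k+h)_d}{(a_j-a_k+1)_d}\Big)z^d,\qquad \Psi'(h,\boldsymbol a,z)_{i,j}=(D+a_j)^{i-1}f_j(h,\boldsymbol a,z),$$ so that $z^{a_j}f_j$ are solutions of the equation. Put $$\mathsf U(h,\boldsymbol a,z)=\Psi'(ph,p\boldsymbol a,z)\ \Lambda\ \big[\mathrm{diag}(1,p,\dots,p^{n-1})\,\Psi'(h,\boldsymbol a,z^p)\big]^{-1},\qquad \Lambda=\mathrm{diag}_j\Big(\prod_{k=1}^n g(h,a_j-a_k)\Big),$$ where $\Psi'(h,\boldsymbol a,z^p)$ is $\Psi'(h,\boldsymbol a,z)$ with $z$ replaced by $z^p$, and $g(h,m)$ is the $p$-adically continuous extension to $h,m\in\mathbb{Z}_p$ of $\binom{pm+ph-1}{pm}\big/\binom{m+h-1}{m}$, $m,h\in\mathbb{N}$ (the ratio of the gamma classes $z^x\prod_i\frac{\Gamma(x+h-a_i)}{\Gamma(x+1-a_i)\Gamma(h)}$ at $(ph,p\boldsymbol a,px,z)$ and at $(h,\boldsymbol a,x,z^p)$, evaluated at $x=a_j$, up to the power-of-$p$ normalization absorbed in the $q\to 1$ limit). When $a_i-a_j\in\mathbb{Z}$ for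 some $i\ne j$, the coefficients of the powers of $z$ in $\mathsf U$ are understood as limits from generic $\boldsymbol a$. $E_p$ is the completion of $\mathbb{Q}(z)$ with respect to the $p$-adic Gauss norm $\big|\sum a_iz^i/\sum b_jz^j\big|=\max|a_i|_p/\max|b_j|_p$. A power series is regarded as an element of $E_p$ if it is the uniform limit (sup norm on coefficients) of Taylor series at $0$ of rational functions regular at $0$ that converge in the Gauss norm. Cohomology. $H_T^\bullet(X)=\mathbb{Z}[x,a_1,\dots,a_n,h]/\prod_i(x-a_i)$ for $X=T^*\mathbb{P}^{n-1}$, $T=(\mathbb{C}^\times)^{n+1}$. ''Multiplication by a class $c(x)$'' means: for pairwise distinct $a_i$, $\mathsf U(h,\boldsymbol a,0)$ has eigenvectors $v_i=(1,pa_i,\dots,(pa_i)^{n-1})^T$ (representing the $T$-fixed points) with eigenvalues $c(a_i)$ obtained by setting $x=a_i$; the remaining cases are understood by taking limits. *)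

(* Defs.v *)
From HB Require Import structures.
From mathcomp Require Import all_boot all_order all_algebra.
From mathcomp Require Import ring lra.
From mathcomp Require Import mathcomp_extra boolp classical_sets functions.

Set Implicit Arguments.
Unset Strict Implicit.
Unset Printing Implicit Defensive.

Import Order.TTheory GRing.Theory Num.Theory.
Local Open Scope ring_scope.

(* Non-archimedean absolute values. The ones used below take values in
   p^Z \cup {0}, hence in rat. *)
Record absval (R : idomainType) := AbsVal {
  av :> R -> rat;
  av_ge0 : forall x, 0 <= av x;
  av_eq0 : forall x, (av x == 0) = (x == 0);
  avM : forall x y, av (x * y) = av x * av y;
  avD : forall x y, av (x + y) <= Num.max (av x) (av y) }.

Section AbsvalTheory.
Variables (R : idomainType) (v : absval R).

Lemma av0 : v 0 = 0. Proof. by apply/eqP; rewrite av_eq0. Qed.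

Lemma av1 : v 1 = 1.
Proof.
have /mulfI : v 1 != 0 by rewrite av_eq0 oner_eq0.
by apply; rewrite -avM !mulr1.
Qed.

Lemma avN x : v (- x) = v x.
Proof.
have h : v (-1) = 1.
  have : v (-1) * v (-1) = 1 by rewrite -avM mulrNN mulr1 av1.
  have := av_ge0 v (-1); nra.
by rewrite -mulN1r avM h mul1r.
Qed.

Lemma avB x y : v (x - y) <= Num.max (v x) (v y).
Proof. by rewrite -(avN y) avD. Qed.

Lemma avBC x y : v (x - y) = v (y - x).
Proof. by rewrite -avN opprB. Qed.

Lemma avD_lt x y e : v x < e -> v y < e -> v (x + y) < e.
Proof. by move=> hx hy; apply: le_lt_trans (avD _ _ _) _; rewrite gt_max hx. Qed.

Lemma avB_lt x y e : v x < e -> v y < e -> v (x - y) < e.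
Proof. by rewrite -(avN y); exact: avD_lt. Qed.

Lemma av_eq_near x y : v (x - y) < v y -> v x = v y.
Proof.
move=> h; apply/eqP; rewrite eq_le; apply/andP; split.
  by rewrite -{1}(subrK y x); apply: le_trans (avD _ _ _) _; rewrite ge_max lexx ltW.
rewrite leNgt; apply/negP => h'.
have : v (x - (x - y)) < v y.
  by apply: avB_lt.
by rewrite opprB addrC subrK ltxx.
Qed.

Lemma av_dist x y : `|v x - v y| <= v (x - y).
Proof.
have [h|h] := ltP (v (x - y)) (v y).
  by rewrite (av_eq_near h) subrr normr0 av_ge0.
have [h'|h'] := ltP (v (x - y)) (v x).
  by rewrite avBC in h'; rewrite (av_eq_near h') subrr normr0 av_ge0.
have := av_ge0 v x; have := av_ge0 v y.
by move=> ? ?; rewrite ler_norml; lra.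
Qed.

End AbsvalTheory.

Lemma avV (F : fieldType) (v : absval F) x : v x^-1 = (v x)^-1.
Proof.
have [->|h] := eqVneq x 0; first by rewrite invr0 av0 invr0.
have hx : v x != 0 by rewrite av_eq0.
by apply: (mulfI hx); rewrite -avM !divff // av1.
Qed.

Section Completion.
Variables (F : fieldType) (v : absval F).

Definition cauchy_seq (u : nat -> F) := forall eps : rat, 0 < eps ->
  exists N, forall m n, (N <= m)%N -> (N <= n)%N -> v (u m - u n) < eps.

Definition null_seq (u : nat -> F) := forall eps : rat, 0 < eps ->
  exists N, forall m, (N <= m)%N -> v (u m) < eps.

Lemma cauchy_bounded u : cauchy_seq u ->
  exists2 B, 0 < B & forall n, v (u n) <= B.
Proof.
move=> /(_ 1 ltr01) [N hN].
have s0 : 0 <= \sum_(i < N.+1) v (u i) by apply: sumr_ge0 => i _; exact: av_ge0.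
exists (1 + \sum_(i < N.+1) v (u i)); first by lra.
have hle i : (i < N.+1)%N -> v (u i) <= \sum_(i < N.+1) v (u i).
  move=> hi; rewrite (bigD1 (Ordinal hi)) //= lerDl.
  by apply: sumr_ge0 => j _; exact: av_ge0.
move=> n; have [h|h] := ltnP n N.+1; first by have := hle _ h; lra.
have := hN n N (ltnW h) (leqnn _).
have := av_dist v (u n) (u N); have := hle N (ltnSn N).
rewrite ler_norml => ? /andP[? ?] ?; lra.
Qed.

Definition cauchy_pred : {pred nat -> F} := [pred u | `[< cauchy_seq u >]].

Lemma cauchy_subring : subring_closed cauchy_pred.
Proof.
split.
- apply/asboolP => e e0; exists 0%N => m n _ _.
  by rewrite subrr av0.
- move=> u w /asboolP hu /asboolP hw; apply/asboolP => e e0.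
  have [N hN] := hu _ e0; have [M hM] := hw _ e0.
  exists (maxn N M) => m n; rewrite !geq_max => /andP[a b] /andP[c d].
  have -> : (u - w) m - (u - w) n = (u m - u n) - (w m - w n).
    by change ((u - w) m) with (u m - w m); change ((u - w) n) with (u n - w n); ring.
  by apply: avB_lt; [exact: hN | exact: hM].
- move=> u w /asboolP hu /asboolP hw; apply/asboolP => e e0.
  have [B B0 hB] := cauchy_bounded hu; have [C C0 hC] := cauchy_bounded hw.
  have [N hN] := hu _ (divr_gt0 e0 C0); have [M hM] := hw _ (divr_gt0 e0 B0).
  exists (maxn N M) => m n; rewrite !geq_max => /andP[a b] /andP[c d].
  have -> : (u * w) m - (u * w) n = (u m - u n) * w m + u n * (w m - w n).
    by change ((u * w) m) with (u m * w m); change ((u * w) n) with (u n * w n); ring.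
  apply: avD_lt; rewrite avM.
  + apply: le_lt_trans (ler_wpM2l (av_ge0 _ _) (hC _)) _.
    by rewrite -ltr_pdivlMr //; exact: hN.
  + apply: le_lt_trans (ler_wpM2r (av_ge0 _ _) (hB _)) _.
    by rewrite mulrC -ltr_pdivlMr //; exact: hM.
Qed.

HB.instance Definition _ :=
  GRing.isSubringClosed.Build (nat -> F) cauchy_pred cauchy_subring.

Record cauchy := Cauchy { cauchy_val :> nat -> F; _ : cauchy_val \in cauchy_pred }.

HB.instance Definition _ := [isSub for cauchy_val].
HB.instance Definition _ := [Choice of cauchy by <:].
HB.instance Definition _ := [SubChoice_isSubComNzRing of cauchy by <:].

Lemma cauchyP (u : cauchy) : cauchy_seq u.
Proof. by case: u => u /= /asboolP. Qed.

Definition mk_cauchy u (hu : cauchy_seq u) : cauchy := Cauchy (asboolT hu).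

Definition null_pred : {pred cauchy} := [pred u | `[< null_seq (u : cauchy) >]].

Lemma null_idealr : idealr_closed null_pred.
Proof.
split.
- by apply/asboolP => e e0; exists 0%N => m _ /=; rewrite av0.
- apply/negP => /asboolP /(_ 1 ltr01) [N /(_ N (leqnn _))] /=.
  by rewrite av1 ltxx.
- move=> w u x /asboolP hu /asboolP hx; apply/asboolP => e e0.
  have [B B0 hB] := cauchy_bounded (@cauchyP w).
  have [N hN] := hu _ (divr_gt0 e0 B0); have [M hM] := hx _ e0.
  exists (maxn N M) => m; rewrite !geq_max => /andP[a b].
  change (v (w m * u m + x m) < e).
  apply: avD_lt; last exact: hM.
  rewrite avM; apply: le_lt_trans (ler_wpM2r (av_ge0 _ _) (hB _)) _.
  by rewrite mulrC -ltr_pdivlMr //; exact: hN.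
Qed.

HB.instance Definition _ := isIdealr.Build cauchy null_pred null_idealr.

Definition completion : Type := {ideal_quot null_pred}.

HB.instance Definition _ := Choice.on completion.
HB.instance Definition _ := GRing.ComNzRing.on completion.

Definition cpi (u : cauchy) : completion := \pi_({ideal_quot null_pred})%qT u.
Definition crepr (x : completion) : cauchy := repr (x : {ideal_quot null_pred}).

Lemma creprK x : cpi (crepr x) = x. Proof. exact: reprK. Qed.

Lemma cpi_eqP u w : cpi u = cpi w <-> null_seq (u - w : cauchy).
Proof.
split; last by move=> h; apply/eqP; rewrite -Quotient.idealrBE; apply/asboolP.
by move=> /eqP; rewrite -Quotient.idealrBE => /asboolP.
Qed.

Lemma cpiD u w : cpi (u + w) = cpi u + cpi w.
Proof. by rewrite /cpi; exact: Quotient.pi_add. Qed.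

Lemma cpiM u w : cpi (u * w) = cpi u * cpi w.
Proof. by rewrite /cpi; exact: Quotient.pi_mul. Qed.

Lemma cpi0 : cpi 0 = 0.
Proof. by apply: (addrI (cpi 0)); rewrite -cpiD !addr0. Qed.

Lemma cpi1 : cpi 1 = 1.
Proof. by rewrite -[LHS]mulr1 -[X in _ * X]creprK -cpiM mul1r creprK. Qed.

Lemma cpi_eq0P u : cpi u = 0 <-> null_seq u.
Proof. by rewrite -cpi0 cpi_eqP subr0. Qed.

Lemma nonnullP (u : cauchy) : ~ null_seq u ->
  exists2 c, 0 < c & exists N, forall n, (N <= n)%N -> v (u n) = c.
Proof.
move=> /existsNP [e /not_implyP [e0 /forallNP hu]].
have [N hN] := cauchyP u e0.
have /existsNP [m /not_implyP [hm /negP]] := hu N.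
rewrite -leNgt => hme; exists (v (u m)); first exact: lt_le_trans hme.
by exists N => n hn; apply: av_eq_near; apply: lt_le_trans hme; exact: hN.
Qed.

Lemma inv_cauchy (u : cauchy) : ~ null_seq u -> cauchy_seq (fun n => (u n)^-1).
Proof.
move=> /nonnullP [c c0 [N hN]] e e0.
have h0 : 0 < e * (c * c) by rewrite !mulr_gt0.
have [M hM] := cauchyP u h0.
exists (maxn N M) => m n; rewrite !geq_max => /andP[a b] /andP[a' b'].
have um : u m != 0 by rewrite -(av_eq0 v) hN // gt_eqF.
have un : u n != 0 by rewrite -(av_eq0 v) hN // gt_eqF.
have -> : (u m)^-1 - (u n)^-1 = (u n - u m) / (u m * u n) by field; rewrite um un.
by rewrite avM avV avM !hN // ltr_pdivrMr ?mulr_gt0 //; exact: hM.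
Qed.

Definition cinv (x : completion) : completion :=
  if pselect (null_seq (crepr x)) is right h then cpi (mk_cauchy (inv_cauchy h))
  else 0.

Lemma cinv0 : cinv 0 = 0.
Proof.
rewrite /cinv; case: pselect => // h; case: h.
by apply/cpi_eq0P; rewrite creprK.
Qed.

Lemma mulcV x : x != 0 -> cinv x * x = 1.
Proof.
move=> /eqP x0; rewrite /cinv; case: pselect => [/cpi_eq0P|h].
  by rewrite creprK.
rewrite -[X in _ * X]creprK -cpiM -cpi1; apply/cpi_eqP => e e0.
have [c c0 [N hN]] := nonnullP h.
exists N => m hm.
change (v ((crepr x m)^-1 * crepr x m - 1) < e).
have um : crepr x m != 0 by rewrite -(av_eq0 v) hN // gt_eqF.
by rewrite mulVf // subrr av0.
Qed.

HB.instance Definition _ := GRing.ComNzRing_isField.Build completion mulcV cinv0.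

Definition abs_lim (u : nat -> F) (c : rat) := forall eps, 0 < eps ->
  exists N, forall n, (N <= n)%N -> `|v (u n) - c| < eps.

Definition cabs (x : completion) : rat := xget 0 [set c | abs_lim (crepr x) c].

Lemma abs_lim_null u : null_seq u -> abs_lim u 0.
Proof.
move=> hu e e0; have [N hN] := hu _ e0; exists N => n hn.
by rewrite subr0 ger0_norm ?hN // av_ge0.
Qed.

Lemma abs_lim_const u c : (exists N, forall n, (N <= n)%N -> v (u n) = c) ->
  abs_lim u c.
Proof.
by move=> [N hN] e e0; exists N => n hn; rewrite hN // subrr normr0.
Qed.

Lemma abs_lim_uniq u w c d : null_seq (fun n => u n - w n) ->
  abs_lim u c -> abs_lim w d -> c = d.
Proof.
move=> hn hu hw; apply/eqP; rewrite -subr_eq0 -normr_eq0; apply/negPn/negP => h.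
have e0 : 0 < `|c - d| / 4 by rewrite divr_gt0 ?normr_gt0 // -normr_eq0.
have [N1 /(_ (maxn N1 _) (leq_maxl _ _)) h1] := hn _ e0.
have [N2 h2] := hu _ e0; have [N3 h3] := hw _ e0.
have := h1 (maxn N2 N3).
have /h2 : (N2 <= maxn N1 (maxn N2 N3))%N by rewrite leq_max leq_maxl orbT.
have /h3 : (N3 <= maxn N1 (maxn N2 N3))%N by rewrite leq_max leq_maxr orbT.
move: (maxn _ _) => k h3' h2' h1'.
have h4 := av_dist v (u k) (w k).
move: h3' h2' e0; rewrite !ltr_norml => /andP[? ?] /andP[? ?].
move: h4; rewrite ler_norml => /andP[? ?] e0.
have : `|c - d| < `|c - d| by rewrite {1}ltr_norml; apply/andP; split; lra.
by rewrite ltxx.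
Qed.

Lemma abs_lim_ex (u : cauchy) : exists c, abs_lim u c.
Proof.
have [/abs_lim_null h|/nonnullP [c _ h]] := pselect (null_seq u).
  by exists 0.
by exists c; exact: abs_lim_const.
Qed.

Lemma cabs_lim (u : cauchy) : abs_lim u (cabs (cpi u)).
Proof.
have h : abs_lim (crepr (cpi u)) (cabs (cpi u)).
  rewrite /cabs; case: (abs_lim_ex (crepr (cpi u))) => c hc.
  exact: (xgetI 0 hc).
have [c hc] := abs_lim_ex u.
suff -> : cabs (cpi u) = c by [].
apply: abs_lim_uniq h hc; apply/cpi_eqP; exact: creprK.
Qed.

Lemma cabsE (u : cauchy) c : abs_lim u c -> cabs (cpi u) = c.
Proof.
apply: abs_lim_uniq (@cabs_lim u).
by move=> e e0; exists 0%N => m _; rewrite subrr av0.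
Qed.

Lemma cabs_eq0 x : (cabs x == 0) = (x == 0).
Proof.
rewrite -[x]creprK; set u := crepr x.
have [h|h] := pselect (null_seq u).
  by rewrite (cabsE (abs_lim_null h)) eqxx; apply/esym/eqP/cpi_eq0P.
have [c c0 hc] := nonnullP h; rewrite (cabsE (abs_lim_const hc)) gt_eqF //.
by apply/esym/eqP => /cpi_eq0P.
Qed.

Lemma cabs_ge0 x : 0 <= cabs x.
Proof.
rewrite -[x]creprK; set u := crepr x.
have [h|h] := pselect (null_seq u); first by rewrite (cabsE (abs_lim_null h)).
by have [c c0 hc] := nonnullP h; rewrite (cabsE (abs_lim_const hc)) ltW.
Qed.

Lemma cabsM x y : cabs (x * y) = cabs x * cabs y.
Proof.
have [->|x0] := eqVneq x 0.
  by rewrite mul0r; move/eqP: (cabs_eq0 0); rewrite eqxx => /eqP /eqP ->; rewrite mul0r.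
have [->|y0] := eqVneq y 0.
  by rewrite mulr0; move/eqP: (cabs_eq0 0); rewrite eqxx => /eqP /eqP ->; rewrite mulr0.
move: x0 y0; rewrite -[x]creprK -[y]creprK.
move: (crepr x) (crepr y) => u w /eqP u0 /eqP w0.
have /nonnullP [c _ hc] : ~ null_seq u by move=> /cpi_eq0P.
have /nonnullP [d _ hd] : ~ null_seq w by move=> /cpi_eq0P.
rewrite (cabsE (abs_lim_const hc)) (cabsE (abs_lim_const hd)) -cpiM.
apply: cabsE; apply: abs_lim_const.
case: hc hd => N hN [M hM]; exists (maxn N M) => n; rewrite geq_max => /andP[a b].
by rewrite -(hN n) // -(hM n) // -avM.
Qed.

Lemma cabsD x y : cabs (x + y) <= Num.max (cabs x) (cabs y).
Proof.
rewrite -[x]creprK -[y]creprK -cpiD; move: (crepr x) (crepr y) => u w.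
rewrite leNgt; apply/negP => h.
set M := Num.max _ _ in h.
have e0 : 0 < (cabs (cpi (u + w)) - M) / 2 by rewrite divr_gt0 // subr_gt0.
have [N1 h1] := @cabs_lim u _ e0; have [N2 h2] := @cabs_lim w _ e0.
have [N3 h3] := @cabs_lim (u + w) _ e0.
pose k := (N1 + N2 + N3)%N.
have := h1 k; rewrite /k -addnA leq_addr => /(_ isT).
have := h2 k; rewrite /k addnAC leq_addl => /(_ isT).
have := h3 k; rewrite /k leq_addl => /(_ isT).
rewrite addnAC addnA; have -> : (N1 + N3 + N2 = N1 + N2 + N3)%N by rewrite addnAC.
rewrite -/k.
have := avD v (u k) (w k); change ((u + w) k) with (u k + w k).
have : cabs (cpi u) <= M by rewrite le_max lexx.
have : cabs (cpi w) <= M by rewrite le_max lexx orbT.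
rewrite !ltr_norml => ? ? + /andP[? ?] /andP[? ?] /andP[? ?].
by rewrite le_max => /orP [] ?; lra.
Qed.

Definition cabsval : absval completion := AbsVal cabs_ge0 cabs_eq0 cabsM cabsD.

Lemma const_cauchy (c : F) : cauchy_seq (fun _ => c).
Proof. by move=> e e0; exists 0%N => m n _ _; rewrite subrr av0. Qed.

Definition cinj (c : F) : completion := cpi (mk_cauchy (@const_cauchy c)).

Lemma cabs_cinj c : cabsval (cinj c) = v c.
Proof. by apply: cabsE; apply: abs_lim_const; exists 0%N. Qed.

End Completion.

Section CompletionMap.
Variables (F F' : fieldType) (v : absval F) (v' : absval F') (f : F -> F').
Hypothesis f_contr : forall x y, v' (f x - f y) <= v (x - y).

Lemma map_cauchy (u : cauchy v) : cauchy_seq v' (fun n => f (u n)).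
Proof.
move=> e e0; have [N hN] := cauchyP u e0.
by exists N => m n hm hn; apply: le_lt_trans (f_contr _ _) _; exact: hN.
Qed.

Definition completion_map (x : completion v) : completion v' :=
  cpi (mk_cauchy (@map_cauchy (crepr x))).

Lemma completion_map_cpi u : completion_map (cpi u) = cpi (mk_cauchy (@map_cauchy u)).
Proof.
apply/cpi_eqP => e e0.
have /cpi_eqP /(_ _ e0) [N hN] : cpi (crepr (cpi u)) = cpi u by exact: creprK.
exists N => m hm; apply: le_lt_trans (f_contr _ _) _; exact: hN.
Qed.

Lemma completion_map_cinj c : completion_map (cinj v c) = cinj v' (f c).
Proof.
rewrite completion_map_cpi; apply/cpi_eqP => e e0.
by exists 0%N => m _ /=; rewrite subrr av0.
Qed.

End CompletionMap.

Section AbsvalFraction.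
Variables (R : idomainType) (v : absval R) (F : fieldType) (i : {rmorphism R -> F}).
Hypothesis i_inj : injective i.
Variables num den : F -> R.
Hypothesis den_neq0 : forall x, den x != 0.
Hypothesis num_den : forall x, x = i (num x) / i (den x).

Definition fabs (x : F) : rat := v (num x) / v (den x).

Lemma fabsE a b : b != 0 -> fabs (i a / i b) = v a / v b.
Proof.
move=> b0; rewrite /fabs; set x := i a / i b.
have ib : i b != 0 by rewrite -(rmorph0 i) (inj_eq i_inj).
have id : i (den x) != 0 by rewrite -(rmorph0 i) (inj_eq i_inj).
have vb : v b != 0 by rewrite av_eq0.
have vd : v (den x) != 0 by rewrite av_eq0.
apply/eqP; rewrite eqr_div // -!avM; apply/eqP; congr (v _).
by apply: i_inj; rewrite !rmorphM; apply/eqP; rewrite -eqr_div // -num_den.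
Qed.

Lemma fabs_ge0 x : 0 <= fabs x.
Proof. by rewrite /fabs divr_ge0 // av_ge0. Qed.

Lemma fabs_eq0 x : (fabs x == 0) = (x == 0).
Proof.
have id : i (den x) != 0 by rewrite -(rmorph0 i) (inj_eq i_inj).
rewrite /fabs [in RHS](num_den x) !mulf_eq0 !invr_eq0 (negbTE id) !av_eq0.
by rewrite (negbTE (den_neq0 x)) !orbF -(rmorph0 i) (inj_eq i_inj).
Qed.

Lemma fabsM x y : fabs (x * y) = fabs x * fabs y.
Proof.
rewrite {1}(num_den x) {1}(num_den y) mulf_div -!rmorphM fabsE ?mulf_neq0 //.
by rewrite !avM -mulf_div.
Qed.

Lemma fabsD x y : fabs (x + y) <= Num.max (fabs x) (fabs y).
Proof.
have ix : i (den x) != 0 by rewrite -(rmorph0 i) (inj_eq i_inj).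
have iy : i (den y) != 0 by rewrite -(rmorph0 i) (inj_eq i_inj).
have vx : 0 < v (den x) by rewrite lt_neqAle av_ge0 eq_sym av_eq0 den_neq0.
have vy : 0 < v (den y) by rewrite lt_neqAle av_ge0 eq_sym av_eq0 den_neq0.
rewrite {1}(num_den x) {1}(num_den y) addf_div // -!rmorphM -rmorphD.
rewrite fabsE ?mulf_neq0 // avM ler_pdivrMr ?mulr_gt0 //.
apply: le_trans (avD _ _ _) _; rewrite !avM /fabs.
rewrite ge_max; apply/andP; split.
- have -> : v (num x) * v (den y) = v (num x) / v (den x) * (v (den x) * v (den y)).
    by rewrite mulrA divfK ?gt_eqF.
  by rewrite ler_pM2r ?mulr_gt0 // le_max lexx.
- have -> : v (num y) * v (den x) = v (num y) / v (den y) * (v (den x) * v (den y)).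
    by rewrite mulrCA divfK ?gt_eqF // mulrC.
  by rewrite ler_pM2r ?mulr_gt0 // le_max lexx orbT.
Qed.

Definition fabsval : absval F := AbsVal fabs_ge0 fabs_eq0 fabsM fabsD.

End AbsvalFraction.

Section Gauss.
Variables (F : fieldType) (v : absval F).

Implicit Types P Q : {poly F}.

Definition gauss P : rat := \big[Num.max/0]_(i < size P) v P`_i.

Lemma gauss_ge0 P : 0 <= gauss P.
Proof.
apply: (big_ind (fun x : rat => 0 <= x)) => //= [x y hx hy|i _]; last exact: av_ge0.
by rewrite le_max hx.
Qed.

Lemma gauss_coef (P : {poly F}) i : v P`_i <= gauss P.
Proof.
have [h|h] := ltnP i (size P); last by rewrite nth_default // av0 gauss_ge0.
exact: (le_bigmax 0 (fun i : 'I_(size P) => v P`_i) (Ordinal h)).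
Qed.

Lemma gauss_le (P : {poly F}) c : 0 <= c -> (forall i, v P`_i <= c) -> gauss P <= c.
Proof.
by move=> c0 h; apply: bigmax_le.
Qed.

Lemma gauss_eq0 P : (gauss P == 0) = (P == 0).
Proof.
apply/eqP/eqP => [h|->]; last by rewrite /gauss size_poly0 big_ord0.
apply/polyP => i; rewrite coef0; apply/eqP; rewrite -(av_eq0 v) eq_le av_ge0 -h.
by rewrite gauss_coef.
Qed.

Lemma gauss_first P : P != 0 -> exists2 i, v P`_i = gauss P &
  forall j, (j < i)%N -> v P`_j < gauss P.
Proof.
move=> P0.
have ex : exists i, v P`_i == gauss P.
  apply: contrapT => /forallNP h.
  have lt i : v P`_i < gauss P.
    by rewrite lt_neqAle gauss_coef andbT; apply/negP/h.
  have : gauss P < gauss P.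
    have g0 : 0 < gauss P by rewrite lt_neqAle gauss_ge0 eq_sym gauss_eq0 P0.
    by rewrite {1}/gauss; apply: bigmax_lt.
  by rewrite ltxx.
exists (ex_minn ex); case: ex_minnP => i /eqP hi hmin //.
move=> j hj; rewrite lt_neqAle gauss_coef andbT; apply/negP => /hmin.
by rewrite leqNgt hj.
Qed.

Lemma gaussD P Q : gauss (P + Q) <= Num.max (gauss P) (gauss Q).
Proof.
apply: gauss_le => [|i]; first by rewrite le_max gauss_ge0.
rewrite coefD; apply: le_trans (avD _ _ _) _.
by rewrite ge_max !le_max !gauss_coef orbT.
Qed.

Lemma av_sum_le (I : Type) (r : seq I) (A : pred I) (f : I -> F) c : 0 <= c ->
  (forall i, A i -> v (f i) <= c) -> v (\sum_(i <- r | A i) f i) <= c.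
Proof.
move=> c0 h; apply: (big_ind (fun x => v x <= c)) => //; first by rewrite av0.
by move=> x y hx hy; apply: le_trans (avD _ _ _) _; rewrite ge_max hx.
Qed.

Lemma av_sum_lt (I : Type) (r : seq I) (A : pred I) (f : I -> F) c : 0 < c ->
  (forall i, A i -> v (f i) < c) -> v (\sum_(i <- r | A i) f i) < c.
Proof.
move=> c0 h; apply: (big_ind (fun x => v x < c)) => //; first by rewrite av0.
by move=> x y; exact: avD_lt.
Qed.

Lemma gaussM P Q : gauss (P * Q) = gauss P * gauss Q.
Proof.
have g00 : gauss 0 = 0 by apply/eqP; rewrite gauss_eq0.
have [->|P0] := eqVneq P 0; first by rewrite mul0r g00 mul0r.
have [->|Q0] := eqVneq Q 0; first by rewrite mulr0 g00 mulr0.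
have gP : 0 < gauss P by rewrite lt_neqAle gauss_ge0 eq_sym gauss_eq0 P0.
have gQ : 0 < gauss Q by rewrite lt_neqAle gauss_ge0 eq_sym gauss_eq0 Q0.
apply/eqP; rewrite eq_le; apply/andP; split.
  apply: gauss_le => [|k]; first by rewrite mulr_ge0 // gauss_ge0.
  rewrite coefM; apply: av_sum_le => [|j _]; first by rewrite mulr_ge0 // gauss_ge0.
  by rewrite avM ler_pM ?av_ge0 ?gauss_coef.
have [i hi hi'] := gauss_first P0; have [j hj hj'] := gauss_first Q0.
apply: le_trans (gauss_coef _ (i + j)).
have il : (i < (i + j).+1)%N by rewrite ltnS leq_addr.
rewrite coefM (bigD1 (Ordinal il)) //= addKn.
set s := \sum_(_ | _) _; set t := P`_i * Q`_j.
have ht : v t = gauss P * gauss Q by rewrite /t avM hi hj.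
suff hs : v s < v t.
  by rewrite -ht (@av_eq_near _ v (t + s) t) // addrAC subrr add0r.
rewrite ht; apply: av_sum_lt => [|k hk]; first by rewrite mulr_gt0.
have ki : (k : nat) != i.
  by apply: contra hk => /eqP ki; apply/eqP/val_inj.
rewrite avM; have [lt|] := ltnP k i.
  apply: (@le_lt_trans _ _ (v P`_k * gauss Q)).
    by rewrite ler_wpM2l ?av_ge0 ?gauss_coef.
  by rewrite ltr_pM2r // hi'.
rewrite leq_eqVlt eq_sym (negbTE ki) /= => lt.
apply: (@le_lt_trans _ _ (gauss P * v Q`_(i + j - k))).
  by rewrite ler_wpM2r ?av_ge0 ?gauss_coef.
rewrite ltr_pM2l // hj' //.
have := ltn_ord k; rewrite ltnS => kl.
by rewrite ltn_subLR // ltn_add2r.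
Qed.

Definition gaussval : absval {poly F} := AbsVal gauss_ge0 gauss_eq0 gaussM gaussD.

Lemma gaussC c : gauss c%:P = v c.
Proof.
apply/eqP; rewrite eq_le; apply/andP; split.
  apply: gauss_le => [|i]; first exact: av_ge0.
  by rewrite coefC; case: eqP => // _; rewrite av0 av_ge0.
by have := gauss_coef c%:P 0; rewrite coefC eqxx.
Qed.

Lemma gaussX P : gauss ('X * P) = gauss P.
Proof.
suff h : gauss 'X = 1 by rewrite gaussM h mul1r.
apply/eqP; rewrite eq_le; apply/andP; split.
  by apply: gauss_le => // i; rewrite coefX; case: eqP => _; rewrite ?av1 ?av0.
by have := gauss_coef 'X 1; rewrite coefX eqxx av1.
Qed.

Lemma av_nat k : v k%:R <= 1.
Proof.
elim: k => [|k IH]; first by rewrite av0.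
by rewrite -addn1 natrD; apply: le_trans (avD _ _ _) _; rewrite ge_max IH av1 /=.
Qed.

Lemma gauss_deriv P : gauss P^`() <= gauss P.
Proof.
apply: gauss_le => [|i]; first exact: gauss_ge0.
rewrite coef_deriv -mulr_natr avM.
apply: le_trans (gauss_coef P i.+1).
by apply: ler_piMr; [exact: av_ge0 | exact: av_nat].
Qed.

End Gauss.

Section RatFun.
Variable F : fieldType.
Local Notation K := {fraction {poly F}}.
Local Notation toK := (@FracField.tofrac {poly F}).

Definition rnum (r : K) : {poly F} := \n_(repr r).
Definition rden (r : K) : {poly F} := \d_(repr r).

Lemma rden_neq0 r : rden r != 0. Proof. exact: denom_ratioP. Qed.

Lemma toK_inj : injective toK.
Proof. by move=> x y /eqP; rewrite tofrac_eq => /eqP. Qed.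

Lemma rnum_rden r : r = toK (rnum r) / toK (rden r).
Proof.
have dn0 : toK (rden r) != 0 by rewrite tofrac_eq0 rden_neq0.
apply: (mulIf dn0); rewrite divfK // -[in LHS](reprK r).
rewrite /rnum /rden; set x := repr r.
unlock FracField.tofrac; rewrite -[LHS]FracField.pi_mul.
apply/eqmodP; rewrite /= FracField.equivfE /FracField.mulf.
rewrite !numden_Ratio ?oner_eq0 ?mulr1 ?mulf_neq0 ?denom_ratioP //=.
by rewrite reprK mulrC.
Qed.

(* z d/dz on F(z), by the quotient rule. *)
Definition zderiv (r : K) : K :=
  toK ('X * ((rnum r)^`() * rden r - rnum r * (rden r)^`())) / toK (rden r ^+ 2).

Lemma zderivE P Q : Q != 0 ->
  zderiv (toK P / toK Q) = toK ('X * (P^`() * Q - P * Q^`())) / toK (Q ^+ 2).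
Proof.
move=> Q0; rewrite /zderiv; set r := toK P / toK Q.
move: (rnum_rden r) (rden_neq0 r); set N := rnum r; set M := rden r => hr M0.
have h : P * M = N * Q.
  apply: toK_inj; rewrite !rmorphM; apply/eqP.
  by rewrite -eqr_div ?tofrac_eq0 // -hr.
have hd : P^`() * M + P * M^`() = N^`() * Q + N * Q^`() by rewrite -!derivM h.
apply/eqP; rewrite eqr_div ?tofrac_eq0 ?expf_neq0 // -!rmorphM; apply/eqP.
congr (toK _).
have e1 : N^`() * Q = P^`() * M + P * M^`() - N * Q^`() by rewrite hd addrK.
transitivity ('X * ((N^`() * Q) * (M * Q) - (N * Q) * (M^`() * Q))); first by ring.
rewrite e1 -h.
transitivity ('X * (P^`() * M * M * Q + P * M^`() * M * Q - (N * Q) * Q^`() * M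
  - P * M * M^`() * Q)); first by ring.
rewrite -h; ring.
Qed.

Lemma zderivB r s : zderiv (r - s) = zderiv r - zderiv s.
Proof.
rewrite {1}(rnum_rden r) {1}(rnum_rden s) [in RHS]/zderiv.
move: (rden_neq0 r) (rden_neq0 s).
move: (rnum r) (rden r) (rnum s) (rden s) => P Q N M Q0 M0.
rewrite -mulNr -rmorphN addf_div ?tofrac_eq0 // -!rmorphM -rmorphD.
rewrite zderivE ?mulf_neq0 //.
rewrite -[X in _ = _ + X]mulNr -[- toK _]rmorphN addf_div ?tofrac_eq0 ?expf_neq0 //.
rewrite -!rmorphM -rmorphD; apply/eqP.
rewrite eqr_div ?tofrac_eq0 ?mulf_neq0 ?expf_neq0 // -!rmorphM; apply/eqP.
congr (toK _); rewrite !derivD !derivM !derivN; ring.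
Qed.

Variable v : absval F.

Definition gauss_abs : absval K :=
  fabsval (gaussval v) toK_inj rden_neq0 rnum_rden.

Lemma gauss_absE P Q : Q != 0 -> gauss_abs (toK P / toK Q) = gauss v P / gauss v Q.
Proof. exact: (fabsE (gaussval v) toK_inj rden_neq0 rnum_rden). Qed.

Lemma gauss_abs_const_contr x y :
  gauss_abs (toK x%:P - toK y%:P) <= v (x - y).
Proof.
rewrite -tofracB -polyCB -[X in gauss_abs X]divr1 -tofrac1 gauss_absE ?oner_eq0 //.
by rewrite gaussC -polyC1 gaussC av1 divr1.
Qed.

Lemma zderiv_contr r s : gauss_abs (zderiv r - zderiv s) <= gauss_abs (r - s).
Proof.
rewrite -zderivB; move: (r - s) => {r s} r.
rewrite {2}(rnum_rden r) gauss_absE ?rden_neq0 // /zderiv.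
move: (rden_neq0 r); move: (rnum r) (rden r) => P Q Q0.
rewrite gauss_absE ?expf_neq0 // gaussX.
have gQ : 0 < gauss v Q by rewrite lt_neqAle gauss_ge0 eq_sym gauss_eq0 Q0.
rewrite expr2 gaussM ler_pdivrMr ?mulr_gt0 // mulrA divfK ?gt_eqF //.
apply: le_trans (avB (gaussval v) _ _) _; rewrite /= !gaussM ge_max.
by rewrite ler_wpM2r ?gauss_ge0 ?gauss_deriv //= ler_wpM2l ?gauss_ge0 ?gauss_deriv.
Qed.

End RatFun.

Section PadicRat.
Variables (p : nat) (hp : prime p).

Definition padic_int_abs (m : int) : rat :=
  if m == 0 then 0 else (p%:R ^+ logn p `|m|%N)^-1.

Let p0 : 0 < p%:R :> rat. Proof. by rewrite ltr0n prime_gt0. Qed.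

Lemma padic_int_ge0 m : 0 <= padic_int_abs m.
Proof. by rewrite /padic_int_abs; case: eqP => // _; rewrite invr_ge0 exprn_ge0 ?ltW. Qed.

Lemma padic_int_eq0 m : (padic_int_abs m == 0) = (m == 0).
Proof.
rewrite /padic_int_abs; case: (m =P 0) => [_|_]; first by rewrite eqxx.
by rewrite invr_eq0 gt_eqF ?exprn_gt0.
Qed.

Lemma padic_intM m k : padic_int_abs (m * k) = padic_int_abs m * padic_int_abs k.
Proof.
have [->|m0] := eqVneq m 0; first by rewrite mul0r /padic_int_abs eqxx mul0r.
have [->|k0] := eqVneq k 0; first by rewrite mulr0 /padic_int_abs eqxx mulr0.
rewrite /padic_int_abs mulf_eq0 (negbTE m0) (negbTE k0) /=.
by rewrite abszM lognM ?absz_gt0 // exprD invfM.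
Qed.

Lemma padic_int_leP m e : (padic_int_abs m <= (p%:R ^+ e)^-1) = (p ^ e %| `|m|)%N.
Proof.
have [->|m0] := eqVneq m 0; rewrite /padic_int_abs ?eqxx ?(negbTE m0).
  by rewrite dvdn0 invr_ge0 exprn_ge0 ?ltW.
rewrite lef_pV2 ?posrE ?exprn_gt0 // pfactor_dvdn ?absz_gt0 //.
by rewrite ler_eXn2l // ltr1n prime_gt1.
Qed.

Lemma padic_intD m k :
  padic_int_abs (m + k) <= Num.max (padic_int_abs m) (padic_int_abs k).
Proof.
wlog h : m k / padic_int_abs k <= padic_int_abs m.
  move=> H; have /orP [h|h] := le_total (padic_int_abs k) (padic_int_abs m); first exact: H.
  by rewrite addrC maxC H.
rewrite (max_idPl h).
have [m0|m0] := eqVneq m 0.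
  move: h; rewrite m0 add0r => h; exact: h.
have hm : padic_int_abs m = (p%:R ^+ logn p `|m|%N)^-1 by rewrite /padic_int_abs (negbTE m0).
have dm : (p ^ logn p `|m|%N %| `|m|)%N by exact: pfactor_dvdnn.
have dk : (p ^ logn p `|m|%N %| `|k|)%N by rewrite -padic_int_leP -hm.
rewrite [leRHS]hm padic_int_leP.
move: dm dk; set d := (p ^ _)%N => dm dk.
have : (d%:Z %| m + k)%Z by apply: rpredD.
by [].
Qed.

Definition padic_intval : absval int :=
  AbsVal padic_int_ge0 padic_int_eq0 padic_intM padic_intD.

Lemma rat_num_den x : x = (numq x)%:~R / (denq x)%:~R.
Proof. by rewrite divq_num_den. Qed.

Definition padic_abs : absval rat :=
  fabsval padic_intval (i := intr) intr_inj denq_neq0 rat_num_den.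

End PadicRat.

Section Frobenius.
Variables (p : nat) (hp : prime p).

Definition Q_p : fieldType := completion (padic_abs hp).
Definition pabs : absval Q_p := cabsval (padic_abs hp).
Definition Z_p : {pred Q_p} := [pred x | pabs x <= 1].

(* Limit of [f] along the indices that are [near delta], as delta -> 0. *)
Definition tends_to (I : Type) (near : rat -> I -> Prop) (f : I -> Q_p) (y : Q_p) :=
  forall eps : rat, 0 < eps -> exists2 delta : rat, 0 < delta &
    forall i, near delta i -> pabs (f i - y) < eps.

Definition plim (I : Type) (near : rat -> I -> Prop) (f : I -> Q_p) : Q_p :=
  xget 0 [set y | tends_to near f y].

Definition Gamma_nat (m : nat) : Q_p :=
  (-1) ^+ m * \prod_(1 <= i < m | ~~ (p %| i)%N) i%:R.

(* Value at x of the continuous extension, for x in Z_p. *)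
Definition Gamma_p (x : Q_p) : Q_p :=
  plim (fun delta (m : nat) => pabs (m%:R - x) < delta) Gamma_nat.

Definition g_nat (h m : nat) : Q_p :=
  'C((p * m + p * h - 1)%N, (p * m)%N)%:R / 'C((m + h - 1)%N, m)%:R.

(* h ranges over the positive integers: at h = 0 < m the ratio is 0 / 0. *)
Definition g (h m : Q_p) : Q_p :=
  plim (fun delta (hm : nat * nat) => [/\ (0 < hm.1)%N,
          pabs (hm.1%:R - h) < delta & pabs (hm.2%:R - m) < delta])
    (fun hm => g_nat hm.1 hm.2).

(* Power series are represented by their sequences of coefficients. *)
Section MatrixSeries.
Variable n : nat.
Implicit Types A B : nat -> 'M[Q_p]_n.

Definition mps_mul A B (d : nat) : 'M[Q_p]_n :=
  \sum_(k < d.+1) A k *m B (d - k)%N.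

Definition mps_one (d : nat) : 'M[Q_p]_n := if d == 0%N then 1%:M else 0.

(* [mps_inv_upto A d k] is the k-th coefficient of the inverse, for k <= d. *)
Fixpoint mps_inv_upto A (d k : nat) : 'M[Q_p]_n :=
  if d is e.+1 then
    if (k <= e)%N then mps_inv_upto A e k
    else - (invmx (A 0%N) *m \sum_(i < e.+1) A i.+1 *m mps_inv_upto A e (e - i)%N)
  else invmx (A 0%N).

Definition mps_inv A (d : nat) : 'M[Q_p]_n := mps_inv_upto A d d.

Lemma mps_inv_uptoE A d k : (k <= d)%N -> mps_inv_upto A d k = mps_inv A k.
Proof.
elim: d => [|d IH]; first by rewrite leqn0 => /eqP ->.
rewrite leq_eqVlt => /orP [/eqP -> //|]; rewrite ltnS => h.
by rewrite /= h IH.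
Qed.

Lemma mps_mulV A : A 0%N \in unitmx -> mps_mul A (mps_inv A) = mps_one.
Proof.
move=> A0; apply/funext => -[|d]; rewrite /mps_mul.
  by rewrite big_ord_recl big_ord0 addr0 /= mulmxV.
rewrite big_ord_recl subn0 /mps_inv /= ltnn mulmxN mulmxA mulmxV // mul1mx.
apply/eqP; rewrite addrC subr_eq0; apply/eqP; apply: eq_bigr => i _.
by rewrite /= /bump /= add1n subSS [in RHS]mps_inv_uptoE ?leq_subr.
Qed.

(* z := z^p *)
Definition mps_subst A (d : nat) : 'M[Q_p]_n :=
  if (p %| d)%N then A (d %/ p)%N else 0.

End MatrixSeries.

Section U.
Variable n : nat.
Implicit Types (h : Q_p) (a : 'I_n -> Q_p).

Definition pochhammer (b : Q_p) (d : nat) : Q_p := \prod_(i < d) (b + i%:R).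

Definition hyp_f h a (j : 'I_n) (d : nat) : Q_p :=
  \prod_(k < n) (pochhammer (a j - a k + h) d / pochhammer (a j - a k + 1) d).

(* The operator D + c on scalar power series. *)
Definition ps_D_plus (c : Q_p) (f : nat -> Q_p) (d : nat) : Q_p := (d%:R + c) * f d.

Definition Psi h a (d : nat) : 'M[Q_p]_n :=
  \matrix_(i, j) iter i (ps_D_plus (a j)) (hyp_f h a j) d.

Definition pscale a : 'I_n -> Q_p := fun i => p%:R * a i.

Definition Lambda h a : 'M[Q_p]_n :=
  diag_mx (\row_j \prod_(k < n) g h (a j - a k)).

(* The formula for U, meaningful when no a_i - a_j with i <> j is an integer. *)
Definition U_generic h a : nat -> 'M[Q_p]_n :=
  mps_mul (fun d => Psi (p%:R * h) (pscale a) d *m Lambda h a)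
    (mps_inv (fun d => diag_mx (\row_i p%:R ^+ i) *m mps_subst (Psi h a) d)).

Definition generic a : Prop :=
  forall i j, i != j -> forall m : int, a i - a j != m%:~R.

Definition near_within (P : ('I_n -> Q_p) -> Prop) a (delta : rat) (b : 'I_n -> Q_p) :=
  [/\ forall i, b i \in Z_p, P b & forall i, pabs (b i - a i) < delta].

Definition U h a (d : nat) : 'M[Q_p]_n :=
  if `[< generic a >] then U_generic h a d
  else \matrix_(i, j) plim (near_within generic a) (fun b => U_generic h b d i j).

Definition U_limits_exist h a : Prop :=
  ~ generic a -> forall d i j, exists y,
    tends_to (near_within generic a) (fun b => U_generic h b d i j) y.

End U.

Definition ratfun : fieldType := {fraction {poly rat}}.

Definition E_p : fieldType := completion (gauss_abs (padic_abs hp)).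
Definition Eabs : absval E_p := cabsval (gauss_abs (padic_abs hp)).

Definition ratfun_to_E (r : ratfun) : E_p := cinj (gauss_abs (padic_abs hp)) r.
Definition zE : E_p := ratfun_to_E (FracField.tofrac ('X : {poly rat})).
Definition const_E : Q_p -> E_p :=
  completion_map (gauss_abs_const_contr (padic_abs hp)).

(* z d/dz, extended from Q(z) by continuity. *)
Definition DE : E_p -> E_p := completion_map (zderiv_contr (padic_abs hp)).

(* r is regular at 0 and t is its Taylor series at 0. *)
Definition is_taylor (r : ratfun) (t : nat -> rat) : Prop :=
  exists P Q : {poly rat}, [/\ Q`_0 != 0,
    r = FracField.tofrac P / FracField.tofrac Q &
    forall d, P`_d = \sum_(k < d.+1) Q`_k * t (d - k)%N].

(* The power series f is regarded as the element e of E_p. *)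
Definition series_in_E (f : nat -> Q_p) (e : E_p) : Prop :=
  exists (r : nat -> ratfun) (t : nat -> nat -> rat),
  [/\ forall k, is_taylor (r k) (t k),
      forall eps : rat, 0 < eps -> exists K, forall k, (K <= k)%N ->
        Eabs (ratfun_to_E (r k) - e) < eps &
      forall eps : rat, 0 < eps -> exists K, forall k, (K <= k)%N ->
        forall d, pabs (cinj (padic_abs hp) (t k d) - f d) < eps].

Section Systems.
Variable n : nat.
Implicit Types (h : Q_p) (a : 'I_n -> Q_p).

(* Symbol, as a polynomial in D with coefficients on the left, of
   zeta prod_i (c D + h - a_i) - prod_i (c D - a_i). *)
Definition hyp_op (c zeta : E_p) h a : {poly E_p} :=
  zeta *: \prod_(i < n) (c *: 'X + (const_E (h - a i))%:P)
  - \prod_(i < n) (c *: 'X - (const_E (a i))%:P).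

(* Matrix A of the system D w = A w satisfied by w = (F, D F, ..., D^(n-1) F)
   when sum_k L_k D^k F = 0, for L of degree n. *)
Definition companion_system (L : {poly E_p}) : 'M[E_p]_n :=
  \matrix_(i, j) if (i.+1 < n)%N then (j == i.+1 :> nat)%:R else - (L`_j / L`_n).

Definition hyp_system h a : 'M[E_p]_n := companion_system (hyp_op 1 zE h a).

(* Since (z^p) d/d(z^p) = p^-1 D, this is the system of the G(z) = F(z^p). *)
Definition hyp_system_zp h a : 'M[E_p]_n :=
  companion_system (hyp_op (p%:R)^-1 (zE ^+ p) h a).

Definition derivation (S : comNzRingType) (D : S -> S) : Prop :=
  (forall x y, D (x + y) = D x + D y) /\ (forall x y, D (x * y) = D x * y + x * D y).

(* Solution vectors are taken in arbitrary differential extensions (S, D) of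
   (E_p, D). *)
Definition frobenius_intertwiner h a (V : 'M[E_p]_n) : Prop :=
  V \in unitmx /\
  forall (S : comNzRingType) (phi : {rmorphism E_p -> S}) (D : S -> S),
    derivation D -> (forall e, D (phi e) = phi (DE e)) ->
    forall w : 'cV[S]_n,
      map_mx D w = map_mx phi (hyp_system_zp h a) *m w ->
      let w' := map_mx phi V *m w in
      map_mx D w' = map_mx phi (hyp_system (p%:R * h) (pscale a)) *m w'.

End Systems.

Section Classes.
Variable n : nat.
Implicit Types a : 'I_n -> Q_p.

(* The vector representing the fixed point x = a_i. *)
Definition fixed_point a (i : 'I_n) : 'cV[Q_p]_n := \col_(k < n) (p%:R * a i) ^+ k.

Definition acts_on_fixed_points (c : ('I_n -> Q_p) -> Q_p -> Q_p) a (M : 'M[Q_p]_n) :=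
  forall i, M *m fixed_point a i = c a (a i) *: fixed_point a i.

(* For pairwise distinct a_i the matrix is determined by its action on the
   fixed points; otherwise it is a limit of such matrices. *)
Definition multiplication_by (c : ('I_n -> Q_p) -> Q_p -> Q_p) a (M : 'M[Q_p]_n) : Prop :=
  (injective a -> acts_on_fixed_points c a M) /\
  (~ injective a -> forall eps : rat, 0 < eps -> exists2 delta : rat, 0 < delta &
     forall b N, near_within (fun b => injective b) a delta b ->
       acts_on_fixed_points c b N -> forall i j, pabs (N i j - M i j) < eps).

Definition gamma_class (h : Q_p) a (x : Q_p) : Q_p :=
  \prod_(j < n) (Gamma_p (p%:R * x + p%:R * h - p%:R * a j)
    / (Gamma_p (p%:R * x - p%:R * a j) * Gamma_p (p%:R * h))).

End Classes.

End Frobenius.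

Arguments Z_p {p hp}.

(* Main.v *)
(* For a natural number h > 0 the ratio g(h, m) is M_h(m) / M_h(0) with
   M_h(X) = prod_{i<h} nu(X + i) and nu(X) = (-1)^p prod_{0<j<p} (pX + j), and
   Gamma_p(ph) = M_h(0). By Wilson nu = 1 mod p, hence M_(p^s) = 1 mod p^s, so that
   h |-> M_h is 1-Lipschitz from the p-adic metric to the Gauss norm.

   The coefficient of z^(pe+r), r < p, in f_j(ph, pa, z) times Lambda_j is H_r(a_j + e) times
   the coefficient of z^e in f_j(h, a, z), where H_r is a p-integral polynomial when h is
   natural. Hence, with th = z d/dz before z |-> z^p, a solution F of the system of (h, a) gives
   the solution F' = sum_{r<p} z^r (H_r(th) F)(z^p) of the system of (ph, pa). Reducing H_r(th)
   modulo the hypergeometric operator, whose leading coefficient is z - 1, writes F' as a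
   combination of the th^k F with coefficients in Z_p[z, 1/(1-z^p)]; up to the factors p^-k
   these are the entries of U. All the constructions are 1-Lipschitz in (h, a) for the supremum
   norm on coefficients, which is the Gauss norm on such rational functions, so everything
   extends from natural h to h in Z_p and from generic a to all a. The intertwining property
   comes from the contiguity relations between the H_r, and the determinant is nonzero because
   its constant term is. *)

(* For h outside the natural numbers the H_r exist only as limits of polynomials of unbounded
   degree. This is why the reduced rows, which always have n entries, are passed to the limit, and
   not the operators H_r(th). The differential identities are proved for each natural h_N by pure
   algebra and then hold modulo every p^N for h. Each series is carried together with the element of
   E_p that it represents. Since the two norms agree, either component determines the other:
   completeness is used in both at once, and an identity may be checked wherever it is easier. The
   nonvanishing of the determinant cannot be read off at coinciding a_i, where the fixed points no
   longer span. For distinct a_i the matrix without the factors p^-k has a constant term whose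
   determinant has absolute value exactly p^(-n(n-1)/2). This value does not depend on a, so it
   persists in the limit. *)
Require Import Defs.
From HB Require Import structures.
From mathcomp Require Import all_boot all_order all_algebra.
From mathcomp Require Import ring lra zify.
From mathcomp Require Import mathcomp_extra boolp classical_sets functions.
Set Implicit Arguments.
Unset Strict Implicit.
Unset Printing Implicit Defensive.
Import Order.TTheory GRing.Theory Num.Theory.
Local Open Scope ring_scope.

(** * Ultrametric congruences and completions *)

(* [fball e x] stands for |x| <= e. *)
Record filtration (R : comNzRingType) := Filtration {
  fball :> rat -> R -> Prop;
  fball0 : forall e, 0 <= e -> fball e 0;
  fball1 : fball 1 1;
  fballB : forall e x y, fball e x -> fball e y -> fball e (x - y);
  fballM : forall e x y, fball 1 x -> fball e y -> fball e (x * y);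
  fballW : forall d e x, d <= e -> fball d x -> fball e x }.

Arguments av : simpl never.

Section Congruence.
Variables (R : comNzRingType) (B : filtration R) (e : rat).
Hypothesis e0 : 0 <= e.

(** Both sides are required to be integral, because products preserve congruences only between
    elements of the unit ball. *)
Definition cong (x y : R) := [/\ B 1 x, B 1 y & B e (x - y)].

Lemma fballN d x : 0 <= d -> B d x -> B d (- x).
Proof. by move=> d0 hx; rewrite -sub0r; apply: fballB => //; exact: fball0. Qed.

Lemma fballD d x y : 0 <= d -> B d x -> B d y -> B d (x + y).
Proof. by move=> d0 hx hy; rewrite -[y]opprK; apply: fballB => //; exact: fballN. Qed.

Lemma cong_refl x : B 1 x -> cong x x.
Proof. by move=> hx; split=> //; rewrite subrr; exact: fball0. Qed.

Lemma cong_sym x y : cong x y -> cong y x.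
Proof. by case=> hx hy h; split=> //; rewrite -opprB; exact: fballN. Qed.

Lemma cong_trans y x z : cong x y -> cong y z -> cong x z.
Proof.
case=> hx hy h [_ hz h']; split=> //.
by rewrite -(subrK y x) -addrA; apply: fballD.
Qed.

Lemma congD x y x' y' : cong x y -> cong x' y' -> cong (x + x') (y + y').
Proof.
case=> hx hy h [hx' hy' h']; split; try exact: fballD.
by rewrite opprD addrACA; exact: fballD.
Qed.

Lemma congN x y : cong x y -> cong (- x) (- y).
Proof.
case=> hx hy h; split; try exact: fballN.
by rewrite -opprD; exact: fballN.
Qed.

Lemma congB x y x' y' : cong x y -> cong x' y' -> cong (x - x') (y - y').
Proof. by move=> h h'; apply: congD => //; exact: congN. Qed.

Lemma congM x y x' y' : cong x y -> cong x' y' -> cong (x * x') (y * y').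
Proof.
case=> hx hy h [hx' hy' h']; split; try exact: fballM.
have -> : x * x' - y * y' = x' * (x - y) + y * (x' - y') by ring.
by apply: fballD => //; exact: fballM.
Qed.

Lemma cong0 : cong 0 0. Proof. by apply: cong_refl; exact: fball0. Qed.
Lemma cong1 : cong 1 1. Proof. by apply: cong_refl; exact: fball1. Qed.

Lemma congX x y k : cong x y -> cong (x ^+ k) (y ^+ k).
Proof.
move=> h; elim: k => [|k IH]; first by rewrite !expr0; exact: cong1.
by rewrite !exprS; exact: congM.
Qed.

Lemma cong_sum I (r : seq I) (P : pred I) (f g : I -> R) :
  (forall i, P i -> cong (f i) (g i)) ->
  cong (\sum_(i <- r | P i) f i) (\sum_(i <- r | P i) g i).
Proof.
by move=> h; apply: (big_rec2 cong) => [|i x y Pi]; [exact: cong0|exact/congD/h].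
Qed.

Lemma cong_prod I (r : seq I) (P : pred I) (f g : I -> R) :
  (forall i, P i -> cong (f i) (g i)) ->
  cong (\prod_(i <- r | P i) f i) (\prod_(i <- r | P i) g i).
Proof.
by move=> h; apply: (big_rec2 cong) => [|i x y Pi]; [exact: cong1|exact/congM/h].
Qed.

Lemma cong_nat k : cong k%:R k%:R.
Proof. by elim: k => [|k IH]; [exact: cong0|rewrite -addn1 natrD; exact/congD/cong1]. Qed.

End Congruence.

Section AbsvalFiltration.
Variables (R : idomainType) (v : absval R).

Lemma absball0 e : 0 <= e -> v 0 <= e. Proof. by rewrite av0. Qed.
Lemma absball1 : v 1 <= 1. Proof. by rewrite av1. Qed.
Lemma absballB e x y : v x <= e -> v y <= e -> v (x - y) <= e.
Proof. by move=> hx hy; apply: le_trans (avB _ _ _) _; rewrite ge_max hx. Qed.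
Lemma absballD e x y : v x <= e -> v y <= e -> v (x + y) <= e.
Proof. by move=> hx hy; apply: le_trans (avD _ _ _) _; rewrite ge_max hx. Qed.
Lemma absballM e x y : v x <= 1 -> v y <= e -> v (x * y) <= e.
Proof.
move=> hx hy; rewrite avM; apply: le_trans _ hy.
by rewrite ler_piMl ?av_ge0.
Qed.
Lemma absballW d e x : d <= e -> v x <= d -> v x <= e.
Proof. by move=> h1 h2; exact: le_trans h2 h1. Qed.

Definition abs_filtration : filtration R :=
  Filtration absball0 absball1 absballB absballM absballW.

Lemma av_le_eps x : (forall e, 0 < e -> v x <= e) -> x = 0.
Proof.
move=> h; apply/eqP; rewrite -(av_eq0 v) -[_ == _]negbK; apply/negP => n0.
have vp : 0 < v x by rewrite lt_neqAle av_ge0 eq_sym n0.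
have /h : 0 < v x / 2 by rewrite divr_gt0.
lra.
Qed.

Lemma avX x k : v (x ^+ k) = v x ^+ k.
Proof. by elim: k => [|k IH]; rewrite ?expr0 ?av1 // !exprS avM IH. Qed.

Lemma av_prod I (r : seq I) (P : pred I) (f : I -> R) :
  v (\prod_(i <- r | P i) f i) = \prod_(i <- r | P i) v (f i).
Proof. by apply: (big_morph v); [exact: avM|exact: av1]. Qed.

Lemma av_sum_bound I (r : seq I) (P : pred I) (f : I -> R) c : 0 <= c ->
  (forall i, P i -> v (f i) <= c) -> v (\sum_(i <- r | P i) f i) <= c.
Proof.
move=> c0 h; apply: (big_ind (fun x => v x <= c)) => //; first exact: absball0.
by move=> x y; exact: absballD.
Qed.

Lemma abs_cong e x y : v x <= 1 -> v y <= 1 -> v (x - y) <= e -> cong abs_filtration e x y.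
Proof. by []. Qed.

Lemma av_natS (m k : nat) : v (m.+1%:R - k.+1%:R) = v (m%:R - k%:R).
Proof. by congr (v _); rewrite -!natr1 opprD addrACA subrr addr0. Qed.

End AbsvalFiltration.

(** Between units, |1/x - 1/y| = |x - y|. *)
Lemma cong_inv (F : fieldType) (v : absval F) e x y : 0 <= e ->
  v x = 1 -> v y = 1 -> cong (abs_filtration v) e x y ->
  cong (abs_filtration v) e x^-1 y^-1.
Proof.
move=> e0 hx hy [_ _ /= h]; split; rewrite /= ?avV ?hx ?hy ?invr1 //.
have x0 : x != 0 by rewrite -(av_eq0 v) hx oner_eq0.
have y0 : y != 0 by rewrite -(av_eq0 v) hy oner_eq0.
have -> : x^-1 - y^-1 = - (x - y) / (x * y) by field; rewrite x0 y0.
by rewrite avM avN avV avM hx hy mulr1 invr1 mulr1.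
Qed.

Lemma cabsval_lim (F : fieldType) (v : absval F) (u : cauchy v) :
  abs_lim v u (cabsval v (cpi u)).
Proof. exact: cabs_lim. Qed.

Lemma cpiB (F : fieldType) (v : absval F) (a b : cauchy v) : cpi (a - b) = cpi a - cpi b.
Proof. by apply/eqP; rewrite eq_sym subr_eq -cpiD subrK. Qed.

Lemma inv_succ_small (e : rat) : 0 < e ->
  exists N, forall n, (N <= n)%N -> n.+1%:R^-1 < e :> rat.
Proof.
move=> e0; exists (Num.Def.archi_bound e^-1) => n hn.
rewrite -[e]invrK ltf_pV2 ?posrE ?ltr0n ?invr_gt0 //.
apply: (lt_le_trans (archi_boundP _)); first by rewrite invr_ge0 ltW.
by rewrite ler_nat ltnW.
Qed.

Section CompletionTheory.
Variables (F : fieldType) (v : absval F).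
Local Notation C := (completion v).
Local Notation cv := (cabsval v).

Lemma cinjB x y : cinj v (x - y) = cinj v x - cinj v y.
Proof.
rewrite /cinj -cpiB; apply/cpi_eqP => e e0.
by exists 0%N => m _; rewrite /= subrr av0.
Qed.

Lemma cinj_monoid : monoid_morphism (cinj v).
Proof.
split; first by rewrite -cpi1; apply/cpi_eqP => e e0; exists 0%N => m _; rewrite /= subrr av0.
move=> x y; rewrite -cpiM; apply/cpi_eqP => e e0.
by exists 0%N => m _; rewrite /= subrr av0.
Qed.

HB.instance Definition _ := GRing.isZmodMorphism.Build F C (cinj v) cinjB.
HB.instance Definition _ := GRing.isMonoidMorphism.Build F C (cinj v) cinj_monoid.

Lemma crepr_cvg (x : C) e : 0 < e ->
  exists N, forall n, (N <= n)%N -> cv (x - cinj v (crepr x n)) < e.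
Proof.
move=> e0; have e20 : 0 < e / 2 by rewrite divr_gt0.
have [N hN] := cauchyP (crepr x) e20; exists N => n hn.
rewrite -{1}[x]creprK /cinj -cpiB; set u := _ - _.
have [M hM] := @cabsval_lim _ _ u _ e20.
have := hM (maxn N M) (leq_maxr _ _).
have : v (u (maxn N M)) < e / 2 by apply: hN; rewrite ?leq_maxl.
by rewrite ltr_norml /= => ? /andP[? ?]; lra.
Qed.

Lemma cinj_dense (x : C) e : 0 < e -> exists c, cv (x - cinj v c) < e.
Proof. by move=> /(crepr_cvg x) [N /(_ N (leqnn _))]; exists (crepr x N). Qed.

(* Diagonal argument: replace x_n by an element of F at distance < 1/(n+1). *)
Lemma completion_complete (x : nat -> C) : cauchy_seq cv x ->
  exists y, forall e, 0 < e -> exists N, forall n, (N <= n)%N -> cv (x n - y) < e.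
Proof.
move=> hx.
have pos n : 0 < n.+1%:R^-1 :> rat by rewrite invr_gt0 ltr0n.
pose c n := xchoose (cinj_dense (x n) (pos n)).
have hc n : cv (x n - cinj v (c n)) < n.+1%:R^-1 by exact: (xchooseP (cinj_dense (x n) (pos n))).
have cc : cauchy_seq v c.
  move=> e e0; have [N hN] := hx _ e0; have [M hM] := inv_succ_small e0.
  exists (maxn N M) => m n; rewrite !geq_max => /andP[a b] /andP[a' b'].
  rewrite -cabs_cinj rmorphB.
  have -> : cinj v (c m) - cinj v (c n) =
    (x m - x n) - (x m - cinj v (c m)) + (x n - cinj v (c n)) by ring.
  apply: avD_lt; last exact: lt_trans (hc n) (hM _ b').
  apply: avB_lt; [exact: hN|exact: lt_trans (hc m) (hM _ b)].
exists (cpi (mk_cauchy cc)) => e e0.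
have [N hN] := cc _ e0; have [M hM] := inv_succ_small e0.
have e20 : 0 < e / 2 by rewrite divr_gt0.
have [N' hN'] := cc _ e20.
exists (maxn N' M) => n; rewrite geq_max => /andP[a b].
have -> : x n - cpi (mk_cauchy cc) =
  (x n - cinj v (c n)) + (cinj v (c n) - cpi (mk_cauchy cc)) by ring.
apply: avD_lt; first exact: lt_trans (hc n) (hM _ b).
rewrite /cinj -cpiB; set u := _ - _; have [K hK] := @cabsval_lim _ _ u _ e20.
have := hK (maxn N' K) (leq_maxr _ _).
have : v (u (maxn N' K)) < e / 2 by apply: hN'; rewrite ?leq_maxl.
by rewrite ltr_norml /= => ? /andP[? ?]; lra.
Qed.

End CompletionTheory.

Section CompletionMapTheory.
Variables (F F' : fieldType) (v : absval F) (v' : absval F') (f : F -> F').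
Hypothesis f_contr : forall x y, v' (f x - f y) <= v (x - y).
Local Notation cf := (completion_map f_contr).
Local Notation cv := (cabsval v).
Local Notation cv' := (cabsval v').

Lemma completion_map_contr x y : cv' (cf x - cf y) <= cv (x - y).
Proof.
rewrite -[x]creprK -[y]creprK !completion_map_cpi -!cpiB.
set a := _ - _; set b := _ - _.
rewrite leNgt; apply/negP => h.
have e0 : 0 < (cabsval v' (cpi a) - cabsval v (cpi b)) / 2 by rewrite divr_gt0 // subr_gt0.
have [N hN] := @cabsval_lim _ _ a _ e0; have [M hM] := @cabsval_lim _ _ b _ e0.
have := hN (maxn N M) (leq_maxl _ _); have := hM (maxn N M) (leq_maxr _ _).
have : v' (a (maxn N M)) <= v (b (maxn N M)) by apply: f_contr.
rewrite !ltr_norml /= => ? /andP[? ?] /andP[? ?]; lra.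
Qed.

End CompletionMapTheory.

Lemma cpi_ptw (F : fieldType) (v : absval F) (u w : cauchy v) :
  (forall n, u n = w n) -> cpi u = cpi w.
Proof.
move=> h; apply/cpi_eqP => e e0; exists 0%N => m _.
by change (v (u m - w m) < e); rewrite h subrr av0.
Qed.

Section CompletionMapMorphism.
Variables (F F' : fieldType) (v : absval F) (v' : absval F') (f : F -> F').
Hypothesis f_contr : forall x y, v' (f x - f y) <= v (x - y).
Local Notation cf := (completion_map f_contr).

Lemma completion_mapB : {morph f : x y / x - y} -> {morph cf : x y / x - y}.
Proof.
move=> fB x y; rewrite -[x]creprK -[y]creprK -cpiB !completion_map_cpi -cpiB.
by apply: cpi_ptw => n; exact: fB.
Qed.

Lemma completion_mapM : {morph f : x y / x * y} -> {morph cf : x y / x * y}.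
Proof.
move=> fM x y; rewrite -[x]creprK -[y]creprK -cpiM !completion_map_cpi -cpiM.
by apply: cpi_ptw => n; exact: fM.
Qed.

Lemma completion_map1 : f 1 = 1 -> cf 1 = 1.
Proof.
by move=> f1; rewrite -(rmorph1 (cinj v)) completion_map_cinj f1 rmorph1.
Qed.

End CompletionMapMorphism.

Lemma completion_map_leibniz (F : fieldType) (v : absval F) (f : F -> F)
    (f_contr : forall x y, v (f x - f y) <= v (x - y)) :
  (forall x y, f (x * y) = f x * y + x * f y) ->
  forall x y, completion_map f_contr (x * y) =
    completion_map f_contr x * y + x * completion_map f_contr y.
Proof.
move=> fM x y; rewrite -[x]creprK -[y]creprK -cpiM !completion_map_cpi -!cpiM -cpiD.
by apply: cpi_ptw => n; exact: fM.
Qed.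

(** * Leibniz rules and constants in Q(z) and E_p *)

Section RatFunTheory.
Variable F : fieldType.
Local Notation K := {fraction {poly F}}.
Local Notation toK := (@FracField.tofrac {poly F}).

Lemma zderivM (r s : K) : zderiv (r * s) = zderiv r * s + r * zderiv s.
Proof.
rewrite {1}(rnum_rden r) {1}(rnum_rden s) [in RHS]/zderiv.
rewrite [X in _ + X * _]rnum_rden [X in _ * X + _]rnum_rden.
move: (rden_neq0 r) (rden_neq0 s).
move: (rnum r) (rden r) (rnum s) (rden s) => P Q N M Q0 M0.
rewrite !mulf_div -!rmorphM zderivE ?mulf_neq0 //.
rewrite addf_div ?tofrac_eq0 ?mulf_neq0 ?expf_neq0 // -!rmorphM -rmorphD; apply/eqP.
rewrite eqr_div ?tofrac_eq0 ?mulf_neq0 ?expf_neq0 // -!rmorphM; apply/eqP.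
congr (toK _); rewrite !derivM; ring.
Qed.

Lemma zderiv_poly P : zderiv (toK P) = toK ('X * P^`()).
Proof.
rewrite -[toK P]divr1 -[1 in LHS]tofrac1 zderivE ?oner_eq0 //.
by rewrite expr1n -polyC1 derivC mulr0 subr0 mulr1 rmorph1 divr1.
Qed.

End RatFunTheory.

Section EpTheory.
Variables (p : nat) (hp : prime p).
Local Notation K := (Q_p hp).
Local Notation E := (E_p hp).
Local Notation vp := (padic_abs hp).
Local Notation toK := (@FracField.tofrac {poly rat}).

Lemma const_E_zmod : zmod_morphism (const_E (hp := hp)).
Proof. by apply: completion_mapB => x y; rewrite -tofracB -polyCB. Qed.

Lemma const_E_monoid : monoid_morphism (const_E (hp := hp)).
Proof.
split; first by apply: completion_map1; rewrite polyC1 tofrac1.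
by apply: completion_mapM => x y; rewrite -tofracM -polyCM.
Qed.

HB.instance Definition _ := GRing.isZmodMorphism.Build K E (const_E (hp := hp)) const_E_zmod.
HB.instance Definition _ := GRing.isMonoidMorphism.Build K E (const_E (hp := hp)) const_E_monoid.

Lemma const_E_cinj c : const_E (cinj vp c) = ratfun_to_E hp (toK c%:P).
Proof. exact: completion_map_cinj. Qed.

Lemma const_E_contr x : Eabs hp (const_E x) <= pabs hp x.
Proof.
have h : Eabs hp (const_E x - const_E 0) <= pabs hp (x - 0) by exact: completion_map_contr.
by rewrite rmorph0 !subr0 in h.
Qed.

Lemma ratfun_to_E_zmod : zmod_morphism (ratfun_to_E hp).
Proof. exact: rmorphB. Qed.

Lemma ratfun_to_E_monoid : monoid_morphism (ratfun_to_E hp).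
Proof. exact: cinj_monoid. Qed.

HB.instance Definition _ :=
  GRing.isZmodMorphism.Build (ratfun : fieldType) E (ratfun_to_E hp) ratfun_to_E_zmod.
HB.instance Definition _ :=
  GRing.isMonoidMorphism.Build (ratfun : fieldType) E (ratfun_to_E hp) ratfun_to_E_monoid.

Lemma Eabs_ratfun r : Eabs hp (ratfun_to_E hp r) = gauss_abs vp r.
Proof. exact: cabs_cinj. Qed.

Lemma DE_zmod : {morph (@DE p hp) : x y / x - y}.
Proof. by apply: completion_mapB => x y; exact: zderivB. Qed.

Lemma DE_contr x : Eabs hp (DE x) <= Eabs hp x.
Proof.
have D0 : @DE p hp 0 = 0 by rewrite -[X in DE X](subrr 0) DE_zmod subrr.
have h : Eabs hp (DE x - DE 0) <= Eabs hp (x - 0) by exact: completion_map_contr.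
by rewrite D0 !subr0 in h.
Qed.

Lemma DE_ratfun r : DE (ratfun_to_E hp r) = ratfun_to_E hp (zderiv r).
Proof. exact: completion_map_cinj. Qed.

Lemma DEM x y : DE (x * y) = DE x * y + x * DE y :> E.
Proof.
exact: (completion_map_leibniz (zderiv_contr vp) (@zderivM _)).
Qed.

Lemma DE_const c : DE (const_E c : E) = 0.
Proof.
rewrite -[c]creprK /const_E /DE !completion_map_cpi; apply/cpi_eq0P => e e0.
exists 0%N => m _.
change (gauss_abs vp (zderiv (toK (crepr c m)%:P)) < e).
by rewrite zderiv_poly derivC mulr0 tofrac0 av0.
Qed.

End EpTheory.

(** * The field of p-adic numbers *)

Section PadicNumbers.
Variables (p : nat) (hp : prime p).
Local Notation K := (Q_p hp).
Local Notation v := (pabs hp).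
Local Notation vp := (padic_abs hp).

Let p_gt0 : 0 < p%:R :> rat. Proof. by rewrite ltr0n prime_gt0. Qed.
Let pi : rat := p%:R^-1.
Let pi_gt0 : 0 < pi. Proof. by rewrite invr_gt0. Qed.

Lemma padic_abs_int (m : int) : vp m%:~R = padic_int_abs p m.
Proof.
have -> : m%:~R = m%:~R / 1%:~R :> rat by rewrite divr1.
have := fabsE (padic_intval hp) (i := intr) intr_inj denq_neq0 rat_num_den m (oner_neq0 _).
by move=> h; apply: (etrans h); rewrite av1 divr1.
Qed.

Lemma pabs_int (m : int) : v m%:~R = padic_int_abs p m.
Proof. by rewrite -padic_abs_int -(cabs_cinj vp) rmorph_int. Qed.

Lemma pabs_nat (m : nat) : v m%:R = padic_int_abs p m.
Proof. by rewrite -pabs_int -pmulrn. Qed.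

Lemma pabs_int_le (m : int) s : (v m%:~R <= pi ^+ s) = (p ^ s %| `|m|)%N.
Proof. by rewrite pabs_int exprVn padic_int_leP. Qed.

Lemma pabs_p : v p%:R = pi.
Proof.
rewrite pabs_nat /padic_int_abs -[_ == 0]/(p == 0%N) gtn_eqF ?prime_gt0 //.
by rewrite absz_nat logn_prime // eqxx expr1.
Qed.

Lemma pabs_nat_coprime (m : nat) : ~~ (p %| m)%N -> v m%:R = 1.
Proof.
move=> h; rewrite pabs_nat /padic_int_abs; case: eqP => [[m0]|_].
  by rewrite m0 dvdn0 in h.
by rewrite absz_nat lognE (negbTE h) !andbF expr0 invr1.
Qed.

Lemma pabs_int_coprime (m : int) : ~~ (p %| `|m|)%N -> v m%:~R = 1.
Proof.
move=> h; rewrite pabs_int /padic_int_abs lognE (negbTE h) !andbF expr0 invr1.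
by case: eqP h => // ->; rewrite absz0 dvdn0.
Qed.

Lemma pabs_nat_le1 (m : nat) : v m%:R <= 1. Proof. exact: av_nat. Qed.

Lemma Qp_natr_eq0 (m : nat) : (m%:R == 0 :> K) = (m == 0%N).
Proof. by rewrite -(av_eq0 v) pabs_nat padic_int_eq0. Qed.

Lemma Qp_p_neq0 : p%:R != 0 :> K.
Proof. by rewrite Qp_natr_eq0 gtn_eqF ?prime_gt0. Qed.

Lemma pabs_p_le1 : pi <= 1.
Proof. by rewrite -pabs_p pabs_nat_le1. Qed.

Lemma pabs_p_lt1 : pi < 1.
Proof. by rewrite invf_lt1 // ltr1n prime_gt1. Qed.

Lemma small_power (e : rat) : 0 < e -> exists s, pi ^+ s < e.
Proof.
move=> e0; exists (Num.Def.archi_bound e^-1).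
set N := Num.Def.archi_bound _.
rewrite exprVn -[e]invrK ltf_pV2 ?posrE ?exprn_gt0 ?invr_gt0 //.
apply: (lt_le_trans (archi_boundP _)); first by rewrite invr_ge0 ltW.
by rewrite -natrX ler_nat ltnW // ltn_expl ?prime_gt1.
Qed.

(** A rational c close to x is p-integral, so its reduced denominator is prime to p. Multiplying its
    numerator by a Bezout inverse of the denominator modulo p^s gives an integer close to c. *)
Lemma Zp_nat_dense (x : K) e : x \in Z_p -> 0 < e ->
  exists2 m : nat, (0 < m)%N & v (m%:R - x) < e.
Proof.
rewrite inE => hx e0.
have [s hs] := small_power e0.
have ps0 : 0 < pi ^+ s by rewrite exprn_gt0.
have [c hc] := cinj_dense x ps0.
have c1 : v (cinj vp c) <= 1.
  rewrite -(subKr x (cinj vp c)); apply: le_trans (avB _ _ _) _.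
  by rewrite ge_max hx (ltW (lt_le_trans hc _)) // exprn_ile1 // ?pabs_p_le1 ?ltW.
have cden : cinj vp c * (denq c)%:~R = (numq c)%:~R.
  rewrite -(rmorph_int (cinj vp)) -rmorphM {1}[c]rat_num_den divfK ?intr_eq0 ?denq_neq0 //.
  by rewrite rmorph_int.
have pden : ~~ (p %| `|denq c|)%N.
  apply/negP => hd; have cn := coprime_num_den c.
  have hn : ~~ (p %| `|numq c|)%N.
    apply/negP => hn; have : (p %| gcdn `|numq c| `|denq c|)%N by rewrite dvdn_gcd hn hd.
    by move: cn; rewrite /coprime => /eqP ->; rewrite dvdn1 => /eqP p1; move: hp; rewrite p1.
  have hden : v (denq c)%:~R < 1.
    apply: le_lt_trans pabs_p_lt1; rewrite -[pi]expr1 pabs_int_le.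
    by rewrite expn1.
  have : v (cinj vp c * (denq c)%:~R) = 1 by rewrite cden pabs_int_coprime.
  rewrite avM => h; move: hden; rewrite -h => hden.
  by have := ler_piMl (av_ge0 v (denq c)%:~R) c1; rewrite leNgt hden.
have d0 : (0 < `|denq c|)%N by rewrite absz_gt0 denq_neq0.
have [u w uw _] := egcdnP (p ^ s) d0.
have cpd : coprime `|denq c| (p ^ s) by rewrite coprime_sym coprimeXl // prime_coprime.
rewrite (eqP cpd) in uw.
pose m0 := ((numq c * u%:Z) %% (p ^ s)%N%:Z)%Z.
have pk0 : (0 < p ^ s)%N by rewrite expn_gt0 prime_gt0.
have m0ge : 0 <= m0 by rewrite modz_ge0 // eqz_nat -lt0n.
(* Adding p^s makes the residue positive within its class; positivity is needed for the first
   argument of [g_nat]. *)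
exists (`|m0| + p ^ s)%N; first by rewrite addn_gt0 pk0 orbT.
apply: le_lt_trans hs.
set m := (_ + _)%N.
have -> : m%:R - x = (m%:R - cinj vp c) - (x - cinj vp c) by ring.
apply: (absballB (v := v)); last exact: ltW.
have -> : v (m%:R - cinj vp c) = v (m%:Z * denq c - numq c)%:~R.
  have -> : (m%:Z * denq c - numq c)%:~R = (m%:R - cinj vp c) * (denq c)%:~R.
    by rewrite mulrBl cden rmorphB rmorphM /= -pmulrn.
  by rewrite avM (pabs_int_coprime pden) mulr1.
rewrite pabs_int_le; suff : ((p ^ s)%N%:Z %| m%:Z * denq c - numq c)%Z by [].
have dE : denq c = `|denq c|%N%:Z by rewrite gez0_abs // ltW // denq_gt0.
have -> : m%:Z = m0 + (p ^ s)%N%:Z by rewrite /m PoszD gez0_abs.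
have -> : m0 = numq c * u%:Z - (numq c * u%:Z %/ (p ^ s)%N%:Z)%Z * (p ^ s)%N%:Z.
  by [].
have uwz : u%:Z * denq c = w%:Z * (p ^ s)%N%:Z + 1 by rewrite dE -PoszM uw PoszD PoszM.
set q := (_ %/ _)%Z; set ps := (p ^ s)%N%:Z in uwz *.
have -> : (numq c * u%:Z - q * ps + ps) * denq c - numq c =
   (numq c * w%:Z + (1 - q) * denq c) * ps.
  transitivity (numq c * (u%:Z * denq c) + (1 - q) * ps * denq c - numq c); first by ring.
  by rewrite uwz; ring.
exact: dvdz_mull.
Qed.

Lemma Qp_int_inj : injective (fun m : int => m%:~R : K).
Proof.
move=> m k /eqP; rewrite -subr_eq0 -rmorphB -(av_eq0 v) pabs_int padic_int_eq0 //.
by rewrite subr_eq0 => /eqP.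
Qed.

(* The points b_i = m_i + p^N i / q, with m_i an integer close to a_i and q > n a prime
   different from p, have no integral differences. *)
Lemma generic_dense n (a : 'I_n -> K) e : (forall i, a i \in Z_p) -> 0 < e ->
  exists b, near_within (@generic p hp n) a e b.
Proof.
move=> ha e0; have [N hN] := small_power e0.
have [q hq pq] := prime_above (maxn n p).
move: hq; rewrite gtn_max => /andP[nq hqp].
have hm i := Zp_nat_dense (ha i) e0.
pose m i : nat := s2val (cid2 (hm i)).
have mP i : v ((m i)%:R - a i) < e by rewrite /m; case: (cid2 _).
have vq : v q%:R = 1.
  rewrite pabs_nat_coprime //; apply/negP; rewrite dvdn_prime2 // => /eqP pq'.
  by move: hqp; rewrite pq' ltnn.
have q0 : q%:R != 0 :> K by rewrite -(av_eq0 v) vq oner_eq0.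
pose t (i : 'I_n) : K := p%:R ^+ N * i%:R / q%:R.
have ht i : v (t i) <= pi ^+ N.
  by rewrite /t !avM avV vq invr1 mulr1 avX pabs_p ler_piMr ?pabs_nat_le1 // exprn_ge0 // ltW.
have tb i : v (t i) < e by apply: le_lt_trans hN.
exists (fun i => (m i)%:R + t i); split => [i|i j ij k|i].
- rewrite inE; apply: le_trans (avD _ _ _) _.
  rewrite ge_max pabs_nat_le1 (le_trans (ht i)) // exprn_ile1 ?pabs_p_le1 //; exact: ltW.
- apply/negP => /eqP h.
  have : (q%:Z * (k - (m i)%:Z + (m j)%:Z))%:~R = ((p ^ N)%N%:Z * (i%:Z - j%:Z))%:~R :> K.
    rewrite !rmorphM !rmorphD /= !rmorphN /= -h -!pmulrn natrX /t.
    have lin (F : fieldType) (x y z s s' c : F) : c != 0 ->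
      c * ((x + z * s / c) - (y + z * s' / c) - x + y) = z * (s - s') by move=> c0; field.
    exact: lin.
  move/Qp_int_inj => hZ.
  have : (q%:Z %| (p ^ N)%N%:Z * (i%:Z - j%:Z))%Z by rewrite -hZ dvdz_mulr.
  rewrite dvdzE abszM absz_nat [`|Posz _|%N]absz_nat Euclid_dvdM // Euclid_dvdX //.
  rewrite dvdn_prime2 // gtn_eqF //= => hd.
  have ijn : `|i%:Z - j%:Z|%N != 0%N by rewrite absz_eq0 subr_eq0 eqz_nat.
  have : (q <= `|i%:Z - j%:Z|)%N by apply: dvdn_leq; rewrite ?lt0n.
  have := ltn_ord i; have := ltn_ord j; move: nq; clear; lia.
- have -> : (m i)%:R + t i - a i = ((m i)%:R - a i) + t i by ring.
  exact: avD_lt.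
Qed.

End PadicNumbers.

(** * Power series and the elements of E_p that they represent *)

Definition ps (R : comNzRingType) : Type := nat -> R.
HB.instance Definition _ R := GRing.Zmodule.on (ps R).

Section PowerSeries.
Variable R : comNzRingType.
Implicit Types f g h : ps R.

Definition ps_one : ps R := fun d => (d == 0%N)%:R.
Definition ps_mul f g : ps R := fun d => \sum_(k < d.+1) f k * g (d - k)%N.
Definition ps_of_poly (P : {poly R}) : ps R := fun d => P`_d.
Definition ps_trunc m f : {poly R} := \poly_(i < m) f i.

(** The ring laws of power series are inherited from polynomials by truncating beyond the degree in
    question. *)
Lemma ps_mulE m f g d : (d < m)%N -> ps_mul f g d = (ps_trunc m f * ps_trunc m g)`_d.
Proof.
move=> dm; rewrite coefM; apply: eq_bigr => k _.
have km : (k < m)%N by apply: leq_ltn_trans dm; rewrite -ltnS.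
by rewrite !coef_poly km (leq_ltn_trans (leq_subr _ _) dm).
Qed.

Lemma ps_coefM_trunc m f (P Q : {poly R}) d : (d < m)%N ->
  (forall k, (k < m)%N -> P`_k = Q`_k) ->
  (ps_trunc m f * P)`_d = (ps_trunc m f * Q)`_d.
Proof.
move=> dm h; rewrite !coefM; apply: eq_bigr => k _; rewrite h //.
exact: leq_ltn_trans (leq_subr _ _) dm.
Qed.

Lemma ps_trunc_mul m f g k : (k < m)%N ->
  (ps_trunc m (ps_mul f g))`_k = (ps_trunc m f * ps_trunc m g)`_k.
Proof. by move=> km; rewrite coef_poly km; exact: ps_mulE. Qed.

Lemma ps_mulC : commutative ps_mul.
Proof. by move=> f g; apply/funext => d; rewrite !(@ps_mulE d.+1) // mulrC. Qed.

Lemma ps_mulA : associative ps_mul.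
Proof.
move=> f g h; apply/funext => d; rewrite !(@ps_mulE d.+1) //.
have e1 := @ps_coefM_trunc d.+1 f _ (ps_trunc d.+1 g * ps_trunc d.+1 h) d (leqnn _)
  (fun k => @ps_trunc_mul _ g h k).
have e2 := @ps_coefM_trunc d.+1 h _ (ps_trunc d.+1 f * ps_trunc d.+1 g) d (leqnn _)
  (fun k => @ps_trunc_mul _ f g k).
have c (P Q : {poly R}) : (P * Q)`_d = (Q * P)`_d by rewrite mulrC.
by rewrite e1 [RHS]c e2 mulrA c.
Qed.

Lemma ps_mul1 : left_id ps_one ps_mul.
Proof.
move=> f; apply/funext => d; rewrite /ps_mul big_ord_recl big1 ?addr0 => [|i _].
  by rewrite /ps_one eqxx mul1r subn0.
by rewrite /ps_one mul0r.
Qed.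

Lemma ps_mulD : left_distributive ps_mul +%R.
Proof.
move=> f g h; apply/funext => d; rewrite /ps_mul.
change ((\sum_(k < d.+1) (f k + g k) * h (d - k)%N) =
  (\sum_(k < d.+1) f k * h (d - k)%N) + (\sum_(k < d.+1) g k * h (d - k)%N)).
by rewrite -big_split; apply: eq_bigr => k _; rewrite mulrDl.
Qed.

Lemma ps_one_neq0 : ps_one != 0.
Proof. by apply/eqP => /(congr1 (fun f : ps R => f 0%N)) /eqP; rewrite /ps_one eqxx oner_eq0. Qed.

HB.instance Definition _ :=
  GRing.Zmodule_isComNzRing.Build (ps R) ps_mulA ps_mulC ps_mul1 ps_mulD ps_one_neq0.

Lemma psM f g d : (f * g) d = \sum_(k < d.+1) f k * g (d - k)%N. Proof. by []. Qed.
Lemma psB f g d : (f - g) d = f d - g d. Proof. by []. Qed.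
Lemma psD f g d : (f + g) d = f d + g d. Proof. by []. Qed.
Lemma ps1 d : (1 : ps R) d = (d == 0%N)%:R. Proof. by []. Qed.

Lemma ps_sum I (r : seq I) (P : pred I) (F : I -> ps R) d :
  (\sum_(i <- r | P i) F i) d = \sum_(i <- r | P i) F i d.
Proof. by elim/big_rec2: _ => // i y1 y2 _ <-. Qed.

Lemma ps_of_poly_zmod : zmod_morphism ps_of_poly.
Proof. by move=> P Q; apply/funext => d; rewrite /ps_of_poly coefB. Qed.
Lemma ps_of_poly_monoid : monoid_morphism ps_of_poly.
Proof.
split; first by apply/funext => d; rewrite /ps_of_poly coef1.
by move=> P Q; apply/funext => d; rewrite /ps_of_poly coefM.
Qed.
HB.instance Definition _ := GRing.isZmodMorphism.Build {poly R} (ps R) ps_of_poly ps_of_poly_zmod.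
HB.instance Definition _ := GRing.isMonoidMorphism.Build {poly R} (ps R) ps_of_poly ps_of_poly_monoid.

Definition ps_coef0 f : R := f 0%N.
Lemma ps_coef0_zmod : zmod_morphism ps_coef0. Proof. by []. Qed.
Lemma ps_coef0_monoid : monoid_morphism ps_coef0.
Proof. by split=> // f g; rewrite /ps_coef0 psM big_ord_recl big_ord0 addr0. Qed.
HB.instance Definition _ := GRing.isZmodMorphism.Build (ps R) R ps_coef0 ps_coef0_zmod.
HB.instance Definition _ := GRing.isMonoidMorphism.Build (ps R) R ps_coef0 ps_coef0_monoid.

Definition ps_D f : ps R := fun d => f d *+ d.

Lemma ps_DB : {morph ps_D : f g / f - g}.
Proof. by move=> f g; apply/funext => d; rewrite psB /ps_D psB mulrnBl. Qed.

Lemma ps_DM f g : ps_D (f * g) = ps_D f * g + f * ps_D g.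
Proof.
apply/funext => d; rewrite psD !psM /ps_D psM -big_split -sumrMnl.
apply: eq_bigr => k _ /=; rewrite mulrnAl mulrnAr -mulrnDr subnKC //.
by rewrite -ltnS.
Qed.

Lemma ps_D_poly P : ps_D (ps_of_poly P) = ps_of_poly ('X * P^`()).
Proof.
apply/funext => -[|d]; rewrite /ps_D /ps_of_poly coefXM //=.
by rewrite coef_deriv.
Qed.

Definition ps_const (c : R) : ps R := ps_of_poly c%:P.
(** The Taylor series of 1 / (1 - z^p). *)
Definition ps_geom (p : nat) : ps R := fun d => (p %| d)%N%:R.

Lemma ps_constM c f d : (ps_const c * f) d = c * f d.
Proof.
rewrite psM big_ord_recl big1 ?addr0 => [|i _].
  by rewrite /ps_const /ps_of_poly coefC eqxx subn0.
by rewrite /ps_const /ps_of_poly coefC mul0r.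
Qed.

Lemma ps_XnM k f d : (ps_of_poly 'X^k * f) d = if (k <= d)%N then f (d - k)%N else 0.
Proof.
rewrite psM /ps_of_poly; under eq_bigr do rewrite coefXn.
case: leqP => kd; last first.
  rewrite big1 // => i _; case: eqP => [ik|]; last by rewrite mul0r.
  by move: (ltn_ord i); rewrite ik ltnS leqNgt kd.
have kd' : (k < d.+1)%N by rewrite ltnS.
rewrite (bigD1 (Ordinal kd')) //= eqxx mul1r big1 ?addr0 // => i ik.
by have /negbTE -> : (i : nat) != k by []; rewrite mul0r.
Qed.

Lemma ps_geomP p : (0 < p)%N -> ps_geom p * ps_of_poly (1 - 'X^p) = 1.
Proof.
move=> p0; rewrite rmorphB rmorph1 mulrBr mulr1 mulrC; apply/funext => d.
rewrite psB ps_XnM ps1 /ps_geom; case: leqP => pd.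
  rewrite -{1}(subnK pd) dvdn_addl // subrr.
  by rewrite gtn_eqF // (leq_trans p0).
rewrite subr0; case: d pd => [|d] pd; first by rewrite dvdn0.
by rewrite gtnNdvd.
Qed.

End PowerSeries.

Section SeriesRing.
Variables (p : nat) (hp : prime p).
Local Notation K := (Q_p hp).
Local Notation E := (E_p hp).
Local Notation v := (pabs hp).
Local Notation vp := (padic_abs hp).
Local Notation ve := (Eabs hp).
Local Notation toK := (@FracField.tofrac {poly rat}).
Local Notation rE := (ratfun_to_E hp).

(* [t] is the Taylor series of P / Q. For such Q the Gauss norm of P / Q is the
   supremum norm of t. *)
Definition unit_taylor (P Q : {poly rat}) (t : ps rat) : Prop :=
  [/\ Q`_0 = 1, gauss vp Q <= 1 & t * ps_of_poly Q = ps_of_poly P].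

Lemma unit_taylor_den P Q t : unit_taylor P Q t -> Q != 0.
Proof. by case=> h _ _; apply/eqP => Q0; move/eqP: h; rewrite Q0 coef0 eq_sym oner_eq0. Qed.

Lemma unit_taylor_gauss P Q t : unit_taylor P Q t -> gauss_abs vp (toK P / toK Q) = gauss vp P.
Proof.
move=> h; rewrite gauss_absE ?(unit_taylor_den h) //; case: h => h1 h2 _.
have -> : gauss vp Q = 1; last by rewrite divr1.
by apply/eqP; rewrite eq_le h2 -[1](av1 vp) -h1 gauss_coef.
Qed.

(** P = tQ bounds P by t. Conversely, the constant term 1 of Q makes the division P / Q a recursion
    on the coefficients of t without denominators. *)
Lemma unit_taylor_le P Q t c : 0 <= c -> unit_taylor P Q t ->
  (forall d, vp (t d) <= c) <-> gauss vp P <= c.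
Proof.
move=> c0 [h1 h2 h]; split => [ht|hP].
  apply: gauss_le => // d; have -> : P`_d = (t * ps_of_poly Q) d by rewrite h.
  rewrite psM; apply: av_sum_le => // k _; rewrite avM -[c]mulr1.
  apply: ler_pM; rewrite ?av_ge0 //; exact: le_trans (gauss_coef _ _ _) h2.
move=> d; elim/ltn_ind: d => d IH.
have := congr1 (fun f : ps rat => f d) h; rewrite psM big_ord_recr /= subnn /ps_of_poly h1 mulr1.
move=> hd; have -> : t d = P`_d - \sum_(i < d) t i * Q`_(d - i) by rewrite -hd addrAC subrr add0r.
apply: absballB; first exact: le_trans (gauss_coef _ _ _) hP.
apply: av_sum_le => // k _; rewrite avM -[c]mulr1.
apply: ler_pM; rewrite ?av_ge0 // ?IH //; exact: le_trans (gauss_coef _ _ _) h2.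
Qed.

Lemma gauss_mul_le1 (P Q : {poly rat}) : gauss vp P <= 1 -> gauss vp Q <= 1 -> gauss vp (P * Q) <= 1.
Proof. by move=> h1 h2; rewrite gaussM -[1]mulr1; apply: ler_pM; rewrite ?gauss_ge0. Qed.

Lemma unit_taylor_poly P : unit_taylor P 1 (ps_of_poly P).
Proof. by split; rewrite ?coef1 // ?rmorph1 ?mulr1 // -polyC1 gaussC av1. Qed.

Lemma unit_taylorB P Q t P' Q' t' : unit_taylor P Q t -> unit_taylor P' Q' t' ->
  unit_taylor (P * Q' - P' * Q) (Q * Q') (t - t').
Proof.
move=> [h1 h2 h3] [h1' h2' h3']; split.
- by rewrite coefM big_ord_recl big_ord0 addr0 h1 h1' mulr1.
- exact: gauss_mul_le1.
- by rewrite rmorphB !rmorphM /= -h3 -h3'; ring.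
Qed.

Lemma unit_taylorM P Q t P' Q' t' : unit_taylor P Q t -> unit_taylor P' Q' t' ->
  unit_taylor (P * P') (Q * Q') (t * t').
Proof.
move=> [h1 h2 h3] [h1' h2' h3']; split.
- by rewrite coefM big_ord_recl big_ord0 addr0 h1 h1' mulr1.
- exact: gauss_mul_le1.
- by rewrite !rmorphM /= -h3 -h3'; ring.
Qed.

Lemma unit_taylorD P Q t : unit_taylor P Q t ->
  unit_taylor ('X * (P^`() * Q - P * Q^`())) (Q ^+ 2) (ps_D t).
Proof.
move=> [h1 h2 h3]; split.
- by rewrite expr2 coefM big_ord_recl big_ord0 addr0 h1 mulr1.
- by rewrite expr2; exact: gauss_mul_le1.
have := congr1 (@ps_D _) h3; rewrite ps_DM !ps_D_poly => h.
have -> : 'X * (P^`() * Q - P * Q^`()) = ('X * P^`()) * Q - P * ('X * Q^`()) by ring.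
have e (A B : {poly rat}) : ps_of_poly (A * Q - P * B) =
  ps_of_poly A * ps_of_poly Q - ps_of_poly P * ps_of_poly B by rewrite rmorphB !rmorphM.
rewrite e rmorphXn /= -h -h3.
by rewrite mulrDl expr2 mulrA [t * _ * _ in RHS]mulrAC addrK.
Qed.

(** Only the denominators of [unit_taylor] are allowed. They suffice for z, the constants and 1 / (1
    - z^p), and for them the norms of the two components can be compared. *)
Definition approximable (x : ps K * E) : Prop := forall e, 0 < e ->
  exists P Q t, [/\ unit_taylor P Q t, ve (rE (toK P / toK Q) - x.2) < e &
    forall d, v (cinj vp (t d) - x.1 d) < e].

Lemma approximable_ratfun P Q t : unit_taylor P Q t ->
  approximable (fun d => cinj vp (t d), rE (toK P / toK Q)).
Proof.
by move=> h e e0; exists P, Q, t; split=> // [|d]; rewrite /= subrr av0.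
Qed.

Lemma approximable_bound x : approximable x -> exists2 c, 0 < c &
  ve x.2 <= c /\ forall d, v (x.1 d) <= c.
Proof.
move=> /(_ 1 ltr01) [P [Q [t [h hE hd]]]].
exists (1 + gauss vp P); first by rewrite ltr_pwDl ?ltr01 ?gauss_ge0.
have g0 := gauss_ge0 vp P; split=> [|d].
  rewrite -(subKr (rE (toK P / toK Q)) x.2); apply: absballB.
    by rewrite Eabs_ratfun (unit_taylor_gauss h); lra.
  by apply: le_trans (ltW hE) _; lra.
rewrite -(subKr (cinj vp (t d)) (x.1 d)); apply: absballB; last first.
  by apply: le_trans (ltW (hd d)) _; lra.
rewrite cabs_cinj; apply: (@le_trans _ _ (gauss vp P)); last by lra.
by move: d {hd}; apply/(unit_taylor_le g0 h).
Qed.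

Lemma approximableB x y : approximable x -> approximable y -> approximable (x - y).
Proof.
move=> hx hy e e0; have [P [Q [t [h hE hd]]]] := hx e e0.
have [P' [Q' [t' [h' hE' hd']]]] := hy e e0.
exists (P * Q' - P' * Q), (Q * Q'), (t - t'); split; first exact: unit_taylorB.
  have -> : toK (P * Q' - P' * Q) / toK (Q * Q') = toK P / toK Q - toK P' / toK Q'.
    rewrite -[X in _ = _ + X]mulNr addf_div ?tofrac_eq0 ?(unit_taylor_den h) ?(unit_taylor_den h') //.
    by rewrite rmorphB !rmorphM mulNr.
  rewrite rmorphB /=; have -> : forall a b c d : E, a - b - (c - d) = (a - c) - (b - d) by move=> *; ring.
  exact: avB_lt.
move=> d; rewrite psB rmorphB /=.
have -> : forall a b c d : K, a - b - (c - d) = (a - c) - (b - d) by move=> *; ring.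
exact: avB_lt.
Qed.

Lemma approximableM x y : approximable x -> approximable y -> approximable (x * y).
Proof.
move=> hx hy e e0.
have [c c0 [cE cd]] := approximable_bound hx.
have [c' c0' [cE' cd']] := approximable_bound hy.
(* The error is (a - a')(b - b') + (a - a') b' + a' (b - b'): the bounds 1 and e / 2 control the
   first term, the last bound controls the other two. *)
pose e1 := Num.min (Num.min 1 (e / 2)) (e / (2 * (c + c' + 1))).
have cc : 0 < 2 * (c + c' + 1) by lra.
have e10 : 0 < e1 by rewrite !lt_min ltr01 !divr_gt0.
have close (L : fieldType) (w : absval L) (a b a' b' : L) : w a' <= c -> w b' <= c' ->
    w (a - a') < e1 -> w (b - b') < e1 -> w (a * b - a' * b') < e.
  move=> ha hb; rewrite !lt_min !ltr_pdivlMr // => /andP[/andP[h1 h2] h3] /andP[/andP[h4 h5] h6].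
  have -> : a * b - a' * b' = (a - a') * (b - b') + (a - a') * b' + a' * (b - b') by ring.
  have w1 := av_ge0 w (a - a'); have w2 := av_ge0 w (b - b').
  have w3 := av_ge0 w a'; have w4 := av_ge0 w b'.
  apply: avD_lt; [apply: avD_lt|]; rewrite avM; nra.
have [P [Q [t [h hE hd]]]] := hx e1 e10.
have [P' [Q' [t' [h' hE' hd']]]] := hy e1 e10.
exists (P * P'), (Q * Q'), (t * t'); split; first exact: unit_taylorM.
  have -> : toK (P * P') / toK (Q * Q') = toK P / toK Q * (toK P' / toK Q').
    by rewrite mulf_div -!rmorphM.
  rewrite rmorphM; exact: (close _ ve).
move=> d; rewrite !psM rmorph_sum /= -sumrB; apply: av_sum_lt => // k _.
rewrite rmorphM; exact: (close _ v _ _ _ _ (cd _) (cd' _) (hd _) (hd' _)).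
Qed.

Lemma approximable1 : approximable 1.
Proof.
move=> e e0; exists 1, 1, (ps_of_poly 1); split; first exact: unit_taylor_poly.
  change (ve (rE (toK 1 / toK 1) - 1) < e).
  by rewrite tofrac1 divr1 rmorph1 subrr av0.
move=> d; change (v (cinj vp ((1 : {poly rat})`_d) - (d == 0%N)%:R) < e).
by rewrite coef1 rmorph_nat subrr av0.
Qed.

Lemma approximableD x : approximable x -> approximable (ps_D x.1, DE x.2).
Proof.
move=> hx e e0; have [P [Q [t [h hE hd]]]] := hx e e0.
exists ('X * (P^`() * Q - P * Q^`())), (Q ^+ 2), (ps_D t); split; first exact: unit_taylorD.
  rewrite -zderivE ?(unit_taylor_den h) // -DE_ratfun -DE_zmod.
  exact: le_lt_trans (DE_contr _) hE.
move=> d; rewrite /ps_D /= rmorphMn -mulrnBl -mulr_natr avM.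
by apply: le_lt_trans (hd d); rewrite ler_piMr ?av_ge0 // pabs_nat_le1.
Qed.

Lemma approximable_lim x : (forall e, 0 < e -> exists y, [/\ approximable y,
   ve (y.2 - x.2) < e & forall d, v (y.1 d - x.1 d) < e]) -> approximable x.
Proof.
move=> hx e e0; have [y [hy yE yd]] := hx e e0.
have [P [Q [t [h hE hd]]]] := hy e e0; exists P, Q, t; split=> // [|d].
  by rewrite -(subrK y.2 (rE _)) -addrA; exact: avD_lt.
by rewrite -(subrK (y.1 d) (cinj _ _)) -addrA; exact: avD_lt.
Qed.

Lemma approximable_const c : approximable (ps_const c, const_E c).
Proof.
apply: approximable_lim => e e0; have [q hq] := cinj_dense c e0.
exists (fun d => cinj vp (ps_of_poly q%:P d), rE (toK q%:P / toK 1)); split=> [||d].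
- exact/approximable_ratfun/unit_taylor_poly.
- change (ve (rE (toK q%:P / toK 1) - const_E c) < e).
  have h : ve (const_E (cinj vp q - c)) <= v (cinj vp q - c) by exact: const_E_contr.
  rewrite tofrac1 divr1 -const_E_cinj -(rmorphB (@const_E p hp)).
  by apply: (le_lt_trans h); rewrite avBC.
- rewrite /= /ps_const /ps_of_poly !coefC; case: eqP => _; last by rewrite rmorph0 subrr av0.
  by rewrite avBC.
Qed.

Lemma approximable_z : approximable (ps_of_poly 'X, zE hp).
Proof.
move=> e e0; exists 'X, 1, (ps_of_poly 'X); split; first exact: unit_taylor_poly.
  change (ve (rE (toK 'X / toK 1) - zE hp) < e).
  by rewrite tofrac1 divr1 subrr av0.
by move=> d; rewrite /= /ps_of_poly !coefX rmorph_nat subrr av0.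
Qed.

Lemma approximable_geom : approximable (ps_geom _ p, (1 - zE hp ^+ p)^-1).
Proof.
have p0 := prime_gt0 hp.
move=> e e0; exists 1, (1 - 'X^p), (ps_geom _ p); split.
- split; last by rewrite ps_geomP // rmorph1.
    by rewrite coefB coef1 coefXn [in X in _ - X]eq_sym (gtn_eqF p0) subr0.
  apply: gauss_le => // i; rewrite coefB coef1 coefXn; apply: absballB; exact: av_nat.
- change (ve (rE (toK 1 / toK (1 - 'X^p)) - (1 - zE hp ^+ p)^-1) < e).
  have e1 : toK (1 - 'X^p) = 1 - toK 'X ^+ p by rewrite rmorphB rmorph1 rmorphXn.
  have e2 : rE (toK (1 - 'X^p)) = 1 - zE hp ^+ p by rewrite e1 rmorphB rmorph1 rmorphXn.
  have e3 r : rE r^-1 = (rE r)^-1 by exact: fmorphV.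
  by rewrite tofrac1 mul1r e3 e2 subrr av0.
- by move=> d; rewrite /= /ps_geom rmorph_nat subrr av0.
Qed.

(** A rational function c-close to x in both components carries the bound from one to the other,
    since [unit_taylor_le] compares its own two norms. *)
Lemma approximable_leE x c : 0 < c -> approximable x ->
  (forall d, v (x.1 d) <= c) <-> ve x.2 <= c.
Proof.
move=> c0 /(_ c c0) [P [Q [t [h hE hd]]]].
have ut := unit_taylor_le (ltW c0) h; have ug := unit_taylor_gauss h.
split=> [hx|hx].
  rewrite -(subKr (rE (toK P / toK Q)) x.2); apply: absballB; last exact: ltW.
  rewrite Eabs_ratfun ug; apply/ut => d.
  by rewrite -(cabs_cinj vp) -(subrK (x.1 d) (cinj _ _)) (absballD (v := v)) // ltW.
move=> d.
rewrite -(subKr (cinj vp (t d)) (x.1 d)); apply: absballB; last exact: ltW (hd d).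
rewrite cabs_cinj; move: d {hd}; apply/ut; rewrite -ug -Eabs_ratfun.
by rewrite -(subrK x.2 (rE _)) (absballD (v := ve)) // ltW.
Qed.

End SeriesRing.

Section ApproximableRing.
Variables (p : nat) (hp : prime p).
Local Notation K := (Q_p hp).
Local Notation E := (E_p hp).
Local Notation v := (pabs hp).
Local Notation ve := (Eabs hp).

Definition approx_pred : {pred (ps K * E)%type} := [pred x | `[< @approximable p hp x >]].

Lemma approx_subring : subring_closed approx_pred.
Proof.
split; first by apply/asboolP; exact: approximable1.
- by move=> x y /asboolP hx /asboolP hy; apply/asboolP; exact: approximableB.
- by move=> x y /asboolP hx /asboolP hy; apply/asboolP; exact: approximableM.
Qed.

HB.instance Definition _ :=
  GRing.isSubringClosed.Build (ps K * E)%type approx_pred approx_subring.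

(* Power series f together with the element e of E_p which f represents. *)
Record aseries := ASeries { aval :> (ps K * E)%type; _ : aval \in approx_pred }.

HB.instance Definition _ := [isSub for aval].
HB.instance Definition _ := [Choice of aseries by <:].
HB.instance Definition _ := [SubChoice_isSubComNzRing of aseries by <:].

Lemma aseriesP (x : aseries) : approximable (aval x).
Proof. by case: x => x /= /asboolP. Qed.

Definition mk_aseries x (hx : @approximable p hp x) : aseries := ASeries (asboolT hx).

Definition aser (x : aseries) : ps K := (aval x).1.
Definition aE (x : aseries) : E := (aval x).2.

Lemma aser_zmod : zmod_morphism aser. Proof. by []. Qed.
Lemma aser_monoid : monoid_morphism aser. Proof. by []. Qed.
HB.instance Definition _ := GRing.isZmodMorphism.Build aseries (ps K) aser aser_zmod.
HB.instance Definition _ := GRing.isMonoidMorphism.Build aseries (ps K) aser aser_monoid.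
Lemma aE_zmod : zmod_morphism aE. Proof. by []. Qed.
Lemma aE_monoid : monoid_morphism aE. Proof. by []. Qed.
HB.instance Definition _ := GRing.isZmodMorphism.Build aseries E aE aE_zmod.
HB.instance Definition _ := GRing.isMonoidMorphism.Build aseries E aE aE_monoid.

Lemma aserB x y : aser (x - y) = aser x - aser y. Proof. by []. Qed.
Lemma aserM x y : aser (x * y) = aser x * aser y. Proof. by []. Qed.
Lemma aser1 : aser 1 = 1. Proof. by []. Qed.
Lemma aEB x y : aE (x - y) = aE x - aE y. Proof. by []. Qed.
Lemma aEM x y : aE (x * y) = aE x * aE y. Proof. by []. Qed.

Lemma aseries_norm c (x : aseries) : 0 < c -> (forall d, v (aser x d) <= c) <-> ve (aE x) <= c.
Proof. by move=> c0; apply: approximable_leE => //; exact: aseriesP. Qed.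

(** Together with [aE_inj] this allows an identity to be proved on either component: the Leibniz
    rule is imported from E_p, whereas [ageomP] is checked on coefficients. *)
Lemma aser_inj : injective aser.
Proof.
move=> x y h; apply: val_inj; apply/eqP; rewrite -subr_eq0; apply/eqP.
have h0 : aser (x - y) = 0 by rewrite aserB h subrr.
suff : aE (x - y) = 0.
  move=> h1; change (aval (x - y) = 0); move: h0 h1; rewrite /aser /aE.
  by case: (aval (x - y)) => a b /= -> ->.
apply: (@av_le_eps _ ve) => e e0; apply/aseries_norm => // d.
by rewrite h0 (av0 v) ltW.
Qed.

Lemma aE_inj : injective aE.
Proof.
move=> x y h; apply: aser_inj; apply/funext => d.
have h0 : aE (x - y) = 0 by rewrite aEB h subrr.
apply/eqP; rewrite -subr_eq0; apply/eqP; apply: (@av_le_eps _ v) => e e0.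
have := (aseries_norm (x - y) e0).2; apply; first by rewrite h0 av0 ltW.
Qed.

Definition aD (x : aseries) : aseries := mk_aseries (approximableD (aseriesP x)).
Definition aconst (c : K) : aseries := mk_aseries (approximable_const c).
Definition az : aseries := mk_aseries (approximable_z hp).
Definition ageom : aseries := mk_aseries (approximable_geom hp).

Lemma aser_D x : aser (aD x) = ps_D (aser x). Proof. by []. Qed.
Lemma aE_D x : aE (aD x) = DE (aE x). Proof. by []. Qed.
Lemma aser_const c : aser (aconst c) = ps_const c. Proof. by []. Qed.
Lemma aE_const c : aE (aconst c) = const_E c. Proof. by []. Qed.
Lemma aser_z : aser az = ps_of_poly 'X. Proof. by []. Qed.
Lemma aser_geom : aser ageom = ps_geom _ p. Proof. by []. Qed.

Lemma aconst_zmod : zmod_morphism aconst.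
Proof. by move=> x y; apply: aE_inj; rewrite aEB !aE_const rmorphB. Qed.
Lemma aconst_monoid : monoid_morphism aconst.
Proof.
split; first by apply: aE_inj; rewrite aE_const !rmorph1.
by move=> x y; apply: aE_inj; rewrite aEM !aE_const rmorphM.
Qed.
HB.instance Definition _ := GRing.isZmodMorphism.Build K aseries aconst aconst_zmod.
HB.instance Definition _ := GRing.isMonoidMorphism.Build K aseries aconst aconst_monoid.

Lemma aDB : {morph aD : x y / x - y}.
Proof. by move=> x y; apply: aE_inj; rewrite aE_D !aEB !aE_D DE_zmod. Qed.

Lemma aDM x y : aD (x * y) = aD x * y + x * aD y.
Proof. by apply: aE_inj; rewrite aE_D aEM DEM. Qed.

Lemma aD_const c : aD (aconst c) = 0.
Proof. by apply: aE_inj; rewrite aE_D aE_const DE_const rmorph0. Qed.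

Lemma aD_z : aD az = az.
Proof.
apply: aser_inj; rewrite aser_D aser_z ps_D_poly derivX mulr1 //.
Qed.

Lemma ageomP : ageom * (1 - az ^+ p) = 1.
Proof.
apply: aser_inj; rewrite aserM aserB aser1 rmorphXn /= aser_geom aser_z.
rewrite -[X in _ * X = _](_ : ps_of_poly (1 - 'X^p) = _).
  exact/ps_geomP/prime_gt0.
by rewrite rmorphB rmorph1 rmorphXn.
Qed.

(* The integral power series have to be supported on multiples of p in order to be
   stable under p^-1 D. *)
Definition aball (e : rat) (x : aseries) : Prop := forall d, v (aser x d) <= e.

Lemma aball0 e : 0 <= e -> aball e 0. Proof. by move=> e0 d; rewrite (av0 v). Qed.
Lemma aball1 : aball 1 1. Proof. by move=> d; rewrite aser1 ps1 pabs_nat_le1. Qed.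
Lemma aballB e x y : aball e x -> aball e y -> aball e (x - y).
Proof. by move=> hx hy d; rewrite aserB psB; exact: absballB. Qed.
Lemma aballM e x y : aball 1 x -> aball e y -> aball e (x * y).
Proof.
move=> hx hy d; rewrite aserM psM; apply: av_sum_le => [|k _].
  exact: le_trans (av_ge0 v _) (hy 0%N).
exact: absballM.
Qed.
Lemma aballW d e x : d <= e -> aball d x -> aball e x.
Proof. by move=> h hx k; exact: le_trans h. Qed.

Definition a_filtration : filtration aseries := Filtration aball0 aball1 aballB aballM aballW.

Definition apball (e : rat) (x : aseries) : Prop :=
  aball e x /\ forall d, ~~ (p %| d)%N -> aser x d = 0.

Lemma apball0 e : 0 <= e -> apball e 0. Proof. by split=> //; exact: aball0. Qed.
Lemma apball1 : apball 1 1.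
Proof. by split=> [|d]; [exact: aball1|rewrite aser1 ps1; case: d; rewrite ?dvdn0]. Qed.
Lemma apballB e x y : apball e x -> apball e y -> apball e (x - y).
Proof.
move=> [hx hx'] [hy hy']; split=> [|d pd]; first exact: aballB.
by rewrite aserB psB hx' // hy' // subrr.
Qed.
Lemma apballM e x y : apball 1 x -> apball e y -> apball e (x * y).
Proof.
move=> [hx hx'] [hy hy']; split=> [|d pd]; first exact: aballM.
rewrite aserM psM big1 // => k _.
have kd : (k <= d)%N by rewrite -ltnS.
have [pk|pk] := boolP (p %| k)%N; last by rewrite hx' // mul0r.
rewrite hy' ?mulr0 //; apply: contra pd => pdk.
by rewrite -(subnK kd) dvdn_addl.
Qed.
Lemma apballW d e x : d <= e -> apball d x -> apball e x.
Proof. by move=> h [hx hx']; split=> //; exact: aballW hx. Qed.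

Definition ap_filtration : filtration aseries :=
  Filtration apball0 apball1 apballB apballM apballW.

Lemma cong_ap e x y : cong ap_filtration e x y -> cong a_filtration e x y.
Proof. by case=> [[? _] [? _] [? _]]. Qed.

Definition ath (x : aseries) : aseries := aconst p%:R^-1 * aD x.

(** On z^(pk) the operator p^-1 D is multiplication by the integer k. *)
Lemma apball_th e x : apball e x -> apball e (ath x).
Proof.
move=> [hx hx']; have E1 d : aser (ath x) d = p%:R^-1 * (aser x d * d%:R).
  by rewrite aserM aser_const ps_constM mulr_natr.
split=> d; rewrite E1; last by move=> pd; rewrite hx' // mul0r mulr0.
have [pd|pd] := boolP (p %| d)%N; last first.
  by rewrite hx' // mul0r mulr0 (av0 v); apply: le_trans (av_ge0 v _) (hx 0%N).
case/dvdnP: pd => k ->; rewrite natrM mulrC -!mulrA mulfV ?Qp_p_neq0 // mulr1.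
by rewrite avM; apply: le_trans (hx (k * p)%N); rewrite ler_piMr ?av_ge0 // pabs_nat_le1.
Qed.

Lemma cong_const e x y : cong (abs_filtration v) e x y -> cong ap_filtration e (aconst x) (aconst y).
Proof.
have h c x' : v x' <= c -> apball c (aconst x').
  move=> hx; have c0 := le_trans (av_ge0 v _) hx.
  split=> d; rewrite aser_const /ps_const /ps_of_poly coefC.
    by case: eqP => _ //; rewrite (av0 v).
  by case: eqP => // ->; rewrite dvdn0.
by case=> hx hy hxy; split; [exact: h|exact: h|rewrite -(rmorphB aconst); exact: h].
Qed.

Lemma apball_zp : apball 1 (az ^+ p).
Proof.
have e1 : aser (az ^+ p) = ps_of_poly 'X^p by rewrite rmorphXn /= aser_z -rmorphXn.
split=> d; rewrite e1 /ps_of_poly coefXn; first exact: pabs_nat_le1.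
by case: eqP => // ->; rewrite dvdnn.
Qed.

Lemma apball_geom : apball 1 ageom.
Proof.
split=> d; rewrite aser_geom /ps_geom; first exact: pabs_nat_le1.
by move=> /negbTE ->.
Qed.

Lemma aball_z : aball 1 az.
Proof. by move=> d; rewrite aser_z /ps_of_poly coefX pabs_nat_le1. Qed.

Lemma aball_eps x : (forall e, 0 < e -> aball e x) -> x = 0.
Proof.
move=> h; apply: aser_inj; apply/funext => d.
by apply: (@av_le_eps _ v) => e /h.
Qed.

Lemma aball_D e x : aball e x -> aball e (aD x).
Proof.
move=> hx d; rewrite aser_D /ps_D -mulr_natr avM; apply: le_trans (hx d).
by rewrite ler_piMr ?av_ge0 // pabs_nat_le1.
Qed.

(** Limits are taken separately in each coefficient and in E_p. The rate [e n] is uniform in the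
    index of the coefficient, so the pair of limits is again approximable. *)
Lemma aseries_complete (x : nat -> aseries) (e : nat -> rat) :
  (forall eps, 0 < eps -> exists N, forall n, (N <= n)%N -> e n < eps) ->
  (forall m n, (m <= n)%N -> aball (e m) (x n - x m)) ->
  exists y, forall n, aball (e n) (y - x n).
Proof.
move=> he hx.
have e0 n : 0 <= e n by apply: le_trans (av_ge0 v _) (hx n n (leqnn _) 0%N).
have cau (L : fieldType) (w : absval L) (u : nat -> L) :
    (forall m n, (m <= n)%N -> w (u n - u m) <= e m) -> cauchy_seq w u.
  move=> hu eps eps0; have [N hN] := he _ eps0; exists N => m n.
  wlog mn : m n / (m <= n)%N => [H a b|a _].
    have /orP[mn|nm] := leq_total m n; first exact: H.
    by rewrite avBC; exact: H.
  by rewrite avBC; apply: le_lt_trans (hu _ _ mn) (hN _ a).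
have lim_le (L : fieldType) (w : absval L) (u : nat -> L) y n :
    (forall eps, 0 < eps -> exists N, forall n, (N <= n)%N -> w (u n - y) < eps) ->
    (forall m n, (m <= n)%N -> w (u n - u m) <= e m) -> w (y - u n) <= e n.
  move=> hy hu; rewrite leNgt; apply/negP => h.
  have d0 : 0 < w (y - u n) by apply: le_lt_trans h.
  have [N hN] := hy _ d0.
  have h1 := hN (maxn N n) (leq_maxl _ _); have h2 := hu n (maxn N n) (leq_maxr _ _).
  have : w (y - u n) < w (y - u n).
    rewrite -{1}(subrK (u (maxn N n)) y) -addrA; apply: avD_lt; first by rewrite avBC.
    exact: le_lt_trans h.
  by rewrite ltxx.
have cs d : cauchy_seq v (fun n => aser (x n) d).
  by apply: cau => m n mn; rewrite -psB -aserB; exact: hx.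
pose A d : set K := fun y => forall eps, 0 < eps ->
  exists N, forall n, (N <= n)%N -> v (aser (x n) d - y) < eps.
pose f d := xget 0 (A d).
have hf d : A d (f d).
  have [y hy] := completion_complete (cs d); have hy' : A d y by exact: hy.
  exact: (xgetI 0 hy').
have ef n d : v (f d - aser (x n) d) <= e n.
  apply: (lim_le _ v (fun n => aser (x n) d)) => [|m k mk]; first exact: hf.
  by rewrite -psB -aserB; exact: hx.
(* [aseries_norm] compares norms only with a positive bound, while [e m] may vanish; hence the
   auxiliary c. *)
have hE m n : (m <= n)%N -> forall c, 0 < c -> e m <= c -> ve (aE (x n) - aE (x m)) <= c.
  move=> mn c c0 ec; rewrite -aEB; apply/aseries_norm => // d.
  exact: le_trans (hx _ _ mn d) ec.
have cE : cauchy_seq ve (fun n => aE (x n)).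
  move=> eps eps0; have e20 : 0 < eps / 2 by rewrite divr_gt0.
  have [N hN] := he _ e20; exists N => m n.
  wlog mn : m n / (m <= n)%N => [H a b|a _].
    have /orP[mn|nm] := leq_total m n; first exact: H.
    by rewrite avBC; exact: H.
  rewrite avBC; apply: (@le_lt_trans _ _ (eps / 2)); last by lra.
  by apply: hE => //; rewrite ltW // hN.
have [y hy] := completion_complete cE.
have hyx : @approximable p hp (f, y).
  apply: approximable_lim => eps eps0; have [N hN] := he _ eps0.
  have [M hM] := hy _ eps0; exists (aval (x (maxn N M))); split.
  - exact: aseriesP.
  - exact: hM (leq_maxr _ _).
  - by move=> d; rewrite avBC; apply: le_lt_trans (ef _ d) (hN _ (leq_maxl _ _)).
by exists (mk_aseries hyx) => n d; rewrite aserB psB; exact: ef.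
Qed.

Lemma aseries_in_E (x : aseries) : series_in_E (aser x) (aE x).
Proof.
have pos k : 0 < k.+1%:R^-1 :> rat by rewrite invr_gt0 ltr0n.
have hx k := aseriesP x (pos k).
pose P k := projT1 (cid (hx k)).
pose Q k := projT1 (cid (projT2 (cid (hx k)))).
pose t k := projT1 (cid (projT2 (cid (projT2 (cid (hx k)))))).
have H k := projT2 (cid (projT2 (cid (projT2 (cid (hx k)))))).
exists (fun k => FracField.tofrac (P k) / FracField.tofrac (Q k)), t; split.
- move=> k; exists (P k), (Q k); have [[h1 h2 h3] _ _] := H k.
  split=> // [|d]; first by rewrite h1 oner_eq0.
  have -> : (P k)`_d = (ps_of_poly (P k)) d by [].
  by rewrite -h3 mulrC.
- move=> e /inv_succ_small [N hN]; exists N => k /hN hk; have [_ h _] := H k.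
  exact: lt_trans h hk.
- move=> e /inv_succ_small [N hN]; exists N => k /hN hk d; have [_ _ h] := H k.
  exact: lt_trans (h d) hk.
Qed.

End ApproximableRing.

(** * The hypergeometric differential module *)

(* The differential module of the hypergeometric system in the variable z^p, over a
   differential ring (R, D) with constants K: [nab] is its connection for the derivation
   [th] = p^-1 D, and [red H] represents H(th) F for F a solution of the equation. *)
Section HypergeometricModule.
Variables (K : fieldType) (R : comNzRingType) (D : R -> R) (cst : {rmorphism K -> R}).
Variables (p : nat) (z om : R).
Hypothesis D_add : forall x y, D (x + y) = D x + D y.
Hypothesis D_mul : forall x y, D (x * y) = D x * y + x * D y.
Hypothesis D_cst : forall c, D (cst c) = 0.
Hypothesis D_z : D z = z.
Hypothesis omP : om * (1 - z ^+ p) = 1.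
Hypothesis p_neq0 : p%:R != 0 :> K.
Hypothesis p_gt0 : (0 < p)%N.

Definition th x := cst p%:R^-1 * D x.

Lemma cst_pK x : cst p%:R * (cst p%:R^-1 * x) = x.
Proof. by rewrite mulrA -rmorphM mulfV // rmorph1 mul1r. Qed.

Lemma D_th x : D x = cst p%:R * th x. Proof. by rewrite cst_pK. Qed.

Lemma th_add x y : th (x + y) = th x + th y.
Proof. by rewrite /th D_add mulrDr. Qed.
Lemma th_mul x y : th (x * y) = th x * y + x * th y.
Proof. by rewrite /th D_mul; ring. Qed.
Lemma th_cst c : th (cst c) = 0. Proof. by rewrite /th D_cst mulr0. Qed.
Lemma th_nat m : th m%:R = 0. Proof. by rewrite -(rmorph_nat cst) th_cst. Qed.

Lemma D_zX r : D (z ^+ r) = r%:R * z ^+ r.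
Proof.
elim: r => [|r IH]; first by rewrite expr0 mul0r -(rmorph1 cst) D_cst.
by rewrite exprS D_mul D_z IH -addn1 natrD; ring.
Qed.

Lemma th_zp : th (z ^+ p) = z ^+ p.
Proof. by rewrite /th D_zX mulrA -(rmorph_nat cst) -rmorphM mulVf // rmorph1 mul1r. Qed.

Variable n' : nat.
Local Notation n := n'.+1.
Variables (h : K) (a : 'I_n -> K).

Definition lin_prod (c : 'I_n -> K) : {poly K} := \prod_i ('X + (c i)%:P).

Lemma lin_prod_coef c : (lin_prod c)`_n = 1 /\ forall l, (n < l)%N -> (lin_prod c)`_l = 0.
Proof.
have -> : lin_prod c = \prod_(x <- [seq - c i | i <- index_enum 'I_n]) ('X - x%:P).
  by rewrite big_map; apply: eq_bigr => i _; rewrite polyCN opprK.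
have := size_prod_XsubC [seq - c i | i <- index_enum 'I_n] id.
have := monic_prod_XsubC [seq - c i | i <- index_enum 'I_n] xpredT id.
set P := \prod_(x <- _) _.
have -> : size [seq - c i | i <- index_enum 'I_n] = n.
  by rewrite size_map /index_enum unlock -enumT size_enum_ord.
move=> hm hs; split; first by move: hm; rewrite monicE /lead_coef hs => /eqP.
by move=> l hl; rewrite nth_default // hs.
Qed.

Definition hypnum := lin_prod (fun i => h - a i).
Definition hypden := lin_prod (fun i => - a i).

(** The last row solves the equation for th^n F: its leading coefficient is z^p - 1, and [om] is the
    inverse of 1 - z^p. *)
Definition At : 'M[R]_n := \matrix_(i, j)
  if (i.+1 < n)%N then (j == i.+1 :> nat)%:R
  else om * (z ^+ p * cst hypnum`_j - cst hypden`_j).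

(** A row u stands for the operator sum_k u_k th^k modulo the equation, and [nab] for its
    composition with th on the left. *)
Definition nab (u : 'rV[R]_n) : 'rV[R]_n := map_mx th u + u *m At.

Lemma nabD u w : nab (u + w) = nab u + nab w.
Proof.
rewrite /nab mulmxDl addrACA; congr (_ + _).
by apply/matrixP => i j; rewrite !mxE th_add.
Qed.

Lemma nabZ x u : nab (x *: u) = th x *: u + x *: nab u.
Proof.
rewrite /nab scalerDr addrA -scalemxAl; congr (_ + _).
by apply/matrixP => i j; rewrite !mxE th_mul.
Qed.

Lemma nab0 : nab 0 = 0.
Proof. by apply: (addrI (nab 0)); rewrite -nabD !addr0. Qed.

Lemma nab_sum I (r : seq I) (P : pred I) (F : I -> 'rV[R]_n) :
  nab (\sum_(i <- r | P i) F i) = \sum_(i <- r | P i) nab (F i).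
Proof. by apply: (big_morph nab); [exact: nabD|exact: nab0]. Qed.

Definition nabX l : 'rV[R]_n := iter l nab (delta_mx 0 0).
Arguments nabX : simpl never.

Lemma nabX_small l (ln : (l < n)%N) : nabX l = delta_mx 0 (Ordinal ln).
Proof.
elim: l ln => [|l IH] ln; first by congr delta_mx; apply: val_inj.
rewrite /nabX /= -/(nabX l) (IH (ltnW ln)) /nab -rowE.
apply/rowP => j; rewrite !mxE ln /= th_nat add0r.
by congr (_%:R); rewrite -val_eqE eq_sym; case: eqVneq.
Qed.

Definition red (H : {poly K}) : 'rV[R]_n := \sum_(l < size H) cst H`_l *: nabX l.

Lemma redE m (H : {poly K}) : (size H <= m)%N -> red H = \sum_(l < m) cst H`_l *: nabX l.
Proof.
move=> hm; rewrite /red (big_ord_widen _ (fun l => cst H`_l *: nabX l) hm) big_mkcond.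
apply: eq_bigr => l _; case: ltnP => // hl.
by rewrite nth_default // rmorph0 scale0r.
Qed.

Lemma redD H G : red (H + G) = red H + red G.
Proof.
pose m := maxn (size H) (size G).
rewrite (@redE m (H + G)) ?size_polyD // (@redE m H) ?leq_maxl // (@redE m G) ?leq_maxr //.
by rewrite -big_split; apply: eq_bigr => l _; rewrite coefD rmorphD scalerDl.
Qed.

Lemma redZ c H : red (c *: H) = cst c *: red H.
Proof.
rewrite (@redE (size H) (c *: H)) ?size_scale_leq // /red scaler_sumr.
by apply: eq_bigr => l _; rewrite coefZ rmorphM scalerA.
Qed.

Lemma red0 : red 0 = 0. Proof. by rewrite /red size_poly0 big_ord0. Qed.

Lemma red_mulX H : red ('X * H) = nab (red H).
Proof.
rewrite (@redE (size H).+1) ?(leq_trans (size_polyMleq _ _)) ?size_polyX //.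
rewrite big_ord_recl coefXM eqxx rmorph0 scale0r add0r /red nab_sum.
by apply: eq_bigr => l _; rewrite coefXM nabZ th_cst scale0r add0r.
Qed.

(** The last row of [At] is this relation divided by 1 - z^p; [omP] undoes the division. *)
Lemma red_equation : z ^+ p *: red hypnum = red hypden.
Proof.
have sz c : (size (lin_prod c) <= n.+1)%N.
  by apply/leq_sizeP => l; exact: (lin_prod_coef c).2.
rewrite (redE (sz _)) (redE (sz _)) big_ord_recr [RHS]big_ord_recr /=.
rewrite !(lin_prod_coef _).1 rmorph1 !scale1r.
have -> : nabX n = \sum_(j < n) (om * (z ^+ p * cst hypnum`_j - cst hypden`_j)) *: nabX j.
  rewrite {1}/nabX iterS -/(nabX n') (nabX_small (ltnSn n')) /nab -rowE.
  apply/rowP => j; rewrite !mxE ltnn /= th_nat add0r summxE (bigD1 j) //= big1 ?addr0.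
    rewrite !mxE nabX_small !mxE eqxx /=.
    have -> : j == Ordinal (ltn_ord j) by rewrite -val_eqE.
    by rewrite mulr1.
  move=> i ij; rewrite nabX_small !mxE eqxx /=.
  by rewrite -val_eqE /= eq_sym val_eqE (negbTE ij) mulr0.
rewrite scalerDr !scaler_sumr -!big_split; apply: eq_bigr => j _ /=.
rewrite !scalerA -!scalerDl; congr (_ *: _).
rewrite -/hypnum -/hypden; set A := cst _; set B := cst _; set q := z ^+ p.
apply/eqP; rewrite -subr_eq0; apply/eqP.
transitivity ((1 - om * (1 - q)) * (q * A - B)); first by ring.
by rewrite omP subrr mul0r.
Qed.

(** This is the hypergeometric equation multiplied on the left by H(th), where th is moved across
    z^p by H(th) z^p = z^p H(th + 1). *)
Lemma red_shift H : z ^+ p *: red (hypnum * (H \Po ('X + 1%:P))) = red (hypden * H).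
Proof.
elim/poly_ind: H => [|H c IH].
  by rewrite comp_poly0 !mulr0 red0 scaler0.
rewrite comp_polyD comp_polyM comp_polyX comp_polyC.
set G := H \Po _ in IH *.
have -> : hypnum * (G * ('X + 1%:P) + c%:P) =
  'X * (hypnum * G) + hypnum * G + c *: hypnum by rewrite -mul_polyC; ring.
have -> : hypden * (H * 'X + c%:P) = 'X * (hypden * H) + c *: hypden.
  by rewrite -mul_polyC; ring.
rewrite !redD !redZ !red_mulX -IH nabZ th_zp -red_equation.
by rewrite !scalerDr !scalerA [cst c * _]mulrC [X in X + _ = _]addrC.
Qed.

(** D (z^r G) = z^r (D + r) G with D = p th, so Q(D) acts behind the factor z^r as Q(p th + r). *)
Definition lin_arg (r : nat) : {poly K} := p%:R *: 'X + r%:R%:P.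

Definition dnab (u : 'rV[R]_n) : 'rV[R]_n := map_mx D u + cst p%:R *: (u *m At).

Lemma dnabE u : dnab u = cst p%:R *: nab u.
Proof.
rewrite /nab scalerDr; congr (_ + _).
by apply/matrixP => i j; rewrite !mxE D_th.
Qed.

Variable H : nat -> {poly K}.

(* With F' = sum_{r<p} z^r H_r(th) F, this represents Q(D) F'. *)
Definition frob_row (Q : {poly K}) : 'rV[R]_n :=
  \sum_(r < p) z ^+ r *: red ((Q \Po lin_arg r) * H r).

Lemma frob_rowD P Q : frob_row (P + Q) = frob_row P + frob_row Q.
Proof.
rewrite /frob_row -big_split; apply: eq_bigr => r _.
by rewrite comp_polyD mulrDl redD scalerDr.
Qed.

Lemma frob_rowZ c Q : frob_row (c *: Q) = cst c *: frob_row Q.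
Proof.
rewrite /frob_row scaler_sumr; apply: eq_bigr => r _.
by rewrite comp_polyZ -scalerAl redZ !scalerA mulrC.
Qed.

Lemma frob_row_coef m (Q : {poly K}) : (size Q <= m)%N ->
  frob_row Q = \sum_(i < m) cst Q`_i *: frob_row 'X^i.
Proof.
move=> hm; have {1}-> : Q = \sum_(i < m) Q`_i *: 'X^i.
  rewrite -poly_def; apply/polyP => i; rewrite coef_poly; case: ltnP => // hi.
  by rewrite nth_default // (leq_trans hm).
rewrite (big_morph frob_row (id1 := 0) (op1 := +%R)) //; first last.
- by rewrite -[0 in LHS](scale0r 'X) frob_rowZ rmorph0 scale0r.
- exact: frob_rowD.
by apply: eq_bigr => i _; rewrite frob_rowZ.
Qed.

Lemma frob_row_mulX Q : dnab (frob_row Q) = frob_row ('X * Q).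
Proof.
rewrite dnabE nab_sum scaler_sumr; apply: eq_bigr => r _.
rewrite nabZ comp_polyM comp_polyX scalerDr !scalerA -D_th D_zX.
rewrite -mulrA; set G := (Q \Po _) * _.
have -> : lin_arg r * G = p%:R *: ('X * G) + r%:R *: G by rewrite /lin_arg mulrDl -scalerAl mul_polyC.
rewrite redD !redZ red_mulX; move: (red G) => M; move: (nab M) => N.
rewrite scalerDr !scalerA (rmorph_nat cst r) addrC.
by rewrite [cst _ * _]mulrC [r%:R * _]mulrC.
Qed.

(** Contiguity: the coefficients of F' obey the recursion of the target equation, inside a block of
    p consecutive exponents by [H_step] and from one block to the next by [H_wrap]. *)
Hypothesis H_step : forall r, (r.+1 < p)%N ->
  (lin_prod (fun k => - (p%:R * a k)) \Po lin_arg r.+1) * H r.+1 =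
  (lin_prod (fun k => p%:R * h - p%:R * a k) \Po lin_arg r) * H r.
Hypothesis H_wrap :
  (lin_prod (fun k => p%:R * h - p%:R * a k) \Po lin_arg p.-1) * H p.-1 =
  p%:R ^+ n *: (hypnum * (H 0%N \Po ('X + 1%:P))).

(** Multiplication by z sends the summand of index r on the left to that of index r + 1 on the right
    by [H_step]. The last one acquires z^p and returns to index 0 through [H_wrap] and
    [red_shift]. *)
Lemma frob_row_wrap :
  z *: frob_row (lin_prod (fun k => p%:R * h - p%:R * a k)) =
  frob_row (lin_prod (fun k => - (p%:R * a k))).
Proof.
have hd0 : lin_prod (fun k => - (p%:R * a k)) \Po lin_arg 0 = p%:R ^+ n *: hypden.
  rewrite /hypden /lin_prod rmorph_prod /=.
  have := scaler_prodl (fun k : 'I_n => true) (fun k => 'X + (- a k)%:P : {poly K}) p%:R.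
  rewrite [#|_|]card_ord => <-; apply: eq_bigr => k _.
  rewrite comp_polyD comp_polyX comp_polyC /lin_arg addr0.
  by rewrite scalerDr -mulrN -mul_polyC polyCM -mul_polyC.
rewrite /frob_row; case: p p_gt0 H_step H_wrap hd0 red_shift => // p' _ hs hw hd0 rs.
rewrite big_ord_recr [RHS]big_ord_recl /= hw hd0 -scalerAl !redZ scale1r.
rewrite scalerDr addrC; congr (_ + _).
  by rewrite !scalerA -exprS mulrC -scalerA rs.
rewrite scaler_sumr; apply: eq_bigr => r _.
by rewrite scalerA -exprS hs // ltnS.
Qed.

Lemma frob_row_equation :
  \sum_(j < n.+1) (z * cst (lin_prod (fun k => p%:R * h - p%:R * a k))`_j
    - cst (lin_prod (fun k => - (p%:R * a k)))`_j) *: frob_row 'X^j = 0.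
Proof.
have sz c : (size (lin_prod c) <= n.+1)%N.
  by apply/leq_sizeP => l; exact: (lin_prod_coef c).2.
under eq_bigr do rewrite scalerBl -scalerA.
by rewrite sumrB -scaler_sumr -!frob_row_coef // frob_row_wrap subrr.
Qed.

Section Pairing.
Variables (R' : comNzRingType) (rho : {rmorphism R -> R'}) (th' : R' -> R').
Hypothesis th'_add : forall x y, th' (x + y) = th' x + th' y.
Hypothesis th'_mul : forall x y, th' (x * y) = th' x * y + x * th' y.
Hypothesis rho_th : forall x, rho (th x) = th' (rho x).
Variables (al : R') (w : 'cV[R']_n).
(** A solution vector carries a factor z^(p al), which is not a power series. The vector w is what
    remains after its removal, whence the twisted derivation th' + al. *)
Hypothesis wP : map_mx th' w + al *: w = map_mx rho At *m w.

Definition pairing (u : 'rV[R]_n) : R' := (map_mx rho u *m w) 0 0.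

Lemma pairingD u u' : pairing (u + u') = pairing u + pairing u'.
Proof. by rewrite /pairing map_mxD mulmxDl mxE. Qed.

Lemma pairingZ x u : pairing (x *: u) = rho x * pairing u.
Proof. by rewrite /pairing map_mxZ -scalemxAl mxE. Qed.

Lemma pairing_sum I (r : seq I) (P : pred I) (F : I -> 'rV[R]_n) :
  pairing (\sum_(i <- r | P i) F i) = \sum_(i <- r | P i) pairing (F i).
Proof.
apply: (big_morph pairing); first exact: pairingD.
by rewrite -[0 in LHS](scale0r 0) pairingZ rmorph0 mul0r.
Qed.

Lemma pairing_nab u : pairing (nab u) = th' (pairing u) + al * pairing u.
Proof.
have th'0 : th' 0 = 0 by apply: (addrI (th' 0)); rewrite -th'_add !addr0.
rewrite /pairing /nab map_mxD map_mxM mulmxDl -mulmxA -wP mulmxDr -scalemxAr.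
rewrite !mxE (big_morph th' th'_add th'0) addrA -big_split; congr (_ + _).
by apply: eq_bigr => j _; rewrite !mxE /= th'_mul -rho_th.
Qed.

Lemma pairing_red G : pairing (red G) =
  \sum_(l < size G) rho (cst G`_l) * iter l (fun x => th' x + al * x) (w 0 0).
Proof.
rewrite /red pairing_sum; apply: eq_bigr => l _; rewrite pairingZ; congr (_ * _).
elim: (nat_of_ord l) => [|m IH]; last by rewrite /nabX !iterS pairing_nab IH.
rewrite /nabX /pairing /= !mxE (bigD1 0) //= big1 ?addr0.
  by rewrite !mxE eqxx rmorph1 mul1r.
by move=> j /negbTE j0; rewrite !mxE j0 rmorph0 mul0r.
Qed.

End Pairing.

End HypergeometricModule.

(** * The p-adic gamma function at multiples of p *)

Section GaussNorm.
Variables (F : fieldType) (v : absval F).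
Local Notation gv := (gaussval v).
Implicit Types (P Q : {poly F}) (a b : F).

Lemma horner_le P a : v a <= 1 -> v P.[a] <= gauss v P.
Proof.
move=> ha; rewrite horner_coef; apply: av_sum_le => [|i _]; first exact: gauss_ge0.
by rewrite avM avX -[gauss v P]mulr1 ler_pM ?av_ge0 ?exprn_ge0 ?gauss_coef ?exprn_ile1 ?av_ge0.
Qed.

Lemma gauss_lin a : v a <= 1 -> gauss v ('X + a%:P) <= 1.
Proof.
move=> ha; apply: le_trans (gaussD _ _ _) _; rewrite gaussC ge_max ha andbT.
by rewrite -['X]mulr1 gaussX -polyC1 gaussC av1.
Qed.

(** Termwise, (X + a)^i - (X + b)^i is a - b times a polynomial with integral coefficients. *)
Lemma gauss_comp_sub P a b : v a <= 1 -> v b <= 1 ->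
  gauss v ((P \Po ('X + a%:P)) - (P \Po ('X + b%:P))) <= gauss v P * v (a - b).
Proof.
move=> ha hb; rewrite !comp_polyE -sumrB.
apply: (av_sum_bound (v := gv)) => [|i _]; first by rewrite mulr_ge0 ?gauss_ge0 ?av_ge0.
rewrite -scalerBr subrXX -mul_polyC.
have -> : 'X + a%:P - ('X + b%:P) = (a - b)%:P by rewrite polyCB; ring.
rewrite !(avM gv) /= [gv _]gaussC [gv _]gaussC.
apply: ler_pM; rewrite ?av_ge0 ?mulr_ge0 ?av_ge0 //; first exact: gauss_coef.
rewrite ler_piMr ?av_ge0 //; apply: (av_sum_bound (v := gv)) => // j _.
by rewrite avM !avX mulr_ile1 ?exprn_ge0 ?av_ge0 ?exprn_ile1 ?av_ge0 //; exact: gauss_lin.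
Qed.

Lemma gauss_comp P a : v a <= 1 -> gauss v (P \Po ('X + a%:P)) <= gauss v P.
Proof.
move=> ha; rewrite comp_polyE; apply: (av_sum_bound (v := gv)) => [|i _]; first exact: gauss_ge0.
rewrite -mul_polyC (avM gv) /= [gv _]gaussC -[gauss v P]mulr1.
by apply: ler_pM; rewrite ?av_ge0 ?gauss_coef ?avX ?exprn_ile1 ?av_ge0 //; exact: gauss_lin.
Qed.

Lemma cong_comp e P Q a b : 0 <= e -> cong (abs_filtration gv) e P Q ->
  cong (abs_filtration v) e a b ->
  cong (abs_filtration gv) e (P \Po ('X + a%:P)) (Q \Po ('X + b%:P)).
Proof.
move=> e0 [/= hP hQ hPQ] [/= ha hb hab]; split=> /=.
- exact: le_trans (gauss_comp _ ha) hP.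
- exact: le_trans (gauss_comp _ hb) hQ.
have -> : (P \Po ('X + a%:P)) - (Q \Po ('X + b%:P)) =
  ((P - Q) \Po ('X + a%:P)) + ((Q \Po ('X + a%:P)) - (Q \Po ('X + b%:P))).
  by rewrite comp_polyB; ring.
apply: (absballD (v := gv)); first exact: le_trans (gauss_comp _ ha) hPQ.
apply: le_trans (gauss_comp_sub _ ha hb) _; rewrite -[e]mul1r.
by rewrite ler_pM ?gauss_ge0 ?av_ge0.
Qed.

Lemma cong_horner e P Q a b : 0 <= e -> cong (abs_filtration gv) e P Q ->
  cong (abs_filtration v) e a b -> cong (abs_filtration v) e P.[a] Q.[b].
Proof.
move=> e0 hPQ hab; have [/= hP hQ _] := hPQ; have [/= ha hb _] := hab.
split=> /=; [exact: le_trans (horner_le _ ha) hP|exact: le_trans (horner_le _ hb) hQ|].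
(* A value at x is the value at 0 of a translate, which reduces the claim to [cong_comp]. *)
have h x (S : {poly F}) : S.[x] = (S \Po ('X + x%:P)).[0].
  by rewrite horner_comp !hornerE.
rewrite (h a) (h b) -hornerN -hornerD.
have [_ _] := cong_comp e0 hPQ hab; apply: le_trans.
by apply: horner_le; rewrite av0.
Qed.

Lemma cong_polyC e a b : cong (abs_filtration v) e a b ->
  cong (abs_filtration gv) e a%:P b%:P.
Proof.
move=> [/= h1 h2 h3]; split; rewrite /= -?polyCB [gv _]gaussC //.
Qed.

Lemma cong_coef e P Q i : cong (abs_filtration gv) e P Q ->
  cong (abs_filtration v) e P`_i Q`_i.
Proof.
move=> [/= h1 h2 h3]; split; rewrite /= -?coefB.
- exact: le_trans (gauss_coef _ _ _) h1.
- exact: le_trans (gauss_coef _ _ _) h2.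
- exact: le_trans (gauss_coef _ _ _) h3.
Qed.

Lemma cong_polyX e : 0 <= e -> cong (abs_filtration gv) e 'X 'X.
Proof.
move=> e0; apply: cong_refl => //=.
by rewrite -['X]mulr1 [gv _]gaussX -polyC1 gaussC av1.
Qed.

End GaussNorm.

Lemma comp_shift (R : comNzRingType) (P : {poly R}) a b :
  (P \Po ('X + a%:P)) \Po ('X + b%:P) = P \Po ('X + (a + b)%:P).
Proof.
rewrite -comp_polyA comp_polyD comp_polyX comp_polyC polyCD.
by congr (_ \Po _); ring.
Qed.

Section GammaPolynomials.
Variables (p : nat) (hp : prime p) (K : fieldType) (v : absval K).
Hypothesis v_nat : forall m : nat, v m%:R = padic_int_abs p m.
Local Notation gv := (gaussval v).
Local Notation fg := (abs_filtration gv).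
Local Notation fv := (abs_filtration v).
Local Notation pi := (p%:R^-1 : rat).

Let pi0 : 0 <= pi. Proof. by rewrite invr_ge0 ler0n. Qed.
Let pi1 : pi <= 1. Proof. by rewrite invf_le1 ?ler1n ?ltr0n prime_gt0. Qed.
Let pi_lt1 : pi < 1. Proof. by rewrite invf_lt1 ?ltr0n ?ltr1n ?prime_gt1 ?prime_gt0. Qed.
Let nat1 k : v k%:R <= 1. Proof. exact: av_nat. Qed.
Let v_p : v p%:R = pi.
Proof.
rewrite v_nat /padic_int_abs -[_ == 0]/(p == 0%N) gtn_eqF ?prime_gt0 //.
by rewrite absz_nat logn_prime // eqxx expr1.
Qed.

Lemma cong_nat_poly e (k : nat) : 0 <= e -> cong fg e k%:R%:P k%:R%:P.
Proof. by move=> e0; apply/cong_polyC/cong_nat. Qed.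

Definition plin (k : nat) : {poly K} := p%:R *: 'X + k%:R%:P.

Lemma cong_plin e k : 0 <= e -> cong fg e (plin k) (plin k).
Proof.
move=> e0; rewrite /plin -mul_polyC.
apply: congD => //; last exact: cong_nat_poly.
by apply: congM => //; [exact: cong_nat_poly|exact: cong_polyX].
Qed.

(* gpoly h is M_h(X) = prod_{i<h} nu(X + i); its value at 0 is Gamma_p(ph), and
   M_h(m) = Gamma_p(pm + ph) / Gamma_p(pm). *)
Definition nu : {poly K} := (-1) ^+ p * \prod_(1 <= j < p) plin j.

Definition gpoly (h : nat) : {poly K} := \prod_(i < h) (nu \Po ('X + i%:R%:P)).

Lemma cong_nu e : 0 <= e -> cong fg e nu nu.
Proof.
move=> e0; rewrite /nu; apply: congM => //.
  by apply: congX => //; apply: congN => //; exact: cong1.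
by apply: cong_prod => // j _; exact: cong_plin.
Qed.

Lemma nu_cong1 : cong fg pi nu 1.
Proof.
have [nu1 _ _] := cong_nu pi0.
apply: (@cong_trans _ _ _ pi0 ((-1) ^+ p * \prod_(1 <= j < p) j%:R%:P)).
  apply: congM => //; first by apply: congX => //; apply: congN => //; exact: cong1.
  apply: cong_prod => // j _; rewrite -[X in cong _ _ _ X]add0r /plin -mul_polyC.
  apply: congD => //; last exact: cong_nat_poly.
  rewrite -[X in cong _ _ _ X](mul0r 'X) -polyC0.
  apply: congM => //; last exact: cong_polyX.
  apply: cong_polyC; split; rewrite /= ?av0 ?subr0 ?v_p // pi1 //.
have -> : (-1) ^+ p * \prod_(1 <= j < p) j%:R%:P = ((-1) ^+ p * (p.-1)`!%:R)%:P :> {poly K}.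
  rewrite polyCM rmorphXn rmorphN1 fact_prod natr_prod rmorph_prod /=.
  by rewrite prednK // prime_gt0.
rewrite -polyC1; apply: cong_polyC.
have [k hk] : exists k : int, ((-1) ^+ p * (p.-1)`!%:R - 1 : int) = p%:Z * k.
  have := Wilson (prime_gt1 hp); rewrite hp => /esym /dvdnP [k hk].
  (* For p = 2 both (-1)^p and (p - 1)! equal 1; for odd p the sign turns the -1 of Wilson's theorem
     into 1. *)
  have [p2|podd] := even_prime hp; first by exists 0; rewrite p2.
  exists (- k%:Z); rewrite -signr_odd podd expr1 mulrN [p%:Z * _]mulrC -PoszM -hk.
  by rewrite natz -addn1 PoszD; ring.
have hk' : (-1) ^+ p * (p.-1)`!%:R - 1 = p%:R * k%:~R :> K.
  have := congr1 (fun m : int => m%:~R : K) hk.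
  by rewrite rmorphB rmorphM rmorphXn rmorphN1 /= rmorph1 rmorph_nat rmorphM /= -pmulrn.
have kle : v k%:~R <= 1.
  by case: k {hk hk'} => k; rewrite ?NegzE ?mulrNz ?avN -pmulrn.
split; rewrite /= ?av1 //; last first.
  by rewrite hk' avM v_p ler_piMr.
by rewrite avM avX avN av1 expr1n mul1r nat1.
Qed.



Lemma gpolyD h k : gpoly (h + k) = gpoly h * (gpoly k \Po ('X + h%:R%:P)).
Proof.
rewrite /gpoly big_split_ord; congr (_ * _).
rewrite rmorph_prod /=; apply: eq_bigr => i _.
by rewrite comp_shift -natrD addnC.
Qed.

Lemma gpolyM h k : gpoly (h * k) = \prod_(j < k) (gpoly h \Po ('X + (h * j)%:R%:P)).
Proof.
elim: k => [|k IH]; first by rewrite muln0 big_ord0 /gpoly big_ord0.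
by rewrite big_ord_recr /= -IH mulnS addnC gpolyD.
Qed.

Lemma cong_gpoly_refl e h : 0 <= e -> cong fg e (gpoly h) (gpoly h).
Proof.
move=> e0; apply: cong_prod => // i _; apply: cong_comp => //; first exact: cong_nu.
exact: cong_nat.
Qed.

Lemma gpoly_cong1 h : cong fg pi (gpoly h) 1.
Proof.
have -> : 1 = \prod_(i < h) 1 :> {poly K} by rewrite big1_eq.
apply: cong_prod => // i _; rewrite -[X in cong _ _ _ X](comp_polyC 1 ('X + i%:R%:P)) polyC1.
apply: cong_comp => //; [exact: nu_cong1|exact: cong_nat].
Qed.

(* Writing M for the polynomial of p^s, that of p^(s+1) is prod_{j<p} M(X + p^s j), which is
   close to M^p because M(X + p^s j) - M(X) is divisible by p^(2s). *)
Lemma gpoly_pow s : gauss v (gpoly (p ^ s.+1) - 1) <= pi ^+ s.+1.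
Proof.
elim: s => [|s IH]; first by have [_ _] := gpoly_cong1 (p ^ 1).
set M := gpoly (p ^ s.+1) in IH *.
have e0 k : 0 <= pi ^+ k by rewrite exprn_ge0.
have [M1 _ _] := cong_gpoly_refl (p ^ s.+1) pi0.
have step j : cong fg (pi ^+ s.+2) (M \Po ('X + (p ^ s.+1 * j)%:R%:P)) M.
  have c0 : v (p ^ s.+1 * j)%:R <= pi ^+ s.+1.
    rewrite natrM natrX avM avX v_p ler_piMr //.
  split=> //=; first exact: le_trans (gauss_comp _ (nat1 _)) M1.
  have -> : (M \Po ('X + (p ^ s.+1 * j)%:R%:P)) - M =
     ((M - 1) \Po ('X + (p ^ s.+1 * j)%:R%:P)) - ((M - 1) \Po ('X + 0%:P)).
    by rewrite !comp_polyB addr0 comp_polyXr -polyC1 !comp_polyC; ring.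
  apply: le_trans (gauss_comp_sub _ (nat1 _) _) _; first by rewrite av0.
  rewrite subr0; apply: le_trans (ler_pM _ _ IH c0) _; rewrite ?gauss_ge0 ?av_ge0 //.
  by rewrite -exprD ler_wiXn2l // addSn addnS !ltnS leq_addl.
rewrite expnSr gpolyM -/M.
have -> : \prod_(j < p) (M \Po ('X + (p ^ s.+1 * j)%:R%:P)) - 1 =
  (\prod_(j < p) (M \Po ('X + (p ^ s.+1 * j)%:R%:P)) - \prod_(j < p) M) + (M ^+ p - 1).
  by rewrite prodr_const card_ord; ring.
apply: (absballD (v := gv)).
  suff [_ _] : cong fg (pi ^+ s.+2)
    (\prod_(j < p) (M \Po ('X + (p ^ s.+1 * j)%:R%:P))) (\prod_(j < p) M) by [].
  by apply: cong_prod => // j _; exact: step.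
have -> : M ^+ p - 1 = (M - 1) * \sum_(i < p) M ^+ (p.-1 - i).
  by rewrite -[1 in LHS](expr1n _ p) subrXX; congr (_ * _); apply: eq_bigr => i _; rewrite expr1n mulr1.
rewrite (avM gv) exprSr; apply: ler_pM; rewrite ?av_ge0 //.
have cM : cong fg pi M 1 by exact: gpoly_cong1.
have [_ _] : cong fg pi (\sum_(i < p) M ^+ (p.-1 - i)) (\sum_(i < p) 1).
  by apply: cong_sum => // i _; have := congX pi0 (p.-1 - i) cM; rewrite expr1n.
rewrite sumr_const card_ord => h.
rewrite -(subrK (p%:R) (\sum_(i < p) _)); apply: (absballD (v := gv)) => //.
by rewrite -polyC_natr [gv _]gaussC v_p.
Qed.

(** This is a product of translates of the polynomial of p^s, each congruent to 1 modulo p^s. *)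
Lemma gpoly_dvd s k : gauss v (gpoly (p ^ s * k) - 1) <= pi ^+ s.
Proof.
have e0 : 0 <= pi ^+ s by rewrite exprn_ge0.
have hs : cong fg (pi ^+ s) (gpoly (p ^ s)) 1.
  have [h1 h2 h3] := gpoly_cong1 (p ^ s); split=> //.
  by case: s {e0} h1 h2 h3 => [|s] h1 h2 h3 /=; [exact: le_trans h3 _|exact: gpoly_pow].
rewrite gpolyM; suff [_ _] : cong fg (pi ^+ s)
  (\prod_(j < k) (gpoly (p ^ s) \Po ('X + (p ^ s * j)%:R%:P))) 1 by [].
have e1 : 1 = \prod_(j < k) 1 :> {poly K} by rewrite big1_eq.
rewrite [X in cong _ _ _ X]e1; apply: cong_prod => // j _; rewrite -[X in cong _ _ _ X](comp_polyC 1 ('X + (p ^ s * j)%:R%:P)) polyC1.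
by apply: cong_comp => //; exact: cong_nat.
Qed.

(** For h = h' + d, the quotient of the two polynomials is a translate of that of d, which is
    congruent to 1 modulo the exact power of p dividing d, that is, up to |d|. *)
Lemma cong_gpoly e h h' : 0 <= e -> v (h%:R - h'%:R) <= e -> cong fg e (gpoly h) (gpoly h').
Proof.
move=> e0; wlog hh : h h' / (h' <= h)%N => [H he|he].
  have /orP[hh|hh] := leq_total h' h; first exact: H.
  by apply: cong_sym => //; apply: H => //; rewrite avBC.
have [h1 _ _] := cong_gpoly_refl h e0; have [h1' _ _] := cong_gpoly_refl h' e0.
split=> //; move: he; rewrite -natrB //; move: (h - h')%N (subnKC hh) => d <-.
have [->|d0] := posnP d; first by rewrite addn0 subrr /= (av0 gv).
rewrite gpolyD => hd.
have -> : gpoly h' * (gpoly d \Po ('X + h'%:R%:P)) - gpoly h' =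
  gpoly h' * ((gpoly d - 1) \Po ('X + h'%:R%:P)).
  by rewrite comp_polyB -polyC1 comp_polyC polyC1; ring.
apply: (absballM (v := gv)) => //; apply: le_trans (gauss_comp _ (nat1 _)) _.
apply: le_trans hd; have /dvdnP[k hk] := pfactor_dvdnn p d.
rewrite {1}hk mulnC; apply: le_trans (gpoly_dvd _ _) _.
rewrite v_nat /padic_int_abs -[_ == 0]/(d == 0%N) gtn_eqF //.
by rewrite absz_nat exprVn.
Qed.

Definition gval (h : nat) : K := (gpoly h).[0].

Lemma gval_cong e h h' : 0 <= e -> v (h%:R - h'%:R) <= e -> cong fv e (gval h) (gval h').
Proof.
move=> e0 he; apply: cong_horner => //; first exact: cong_gpoly.
exact: cong0.
Qed.

Lemma gpoly_unit h a : v a <= 1 -> v (gpoly h).[a] = 1.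
Proof.
move=> ha; rewrite -(av1 v); apply: av_eq_near.
have [_ _] := gpoly_cong1 h; rewrite /= => hg; rewrite av1; apply: le_lt_trans pi_lt1.
by rewrite -(hornerC 1 a) -hornerN -hornerD; apply: le_trans (horner_le _ ha) _; rewrite polyC1.
Qed.

Lemma gpoly_shift h m : (gpoly h).[m%:R] * gval m = gval (m + h).
Proof.
by rewrite /gval gpolyD hornerM horner_comp !hornerE mulrC.
Qed.

End GammaPolynomials.

(** Among the factors up to pm, the multiples of p contribute p^m m!, and the others form m blocks
    of p - 1 factors. *)
Lemma fact_pmul (p m : nat) : (0 < p)%N ->
  ((p * m)`! = p ^ m * m`! * \prod_(i < m) \prod_(1 <= j < p) (p * i + j))%N.
Proof.
move=> p0; elim: m => [|m IH]; first by rewrite muln0 big_ord0 !fact0.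
rewrite big_ord_recr /= mulnS addnC.
have step k : ((p * m + k)`! = (p * m)`! * \prod_(1 <= j < k.+1) (p * m + j))%N.
  elim: k => [|k IHk]; first by rewrite addn0 big_geq // muln1.
  by rewrite addnS factS IHk [in RHS]big_nat_recr //= addnS; ring.
rewrite step big_nat_recr //= IH factS expnS.
have -> : (p * m + p = p * m.+1)%N by rewrite mulnS addnC.
ring.
Qed.

(** The relation between C(N+M-1, N) and C(N+M, N), cleared of denominators so that it can be cast
    to Q_p. *)
Lemma bin_cross (M N : nat) : (0 < M)%N ->
  ('C(N + M - 1, N) * (N + M) * (N`! * M`!) = M * (N + M)`!)%N.
Proof.
case: M => // M _; rewrite addnS subn1 /= !factS.
have := bin_fact (leq_addr M N); rewrite addKn => <-.
ring.
Qed.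

Section GammaNat.
Variables (p : nat) (hp : prime p).
Local Notation K := (Q_p hp).
Local Notation v := (pabs hp).

Lemma gval_prod (m : nat) : gval p K m = (-1) ^+ (p * m) *
  (\prod_(i < m) \prod_(1 <= j < p) (p * i + j)%N)%:R.
Proof.
rewrite /gval /gpoly horner_prod exprM natr_prod -[m in (_ ^+ m)]card_ord -prodr_const.
rewrite -big_split; apply: eq_bigr => i _.
rewrite horner_comp hornerD hornerX hornerC add0r /nu hornerM horner_exp hornerN hornerC; congr (_ * _).
rewrite horner_prod natr_prod; apply: eq_bigr => j _.
by rewrite /plin hornerD hornerZ hornerX hornerC natrD natrM.
Qed.

Lemma gval_Gamma (m : nat) : gval p K m = Gamma_nat hp (p * m).
Proof.
rewrite gval_prod /Gamma_nat natr_prod; congr (_ * _).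
(* The index 0 may be included since p divides it; the range then splits into blocks of length p. *)
have -> : \prod_(1 <= i < p * m | ~~ (p %| i)%N) i%:R =
    \prod_(0 <= i < p * m | ~~ (p %| i)%N) i%:R :> K.
  have [->|pm0] := posnP (p * m); first by rewrite !big_geq.
  by rewrite [RHS]big_ltn_cond // dvdn0.
elim: m => [|m IH]; first by rewrite muln0 big_ord0 big_geq.
rewrite big_ord_recr /= IH [RHS](@big_cat_nat _ _ _ (p * m)) ?leq_mul2l ?leqnSn ?orbT //=.
congr (_ * _); rewrite -{2}[(p * m)%N]add0n big_addn mulnS addnK.
rewrite [RHS]big_ltn_cond ?prime_gt0 // add0n dvdn_mulr // natr_prod.
rewrite big_nat_cond [RHS]big_nat_cond; apply: eq_big => [j|j _]; last by rewrite addnC.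
have [/= /andP[j1 jp]|//] := boolP (1 <= j < p)%N.
by rewrite dvdn_addl ?dvdn_mulr // gtnNdvd.
Qed.

Lemma natr_fact_neq0 m : (m`!)%:R != 0 :> K.
Proof. by rewrite Qp_natr_eq0 -lt0n fact_gt0. Qed.

Lemma natr_pos_neq0 m : (0 < m)%N -> m%:R != 0 :> K.
Proof. by rewrite Qp_natr_eq0 -lt0n. Qed.

Lemma gval_unit h : v (gval p K h) = 1.
Proof. by apply: (gpoly_unit hp (@pabs_nat p hp)); rewrite av0. Qed.

Lemma gval_neq0 h : gval p K h != 0.
Proof. by rewrite -(av_eq0 v) gval_unit oner_eq0. Qed.

(** By [fact_pmul] the powers of p and the factorials of m, h and m + h cancel between the two
    binomials. Only the blocks prime to p remain, and their signs are multiplicative. *)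
Lemma g_natE h m : (0 < h)%N -> g_nat hp h m = (gpoly p K h).[m%:R] / gval p K h.
Proof.
move=> h0; have p0 := prime_gt0 hp.
pose G k : K := (\prod_(i < k) \prod_(1 <= j < p) (p * i + j)%N)%:R.
have gG k : gval p K k = (-1) ^+ (p * k) * G k by exact: gval_prod.
have G0 k : G k != 0.
  by have := gval_neq0 k; rewrite gG mulf_eq0 negb_or => /andP[].
have fG k : (p * k)`!%:R = p%:R ^+ k * k`!%:R * G k :> K.
  by rewrite fact_pmul // !natrM natrX.
have ph0 : (0 < p * h)%N by rewrite muln_gt0 p0.
have e1 := congr1 (fun k : nat => k%:R : K) (bin_cross (p * m) ph0).
have e2 := congr1 (fun k : nat => k%:R : K) (bin_cross m h0).
move: e1 e2; rewrite !natrM.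
have B0 : 'C(m + h - 1, m)%:R != 0 :> K.
  by rewrite natr_pos_neq0 // bin_gt0; case: (h) h0 => // h' _; rewrite addnS subn1 leq_addr.
have mh0 : (m + h)%:R != 0 :> K by rewrite natr_pos_neq0 // addn_gt0 h0 orbT.
rewrite /g_nat; set C := 'C(p * m + p * h - 1, _)%:R; rewrite -mulnDr !fG natrM; set C1 := 'C(m + h - 1, m)%:R in B0 *.
have key (F : fieldType) (c c1 P X Y Z T H G1 G2 G3 : F) :
    P != 0 -> X != 0 -> Y != 0 -> Z != 0 -> G1 != 0 -> G2 != 0 -> c1 != 0 ->
    c * (P * X) * ((P ^+ m * Y * G1) * (P ^+ h * Z * G2)) = P * H * (P ^+ (m + h) * T * G3) ->
    c1 * X * (Y * Z) = H * T -> c / c1 = G3 / (G1 * G2).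
  move=> P0 X0 Y0 Z0 G10 G20 c10 E1 E2.
  apply/eqP; rewrite eqr_div ?mulf_neq0 //; apply/eqP.
  apply: (mulfI (_ : P ^+ (m + h) * P * X * Y * Z != 0)); first by rewrite !mulf_neq0 ?expf_neq0.
  transitivity (c * (P * X) * ((P ^+ m * Y * G1) * (P ^+ h * Z * G2))).
    by rewrite exprD; ring.
  rewrite E1; transitivity (P * P ^+ (m + h) * G3 * (H * T)); first by ring.
  by rewrite -E2; ring.
move=> E1 E2; have -> : C / C1 = G (m + h)%N / (G m * G h).
  by apply: (@key K C C1 p%:R (m + h)%:R m`!%:R h`!%:R (m + h)`!%:R h%:R); rewrite ?Qp_p_neq0 ?natr_fact_neq0 //.
have -> : (gpoly p K h).[m%:R] = gval p K (m + h) / gval p K m.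
  by rewrite -gpoly_shift mulfK // gval_neq0.
rewrite !gG mulnDr exprD.
have s0 k : (-1) ^+ k != 0 :> K by rewrite signr_eq0.
have fin (F : fieldType) (x y A B C' : F) : x != 0 -> y != 0 -> A != 0 -> B != 0 ->
  C' / (A * B) = x * y * C' / (x * A) / (y * B) by move=> *; field; do !(apply/andP; split).
exact: fin.
Qed.

End GammaNat.

(** * The Frobenius matrix for natural h *)

(* [krat r m] is the polynomial (Gamma_p(py+ph) / Gamma_p(py) Gamma_p(ph))
   * (py+ph)_r / (py+1)_r in y, where h = m + 1; for natural h > 0 the factors of the
   denominator cancel. *)
Section FrobeniusPolynomials.
Variables (p : nat) (hp : prime p) (K : fieldType).
Local Notation gp := (gpoly p K).
Local Notation gv := (gval p K).
Local Notation pl := (plin p K).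

Definition krat (r m : nat) : {poly K} :=
  (gv m.+1)^-1 *: ((-1) ^+ p * \prod_(r.+1 <= j < p) pl j
    * (gp m \Po ('X + 1%:P)) * \prod_(0 <= i < r) pl (p * m.+1 + i)).

Lemma nu_shift (m : nat) : nu p K \Po ('X + m%:R%:P) =
  (-1) ^+ p * \prod_(1 <= j < p) pl (p * m + j).
Proof.
rewrite /nu comp_polyM rmorphXn /= rmorphN1; congr (_ * _).
rewrite rmorph_prod; apply: eq_bigr => j _ /=.
rewrite /plin comp_polyD comp_polyZ comp_polyX comp_polyC scalerDr natrD natrM polyCD addrA.
by rewrite polyCM mul_polyC.
Qed.

Lemma gpoly1 : gp 1 = nu p K.
Proof. by rewrite /gpoly big_ord_recl big_ord0 mulr1 /= polyC0 addr0 comp_polyXr. Qed.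

Lemma gpolyS (m : nat) : gp m.+1 = nu p K * (gp m \Po ('X + 1%:P)).
Proof.
by rewrite -[m.+1]add1n gpolyD gpoly1.
Qed.

Lemma krat0 m : krat 0 m = (gv m.+1)^-1 *: gp m.+1.
Proof. by rewrite /krat gpolyS /nu [\prod_(0 <= i < 0) _]big_geq // mulr1. Qed.

Lemma krat_step r m : (r.+1 < p)%N -> pl r.+1 * krat r.+1 m = pl (p * m.+1 + r) * krat r m.
Proof.
move=> rp; rewrite /krat -!scalerAr; congr (_ *: _).
rewrite [\prod_(r.+1 <= j < p) _]big_ltn // [\prod_(0 <= i < r.+1) _]big_nat_recr //=.
ring.
Qed.

(** The factor p(m+1) + p-1 completes the rising product to p consecutive terms. Its first term is
    p(X + m + 1); the others, with the sign, form nu(X + m + 1), which extends M_m(X + 1) to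
    M_(m+1)(X + 1). *)
Lemma krat_wrap m : pl (p * m.+1 + p.-1) * krat p.-1 m =
  (p%:R *: ('X + m.+1%:R%:P)) * (krat 0 m \Po ('X + 1%:P)).
Proof.
rewrite krat0 comp_polyZ /krat -!scalerAr; congr (_ *: _).
have p0 := prime_gt0 hp.
rewrite prednK // big_geq // mulr1 -addn1 gpolyD comp_polyM comp_shift addn1.
have -> : m%:R + 1 = m.+1%:R :> K by rewrite natr1.
rewrite gpoly1 nu_shift.
have -> : p%:R *: ('X + m.+1%:R%:P) = pl (p * m.+1 + 0).
  by rewrite addn0 /plin scalerDr natrM polyCM mul_polyC.
have e : pl (p * m.+1 + p.-1) * \prod_(0 <= i < p.-1) pl (p * m.+1 + i) =
    pl (p * m.+1 + 0) * \prod_(1 <= j < p) pl (p * m.+1 + j).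
  transitivity (\prod_(0 <= j < p.-1.+1) pl (p * m.+1 + j)).
    by rewrite big_nat_recr //= mulrC.
  by rewrite prednK // big_ltn.
rewrite mulrCA e; ring.
Qed.

Variable n' : nat.
Local Notation n := n'.+1.
Implicit Type a : 'I_n -> K.

(** This is H_r for h = m + 1: one factor of [krat] for each k, so that at X = a_j + e the argument
    is y = a_j - a_k + e. *)
Definition frob_poly (m : nat) a (r : nat) : {poly K} :=
  \prod_k (krat r m \Po ('X + (- a k)%:P)).

Lemma plin_shift r b : pl r \Po ('X + (- b)%:P) = ('X + (- (p%:R * b))%:P) \Po lin_arg K p r.
Proof.
rewrite /plin /lin_arg comp_polyD comp_polyZ comp_polyX comp_polyC.
rewrite comp_polyD comp_polyX comp_polyC scalerDr !polyCN polyCM scalerN -mul_polyC mul_polyC.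
by rewrite -addrA [_ + r%:R%:P]addrC addrA mul_polyC.
Qed.

Lemma frob_poly_step m a r : (r.+1 < p)%N ->
  (lin_prod (fun k => - (p%:R * a k)) \Po lin_arg K p r.+1) * frob_poly m a r.+1 =
  (lin_prod (fun k => p%:R * m.+1%:R - p%:R * a k) \Po lin_arg K p r) * frob_poly m a r.
Proof.
move=> rp; rewrite /lin_prod /frob_poly !rmorph_prod /= -!big_split; apply: eq_bigr => k _ /=.
rewrite -plin_shift -comp_polyM krat_step // comp_polyM plin_shift; congr (_ * _).
rewrite /lin_arg natrD natrM polyCD !(comp_polyD, comp_polyX, comp_polyC) polyCD.
ring.
Qed.

Lemma frob_poly_wrap m a :
  (lin_prod (fun k => p%:R * m.+1%:R - p%:R * a k) \Po lin_arg K p p.-1) * frob_poly m a p.-1 =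
  p%:R ^+ n *: (hypnum m.+1%:R a * (frob_poly m a 0 \Po ('X + 1%:P))).
Proof.
rewrite /hypnum /lin_prod /frob_poly !rmorph_prod /= -!big_split /=.
have := scaler_prodl (fun k : 'I_n => true) (fun k => ('X + (m.+1%:R - a k)%:P) *
  ((krat 0 m \Po ('X + (- a k)%:P)) \Po ('X + 1%:P)) : {poly K}) p%:R.
rewrite [#|_|]card_ord => <-; apply: eq_bigr => k _.
have -> : ('X + (p%:R * m.+1%:R - p%:R * a k)%:P) \Po lin_arg K p p.-1 =
    pl (p * m.+1 + p.-1) \Po ('X + (- a k)%:P).
  rewrite plin_shift /lin_arg natrD natrM !(comp_polyD, comp_polyX, comp_polyC) !polyCD.
  ring.
rewrite -comp_polyM krat_wrap comp_polyM comp_polyZ -scalerAl; congr (_ *: (_ * _)).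
  by rewrite comp_polyD comp_polyX comp_polyC polyCD -addrA [_ + m.+1%:R%:P]addrC.
by rewrite !comp_shift [- a k + 1]addrC.
Qed.

Variable v : absval K.
Hypothesis v_nat : forall m : nat, v m%:R = padic_int_abs p m.
Local Notation gvl := (gaussval v).

(** The factors depend on m through [gpoly] and through integers, both 1-Lipschitz; the only
    division is by the unit [gval]. *)
Lemma cong_krat e r m m' : 0 <= e -> v (m%:R - m'%:R) <= e ->
  cong (abs_filtration gvl) e (krat r m) (krat r m').
Proof.
move=> e0 he; have he1 : v (m.+1%:R - m'.+1%:R) <= e.
  by rewrite -!natr1 opprD addrACA subrr addr0.
rewrite /krat -!mul_polyC; apply: congM => //.
  apply/cong_polyC/cong_inv => //; try by apply: gpoly_unit; rewrite // av0.
  exact: gval_cong.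
have cpl k k' : v (k%:R - k'%:R) <= e -> cong (abs_filtration gvl) e (pl k) (pl k').
  move=> hk; rewrite /plin -mul_polyC; apply: congD => //.
    by apply: congM => //; [apply/cong_polyC/cong_nat|exact: cong_polyX].
  by apply: cong_polyC; split; rewrite //= av_nat.
apply: congM => //; [apply: congM => //; [apply: congM => //|]|].
- by apply: congX => //; apply: congN => //; exact: cong1.
- by apply: cong_prod => // j _; apply: cpl; rewrite subrr av0.
- by apply: cong_comp => //; [exact: cong_gpoly|exact: cong1].
- apply: cong_prod => // j _; apply: cpl.
  rewrite !natrD opprD addrACA subrr addr0 !natrM -mulrBr.
  by apply: absballM; rewrite ?av_nat.
Qed.

Lemma cong_frob_poly e r m m' a a' : 0 <= e -> v (m%:R - m'%:R) <= e ->
  (forall k, cong (abs_filtration v) e (a k) (a' k)) ->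
  cong (abs_filtration gvl) e (frob_poly m a r) (frob_poly m' a' r).
Proof.
move=> e0 he ha; apply: cong_prod => // k _; apply: cong_comp => //.
  exact: cong_krat.
exact: congN.
Qed.

End FrobeniusPolynomials.

(** * Lipschitz dependence of the Frobenius rows on h and a *)

Section FrobeniusContinuity.
Variables (p : nat) (hp : prime p) (K : fieldType) (v : absval K).
Hypothesis v_nat : forall m : nat, v m%:R = padic_int_abs p m.
Local Notation fv := (abs_filtration v).
Local Notation fg := (abs_filtration (gaussval v)).
Variables (R : comNzRingType) (D : R -> R) (cst : {rmorphism K -> R}) (z om : R).
Hypothesis D_add : forall x y, D (x + y) = D x + D y.
(** B, stable under th, serves for the reduced rows, whose entries involve only z^p. The factors z^r
    of [frob_row] are available only in the larger filtration Bz. *)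
Variables (B Bz : filtration R).
Hypothesis cong_cst : forall e x y, cong fv e x y -> cong B e (cst x) (cst y).
Hypothesis B_th : forall e x, B e x -> B e (th D cst p x).
Hypothesis B_zp : B 1 (z ^+ p).
Hypothesis B_om : B 1 om.
Hypothesis BBz : forall e x y, cong B e x y -> cong Bz e x y.
Hypothesis Bz_z : Bz 1 z.
Variables (n' : nat) (e : rat).
Local Notation n := n'.+1.
Hypothesis e0 : 0 <= e.

Local Notation tt := (th D cst p).

Variables (h h' : K) (a a' : 'I_n -> K).
Hypothesis ch : cong fv e h h'.
Hypothesis ca : forall k, cong fv e (a k) (a' k).

Lemma cong_lin_prod (c c' : 'I_n -> K) : (forall k, cong fv e (c k) (c' k)) ->
  cong fg e (lin_prod c) (lin_prod c').
Proof.
move=> hc; apply: cong_prod => // k _; apply: congD => //; first exact: cong_polyX.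
exact: cong_polyC.
Qed.

Lemma cong_th x y : cong B e x y -> cong B e (tt x) (tt y).
Proof.
case=> hx hy hxy; split; try exact: B_th.
have -> : tt x - tt y = tt (x - y); last exact: B_th.
by apply/eqP; rewrite subr_eq -(th_add _ _ D_add) subrK.
Qed.

Lemma cong_At i j : cong B e (At cst p z om h a i j) (At cst p z om h' a' i j).
Proof.
rewrite !mxE; case: ifP => _; first exact: cong_nat.
apply: congM => //; first exact: cong_refl.
apply: congB => //; first apply: congM => //; first exact: cong_refl.
- by apply/cong_cst/cong_coef/cong_lin_prod => k; exact: congB.
- by apply/cong_cst/cong_coef/cong_lin_prod => k; exact: congN.
Qed.

Definition cong_row (u u' : 'rV[R]_n) := forall k, cong B e (u 0 k) (u' 0 k).

Lemma cong_nab u u' : cong_row u u' -> cong_row (nab D cst p z om h a u) (nab D cst p z om h' a' u').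
Proof.
move=> hu k; rewrite /nab !mxE; apply: congD => //; first exact: cong_th.
by apply: cong_sum => // j _; apply: congM => //; exact: cong_At.
Qed.

Lemma cong_nabX l : cong_row (nabX D cst p z om h a l) (nabX D cst p z om h' a' l).
Proof.
elim: l => [|l IH]; first by move=> k; rewrite !mxE; exact: cong_nat.
exact: cong_nab.
Qed.

Lemma cong_red P P' : cong fg e P P' ->
  cong_row (red D cst p z om h a P) (red D cst p z om h' a' P').
Proof.
move=> hP k; pose m := maxn (size P) (size P').
rewrite (@redE _ _ _ _ _ _ _ _ _ _ m P) ?leq_maxl //.
rewrite (@redE _ _ _ _ _ _ _ _ _ _ m P') ?leq_maxr // !summxE.
apply: cong_sum => // l _; rewrite !mxE; apply: congM => //.
  exact/cong_cst/cong_coef.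
exact: cong_nabX.
Qed.

Lemma cong_frob_row i m m' k : v (m%:R - m'%:R) <= e ->
  cong Bz e (frob_row D cst p z om h a (frob_poly p m a) 'X^i 0 k)
            (frob_row D cst p z om h' a' (frob_poly p m' a') 'X^i 0 k).
Proof.
move=> hm; rewrite /frob_row !summxE; apply: cong_sum => // r _.
rewrite !mxE; apply: congM => //.
  by apply: congX => //; exact: cong_refl.
apply: BBz; apply: cong_red; apply: congM => //; last exact: (cong_frob_poly _ v_nat).
rewrite comp_Xn_poly; apply: congX => //.
exact: (@cong_plin p K v e r e0).
Qed.

End FrobeniusContinuity.

(** * Companion systems and the gauge transformation *)

Section OperatorCoefficients.
Variables (K L : fieldType) (f : {rmorphism K -> L}) (n' : nat).
Local Notation n := n'.+1.
Variables (h : K) (a : 'I_n -> K).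

(** The product is [lin_prod b] with cX substituted for X; the values c = 1 and c = p^-1 give the
    two systems. *)
Lemma scaled_prod_coef (c : L) (b : 'I_n -> K) j :
  (\prod_i (c *: 'X + (f (b i))%:P))`_j = c ^+ j * f (lin_prod b)`_j.
Proof.
have -> : \prod_i (c *: 'X + (f (b i))%:P) = (map_poly f (lin_prod b)) \Po (c *: 'X).
  rewrite /lin_prod !rmorph_prod; apply: eq_bigr => i _ /=.
  by rewrite rmorphD /= map_polyX map_polyC comp_polyD comp_polyX comp_polyC.
rewrite -(coef_map f); set Q := map_poly f _; rewrite comp_polyE.
have -> : \sum_(i < size Q) Q`_i *: (c *: 'X) ^+ i = \poly_(i < size Q) (Q`_i * c ^+ i).
  by rewrite poly_def; apply: eq_bigr => i _; rewrite exprZn scalerA.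
rewrite coef_poly mulrC; case: ltnP => // hj.
by rewrite nth_default ?mulr0 ?mul0r.
Qed.

Lemma hyp_op_coef (c zeta : L) j :
  (zeta *: \prod_i (c *: 'X + (f (h - a i))%:P) - \prod_i (c *: 'X - (f (a i))%:P))`_j =
  c ^+ j * (zeta * f (hypnum h a)`_j - f (hypden a)`_j).
Proof.
have -> : \prod_i (c *: 'X - (f (a i))%:P) = \prod_i (c *: 'X + (f (- a i))%:P).
  by apply: eq_bigr => i _; rewrite rmorphN polyCN.
by rewrite coefB coefZ !scaled_prod_coef mulrBr mulrCA.
Qed.

Lemma hyp_op_lead (c zeta : L) :
  (zeta *: \prod_i (c *: 'X + (f (h - a i))%:P) - \prod_i (c *: 'X - (f (a i))%:P))`_n =
  c ^+ n * (zeta - 1).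
Proof. by rewrite hyp_op_coef !(lin_prod_coef _).1 rmorph1 mulr1. Qed.

End OperatorCoefficients.

Section Gauge.
Variables (L : fieldType) (D : L -> L) (n' : nat) (P : L).
Local Notation n := n'.+1.
Hypothesis D_mul : forall x y, D (x * y) = D x * y + x * D y.
Hypothesis D_P : forall k, D (P ^- k) = 0.
Hypothesis P0 : P != 0.
Variables (X : nat -> 'rV[L]_n) (At : 'M[L]_n) (t : 'I_n -> L) (l : nat -> L).
Hypothesis AtE : forall i j : 'I_n,
  At i j = if (i.+1 < n)%N then (j == i.+1 :> nat)%:R else t j.
Hypothesis X_step : forall i, map_mx D (X i) + P *: (X i *m At) = X i.+1.
Hypothesis X_eq : \sum_(j < n.+1) l j *: X j = 0.
Hypothesis ln0 : l n != 0.

(** The rows X_i refer to the basis th^k F, the systems to D^k F = P^k th^k F, which explains the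
    factors P^-k. Except in the last row the identity is [X_step]; there [X_eq] expresses X_n
    through the preceding rows. *)
Lemma gauge_identity (V A A' : 'M[L]_n) :
  (forall i k, V i k = P ^- k * X i 0 k) ->
  (forall i j : 'I_n, A i j = if (i.+1 < n)%N then (j == i.+1 :> nat)%:R else P ^+ n * P ^- j * t j) ->
  (forall i j : 'I_n, A' i j = if (i.+1 < n)%N then (j == i.+1 :> nat)%:R else - (l j / l n)) ->
  map_mx D V + V *m A = A' *m V.
Proof.
move=> hV hA hA'; apply/matrixP => i k; rewrite mxE.
transitivity (P ^- k * X i.+1 0 k).
  rewrite -X_step !mxE hV D_mul D_P mul0r add0r mulrDr; congr (_ + _).
  rewrite !mulr_sumr; apply: eq_bigr => j _; rewrite hV hA AtE.
  case: ifP => jn; last first.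
    have jn' : (j : nat) = n' by apply/eqP; rewrite eqn_leq -ltnS ltn_ord /= leqNgt -ltnS jn.
    have -> : P ^+ n = P * P ^+ j by rewrite jn' exprS.
    have Pj : P ^+ j != 0 by rewrite expf_neq0.
    move: (P ^- k) (P ^+ j) Pj (X i 0 j) (t k) => a b b0 c d; by field.
  case: eqP => [->|_]; last by rewrite !mulr0.
  by rewrite exprS invfM !mulr1; field; rewrite expf_neq0.
rewrite mxE; case: (ltnP i.+1 n) => hi.
  rewrite (bigD1 (Ordinal hi)) //= big1 ?addr0 => [|j ij].
    by rewrite hA' hi eqxx mul1r hV.
  by rewrite hA' hi (negbTE (_ : (j : nat) != i.+1)) ?mul0r.
have -> : i.+1 = n by apply/eqP; rewrite eqn_leq hi ltn_ord.
have := congr1 (fun u : 'rV[L]_n => u 0 k) X_eq.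
rewrite big_ord_recr /= !mxE => /eqP; rewrite addr_eq0 => /eqP hX.
have -> : X n 0 k = - (\sum_(j < n) l j * X j 0 k) / l n.
  apply: (mulfI ln0); rewrite mulrCA mulfV // mulr1 -[LHS]opprK -hX summxE; congr (- _).
  by apply: eq_bigr => j _; rewrite mxE.
rewrite mulNr mulrN mulr_suml mulr_sumr -sumrN; apply: eq_bigr => j _.
rewrite hA' ltnNge hi /= hV; ring.
Qed.

Lemma gauge_solution (V A A' : 'M[L]_n) (S : comNzRingType) (phi : {rmorphism L -> S}) (DS : S -> S) :
  derivation DS -> (forall x, DS (phi x) = phi (D x)) ->
  map_mx D V + V *m A = A' *m V ->
  forall w : 'cV[S]_n, map_mx DS w = map_mx phi A *m w ->
  map_mx DS (map_mx phi V *m w) = map_mx phi A' *m (map_mx phi V *m w).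
Proof.
move=> [DS_add DS_mul] hphi hV w hw.
have DS0 : DS 0 = 0 by apply: (addrI (DS 0)); rewrite -DS_add !addr0.
rewrite mulmxA -map_mxM -hV map_mxD map_mxM mulmxDl -mulmxA -hw.
apply/matrixP => i j; rewrite !mxE (big_morph DS DS_add DS0) -big_split.
by apply: eq_bigr => k _; rewrite !mxE DS_mul hphi.
Qed.

End Gauge.

(** * Passage to the limit in h *)

Section FrobeniusLimit.
Variables (p : nat) (hp : prime p) (n' : nat).
Local Notation n := n'.+1.
Local Notation K := (Q_p hp).
Local Notation W := (aseries hp).
Local Notation v := (pabs hp).
Local Notation fv := (abs_filtration v).
Local Notation fa := (a_filtration hp).
Local Notation cst := (@aconst p hp : {rmorphism K -> W}).
Local Notation pi := (p%:R^-1 : rat).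

Lemma aD_add (x y : W) : aD (x + y) = aD x + aD y.
Proof. by have := aDB (x + y) y; rewrite addrK => ->; rewrite subrK. Qed.

Definition Atil (h : K) (a : 'I_n -> K) : 'M[W]_n := At cst p (az hp) (ageom hp) h a.

Definition frobN (m : nat) (a : 'I_n -> K) (i : nat) : 'rV[W]_n :=
  frob_row (@aD p hp) cst p (az hp) (ageom hp) m.+1%:R a (frob_poly p m a) 'X^i.

Definition eqn_coef (h : K) (a : 'I_n -> K) (j : nat) : W :=
  az hp * aconst (lin_prod (fun k => p%:R * h - p%:R * a k))`_j
  - aconst (lin_prod (fun k => - (p%:R * a k)))`_j.

Lemma frobN_step m a i :
  map_mx (@aD p hp) (frobN m a i) + aconst p%:R *: (frobN m a i *m Atil m.+1%:R a) = frobN m a i.+1.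
Proof.
have := @frob_row_mulX K W (@aD p hp) cst p (az hp) (ageom hp) aD_add (@aDM p hp)
  (@aD_const p hp) (@aD_z p hp) (Qp_p_neq0 hp) n' m.+1%:R a (frob_poly p m a) 'X^i.
by rewrite -exprS.
Qed.

Lemma frobN_eqn m a : \sum_(j < n.+1) eqn_coef m.+1%:R a j *: frobN m a j = 0.
Proof.
exact: (@frob_row_equation K W (@aD p hp) cst p (az hp) (ageom hp) aD_add (@aDM p hp)
  (@aD_const p hp) (@aD_z p hp) (ageomP hp) (Qp_p_neq0 hp) (prime_gt0 hp) n' m.+1%:R a
  (frob_poly p m a) (fun r => @frob_poly_step p K n' m a r) (frob_poly_wrap hp m a)).
Qed.

Lemma cong_frobN e m m' a a' i k : 0 <= e -> v (m%:R - m'%:R) <= e ->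
  (forall k, cong fv e (a k) (a' k)) -> cong fa e (frobN m a i 0 k) (frobN m' a' i 0 k).
Proof.
move=> e0 he ha.
apply: (cong_frob_row hp (@pabs_nat p hp) aD_add (B := ap_filtration hp)) => //.
- by move=> d x y; exact: cong_const.
- by move=> d x; exact: apball_th.
- exact: apball_zp.
- exact: apball_geom.
- by move=> d x y; exact: cong_ap.
- exact: aball_z.
- apply: abs_cong; [exact: pabs_nat_le1|exact: pabs_nat_le1|by rewrite av_natS].
Qed.

Lemma cong_Atil e h h' a a' i j : 0 <= e -> cong fv e h h' ->
  (forall k, cong fv e (a k) (a' k)) -> cong fa e (Atil h a i j) (Atil h' a' i j).
Proof.
move=> e0 ch ca; apply: cong_ap.
apply: (@cong_At p K v W cst (az hp) (ageom hp) (ap_filtration hp)) => //.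
- by move=> d x y; exact: cong_const.
- exact: apball_zp.
- exact: apball_geom.
Qed.

Lemma cong_aD e x y : cong fa e x y -> cong fa e (aD x) (aD y).
Proof. by case=> hx hy hxy; split; rewrite /= -?aDB; exact: aball_D. Qed.

Lemma cong_aconst e x y : cong fv e x y -> cong fa e (aconst x) (aconst y).
Proof. by move=> h; apply/cong_ap/cong_const. Qed.

Lemma cong_eqn_coef e h h' a j : 0 <= e -> cong fv e h h' -> (forall k, a k \in Z_p) ->
  cong fa e (eqn_coef h a j) (eqn_coef h' a j).
Proof.
move=> e0 ch ha.
have cpa k : cong fv e (p%:R * a k) (p%:R * a k).
  by apply: cong_refl => //=; apply: absballM; [exact: pabs_nat_le1|have := ha k; rewrite inE].
apply: congB => //; first apply: congM => //.
- by apply: cong_refl => //; exact: aball_z.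
- apply: cong_aconst; apply: cong_coef; apply: cong_lin_prod => // k.
  by apply: congB => //; apply: congM => //; exact: cong_nat.
- apply: cong_aconst; apply: cong_coef; apply: cong_lin_prod => // k.
  exact: congN.
Qed.

Variable h : K.
Hypothesis hZ : h \in Z_p.

Let pi_gt0 N : 0 < pi ^+ N. Proof. by rewrite exprn_gt0 // invr_gt0 ltr0n prime_gt0. Qed.
Let pi_le1 N : pi ^+ N <= 1. Proof. by rewrite exprn_ile1 ?pabs_p_le1 // invr_ge0 ler0n. Qed.

Lemma nat_approx_ex N : exists m : nat, v (m.+1%:R - h) < pi ^+ N.
Proof. by have [[//|m] _ hm] := Zp_nat_dense hZ (pi_gt0 N); exists m. Qed.

(* Natural numbers h_N = happ N + 1 converging to h. *)
Definition happ N : nat := xchoose (nat_approx_ex N).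

Lemma happP N : v ((happ N).+1%:R - h) <= pi ^+ N.
Proof. exact/ltW/(xchooseP (nat_approx_ex N)). Qed.

Lemma happ_cong N : cong fv (pi ^+ N) h (happ N).+1%:R.
Proof.
apply: abs_cong; [by have := hZ; rewrite inE|exact: pabs_nat_le1|].
by rewrite avBC; exact: happP.
Qed.

Lemma happ_cauchy M N : (M <= N)%N -> v ((happ N)%:R - (happ M)%:R) <= pi ^+ M.
Proof.
move=> MN.
have -> : (happ N)%:R - (happ M)%:R = ((happ N).+1%:R - h) - ((happ M).+1%:R - h) :> K.
  by rewrite -!natr1 opprB addrA subrK opprD addrACA subrr addr0.
apply: absballB; last exact: happP.
apply: le_trans (happP N) _; rewrite ler_wiXn2l ?pabs_p_le1 // invr_ge0 ler0n //.
Qed.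

Lemma cong_Zp e a : 0 <= e -> (forall k, a k \in Z_p) -> forall k : 'I_n, cong fv e (a k) (a k).
Proof. by move=> e0 ha k; apply: cong_refl => //; have := ha k; rewrite inE. Qed.

(** The integrality of a is placed under the existential so that [frobL] is a total function of
    a. *)
Lemma frobL_ex (a : 'I_n -> K) i k : exists y : W, (forall l, a l \in Z_p) ->
  forall N, aball (pi ^+ N) (y - frobN (happ N) a i 0 k).
Proof.
have [ha|ha] := pselect (forall l, a l \in Z_p); last by exists 0.
have [|M N MN|y hy] := @aseries_complete p hp (fun N => frobN (happ N) a i 0 k) (fun N => pi ^+ N).
- move=> eps eps0; have [N hN] := small_power hp eps0; exists N => m Nm.
  apply: le_lt_trans hN; rewrite ler_wiXn2l ?pabs_p_le1 // invr_ge0 ler0n //.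
- have [_ _] // := @cong_frobN (pi ^+ M) (happ N) (happ M) a a i k (ltW (pi_gt0 M))
    (happ_cauchy MN) (cong_Zp (ltW (pi_gt0 M)) ha).
by exists y.
Qed.

Definition frobL (a : 'I_n -> K) i k : W := projT1 (cid (frobL_ex a i k)).

Lemma frobL_cong a i k N : (forall l, a l \in Z_p) ->
  cong fa (pi ^+ N) (frobL a i k) (frobN (happ N) a i 0 k).
Proof.
move=> ha; have := projT2 (cid (frobL_ex a i k)) ha N; rewrite -/(frobL a i k) => hN.
have [h1 _ _] := @cong_frobN (pi ^+ N) (happ N) (happ N) a a i k (ltW (pi_gt0 N))
  ltac:(by rewrite subrr av0 ltW) (cong_Zp (ltW (pi_gt0 N)) ha).
split=> //; rewrite -(subrK (frobN (happ N) a i 0 k) (frobL a i k)).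
apply: (fballD (B := fa)) => //; exact: (aballW (pi_le1 N)).
Qed.

Lemma aeq_cong (x y : W) : (forall N, cong fa (pi ^+ N) x y) -> x = y.
Proof.
move=> H; apply/eqP; rewrite -subr_eq0; apply/eqP; apply: aball_eps => e e0.
have [N hN] := small_power hp e0; have [_ _] := H N.
exact: (aballW (ltW hN)).
Qed.

Variable a : 'I_n -> K.
Hypothesis aZ : forall l, a l \in Z_p.

(** Modulo p^N this is [frobN_step] for h_N, since the rows and the connection matrix change by at
    most p^-N between h_N and h. *)
Lemma frobL_step i k :
  aD (frobL a i k) + aconst p%:R * \sum_j frobL a i j * Atil h a j k = frobL a i.+1 k.
Proof.
apply: aeq_cong => N; have e0 := ltW (pi_gt0 N).
apply: (cong_trans e0 (y := frobN (happ N) a i.+1 0 k)); last first.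
  by apply: cong_sym => //; exact: frobL_cong.
rewrite -frobN_step !mxE; apply: congD => //; first exact/cong_aD/frobL_cong.
apply: congM => //; first by apply: cong_aconst; exact: cong_nat.
apply: cong_sum => // j _; apply: congM => //; first exact: frobL_cong.
by apply: cong_Atil => //; [exact: happ_cong|exact: cong_Zp].
Qed.

Lemma frobL_eqn k : \sum_(j < n.+1) eqn_coef h a j * frobL a j k = 0.
Proof.
apply: aeq_cong => N; have e0 := ltW (pi_gt0 N).
have := congr1 (fun u : 'rV[W]_n => u 0 k) (frobN_eqn (happ N) a).
rewrite summxE [X in _ = X]mxE => e1; rewrite -[X in cong _ _ _ X]e1.
apply: cong_sum => // j _; rewrite mxE; apply: congM => //; last exact: frobL_cong.
by apply: cong_eqn_coef => //; exact: happ_cong.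
Qed.

End FrobeniusLimit.

(** * Continuous extension to Z_p of the gamma quotients *)

Section PadicLimits.
Variables (p : nat) (hp : prime p).
Local Notation K := (Q_p hp).
Local Notation v := (pabs hp).
Local Notation fv := (abs_filtration v).
Local Notation pi := (p%:R^-1 : rat).

(** Neighborhoods that are nested and nonempty at every scale provide one index close to both
    candidate limits, hence uniqueness. *)
Lemma plimE (I : Type) (near : rat -> I -> Prop) (f : I -> K) y :
  (forall d d' i, d <= d' -> near d i -> near d' i) ->
  (forall d, 0 < d -> exists i, near d i) ->
  tends_to near f y -> plim near f = y.
Proof.
move=> mono ne hy; have hl : tends_to near f (plim near f).
  pose A : set K := fun y => tends_to near f y; have hA : A y by exact: hy.
  exact: (xgetI 0 hA).
apply/eqP; rewrite -subr_eq0; apply/eqP; apply: (@av_le_eps _ v) => e e0.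
have [d d0 hd] := hl e e0; have [d' d'0 hd'] := hy e e0.
have m0 : 0 < Num.min d d' by rewrite lt_min d0.
have ml : Num.min d d' <= d by rewrite ge_min lexx.
have mr : Num.min d d' <= d' by rewrite ge_min lexx orbT.
have [i hi] := ne _ m0.
have h1 := hd i (mono _ _ _ ml hi).
have h2 := hd' i (mono _ _ _ mr hi).
rewrite -(subrK (f i) (plim near f)) -addrA; apply: absballD; last exact: ltW.
by rewrite avBC ltW.
Qed.

(** The values along natural numbers tending to x are Cauchy, and by the ultrametric inequality the
    Lipschitz constant 1 survives the limit. *)
Lemma Zp_extension (F : nat -> K) x : x \in Z_p ->
  (forall k l, v (F k - F l) <= v (k%:R - l%:R)) ->
  exists y, forall k, v (F k - y) <= v (k%:R - x).
Proof.
move=> hx hF.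
have pp N : 0 < pi ^+ N by rewrite exprn_gt0 // invr_gt0 ltr0n prime_gt0.
have ex N : exists m : nat, v (m%:R - x) < pi ^+ N.
  by have [m _ hm] := Zp_nat_dense hx (pp N); exists m.
pose s N := xchoose (ex N).
have hs N : v ((s N)%:R - x) < pi ^+ N by exact: (xchooseP (ex N)).
have small e : 0 < e -> exists N, forall n, (N <= n)%N -> v ((s n)%:R - x) < e.
  move=> e0; have [N hN] := small_power hp e0; exists N => k Nk.
  apply: lt_le_trans (hs k) _; apply: le_trans (ltW hN).
  by rewrite ler_wiXn2l ?pabs_p_le1 // invr_ge0 ler0n.
have dist k l : v (k%:R - l%:R) <= Num.max (v (k%:R - x)) (v (l%:R - x)).
  have -> : k%:R - l%:R = (k%:R - x) - (l%:R - x) :> K by rewrite opprB addrA subrK.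
  exact: avB.
have [y hy] : exists y, forall e, 0 < e -> exists N, forall n, (N <= n)%N -> v (F (s n) - y) < e.
  apply: completion_complete => e e0; have [N hN] := small e e0.
  exists N => k l Nk Nl; apply: le_lt_trans (hF _ _) _; apply: le_lt_trans (dist _ _) _.
  by rewrite gt_max !hN.
exists y => k; rewrite leNgt; apply/negP => hk.
have c0 : 0 < v (F k - y) by apply: le_lt_trans hk; exact: av_ge0.
have [N hN] := small _ c0; have [M hM] := hy _ c0.
have : v (F k - y) < v (F k - y).
  rewrite -{1}(subrK (F (s (maxn N M))) (F k)) -addrA.
  apply: avD_lt; last by apply: hM; exact: leq_maxr.
  apply: le_lt_trans (hF _ _) _; apply: le_lt_trans (dist _ _) _.
  by rewrite gt_max hk hN // leq_maxl.
by rewrite ltxx.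
Qed.

Lemma gval_lip k l : v (gval p K k - gval p K l) <= v (k%:R - l%:R).
Proof.
have [_ _] // := @gval_cong p hp K v (@pabs_nat p hp) (v (k%:R - l%:R)) k l (av_ge0 _ _) (lexx _).
Qed.

(* Continuous extension of m |-> Gamma_p(pm). *)
Definition gam (x : K) : K :=
  if pselect (x \in Z_p) is left hx then projT1 (cid (Zp_extension hx gval_lip)) else 0.

Lemma gamP x k : x \in Z_p -> v (gval p K k - gam x) <= v (k%:R - x).
Proof.
by rewrite /gam; case: pselect => // hx _; exact: (projT2 (cid (Zp_extension hx gval_lip))).
Qed.

Lemma gam_cong e x k : x \in Z_p -> v (k%:R - x) <= e ->
  cong fv e (gval p K k) (gam x) /\ v (gam x) = 1.
Proof.
move=> hx hk.
have [m _ hm] := Zp_nat_dense hx (ltr01 : 0 < 1 :> rat).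
have u : v (gam x) = 1.
  rewrite -(gval_unit hp m); apply: av_eq_near; rewrite gval_unit avBC.
  exact: le_lt_trans (gamP m hx) hm.
split=> //; apply: abs_cong; rewrite ?gval_unit ?u //.
exact: le_trans (gamP k hx) hk.
Qed.

Lemma g_nat_cong e h m (k l : nat) : h \in Z_p -> m \in Z_p -> 0 < e -> (0 < k)%N ->
  v (k%:R - h) <= e -> v (l%:R - m) <= e ->
  cong fv e ((gpoly p K k).[l%:R] / gval p K k) (gam (m + h) / (gam m * gam h)).
Proof.
move=> hh hm e0 k0 hk hl.
have hmh : m + h \in Z_p by move: hh hm; rewrite !inE => hh hm; exact: absballD.
have hlk : v ((l + k)%:R - (m + h)) <= e.
  by rewrite natrD opprD addrACA; exact: absballD.
have [c1 _] := gam_cong hmh hlk; have [c2 u2] := gam_cong hm hl; have [c3 u3] := gam_cong hh hk.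
have -> : (gpoly p K k).[l%:R] = gval p K (l + k) / gval p K l.
  by rewrite -gpoly_shift mulfK // gval_neq0.
rewrite -mulrA -invfM; apply: congM => //; first exact: ltW.
apply: cong_inv; rewrite ?avM ?gval_unit ?u2 ?u3 ?mulr1 //; first exact: ltW.
by apply: congM => //; exact: ltW.
Qed.

Lemma gE h m : h \in Z_p -> m \in Z_p -> g h m = gam (m + h) / (gam m * gam h).
Proof.
move=> hh hm; apply: plimE.
- by move=> d d' i dd [h1 h2 h3]; split=> //; exact: lt_le_trans dd.
- move=> d d0; have [k k0 hk] := Zp_nat_dense hh d0; have [l _ hl] := Zp_nat_dense hm d0.
  by exists (k, l).
move=> e e0; exists (e / 2); first by rewrite divr_gt0.
move=> [k l] [/= k0 hk hl]; rewrite g_natE //.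
have e20 : 0 < e / 2 by rewrite divr_gt0.
have [_ _ /= hc] := g_nat_cong hh hm e20 k0 (ltW hk) (ltW hl).
by apply: le_lt_trans hc _; lra.
Qed.

(** [g] is defined through natural second arguments. A natural l close to m relates it to the
    polynomial at m itself, the form in which it occurs in H_0 at a_j. *)
Lemma g_approx e h m (k : nat) : h \in Z_p -> m \in Z_p -> 0 < e -> (0 < k)%N ->
  v (k%:R - h) <= e -> v ((gpoly p K k).[m] / gval p K k - g h m) <= e.
Proof.
move=> hh hm e0 k0 hk; have [l _ hl] := Zp_nat_dense hm e0.
rewrite gE //; set G := gam _ / _.
suff [_ _] : cong fv e ((gpoly p K k).[m] / gval p K k) G by [].
have e0' := ltW e0.
apply: (cong_trans e0' (y := (gpoly p K k).[l%:R] / gval p K k)); last first.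
  by apply: g_nat_cong => //; exact: ltW.
apply: congM => //; last by apply: cong_refl; rewrite //= avV gval_unit invr1.
apply: cong_horner => //; first exact: cong_gpoly_refl.
apply: abs_cong; [by move: hm; rewrite inE|exact: pabs_nat_le1|by rewrite avBC ltW].
Qed.

Lemma g_unit h m : h \in Z_p -> m \in Z_p -> v (g h m) = 1.
Proof.
move=> hh hm; rewrite gE // avM avV avM.
have hmh : m + h \in Z_p by move: hh hm; rewrite !inE => hh hm; exact: absballD.
have le2 x : x \in Z_p -> v (0%:R - x) <= 1 by rewrite inE sub0r avN.
have [_ u1] := gam_cong hh (le2 _ hh); have [_ u2] := gam_cong hm (le2 _ hm).
have [_ u3] := gam_cong hmh (le2 _ hmh).
by rewrite u1 u2 u3 !mulr1.
Qed.

Lemma Gamma_pE x : x \in Z_p -> Gamma_p (p%:R * x) = gam x.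
Proof.
move=> hx; have pi0 : 0 < pi by rewrite invr_gt0 ltr0n prime_gt0.
apply: plimE.
- by move=> d d' i dd; move/lt_le_trans; exact.
- move=> d d0; have [k _ hk] := Zp_nat_dense hx d0; exists (p * k)%N.
  rewrite natrM -mulrBr avM; apply: le_lt_trans hk.
  by rewrite ler_piMl ?av_ge0 // pabs_nat_le1.
(* Within 1/p of px every natural number is a multiple pk of p, and |pk - px| = |k - x| / p. *)
move=> e e0; exists (Num.min pi (pi * e)); first by rewrite lt_min pi0 mulr_gt0.
move=> m; rewrite lt_min => /andP[h1 h2].
have pm : (p %| m)%N.
  rewrite -[(p %| m)%N]/(p %| `|m%:Z|)%N -[p in (p %| _)%N]expn1 -(pabs_int_le hp) expr1 -pmulrn.
  rewrite -(subrK (p%:R * x) m%:R); apply: absballD; first exact: ltW.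
  rewrite avM pabs_p ler_piMr ?(ltW pi0) //; by move: hx; rewrite inE.
case/dvdnP: pm h1 h2 => k -> _; rewrite mulnC -gval_Gamma natrM -mulrBr avM pabs_p ltr_pM2l // => hk.
exact: le_lt_trans (gamP k hx) hk.
Qed.

(** Every argument of Gamma_p here is p times an element of Z_p, so [gam] gives all the values. *)
Lemma gamma_classE (n : nat) h (a : 'I_n -> K) i : h \in Z_p -> (forall k, a k \in Z_p) ->
  gamma_class h a (a i) = \prod_(j < n) g h (a i - a j).
Proof.
move=> hh ha; apply: eq_bigr => j _.
have hij : a i - a j \in Z_p.
  by have := ha i; have := ha j; rewrite !inE => h1 h2; exact: absballB.
have hijh : a i - a j + h \in Z_p.
  by move: hij hh; rewrite !inE => h1 h2; exact: absballD.
rewrite gE // -mulrBr -mulrDr -mulrBr !Gamma_pE //.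
  by rewrite addrAC.
by rewrite addrAC.
Qed.

End PadicLimits.

(** * Values of the Frobenius rows on the power series solutions *)

Section PairingValues.
Variables (K : fieldType) (p : nat).
Hypothesis p_gt0 : (0 < p)%N.
Hypothesis p_neq0 : p%:R != 0 :> K.
Variables (R : comNzRingType) (D : R -> R) (cst : {rmorphism K -> R}) (z om : R).
Variable n' : nat.
Local Notation n := n'.+1.
Variables (h : K) (a : 'I_n -> K) (j : 'I_n) (H : nat -> {poly K}).
Local Notation al := (a j).
Local Notation redh := (red D cst p z om h a).
Local Notation frow := (frob_row D cst p z om h a H).

Lemma horner_lin_prod (c : 'I_n -> K) x : (lin_prod c).[x] = \prod_i (x + c i).
Proof. by rewrite /lin_prod horner_prod; apply: eq_bigr => i _; rewrite hornerD hornerX hornerC. Qed.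

Lemma hypden_root : (hypden a).[al] = 0.
Proof. by rewrite horner_lin_prod (bigD1 j) //= subrr mul0r. Qed.

Lemma horner_lin_arg q r x : (lin_arg K q r).[x] = q%:R * x + r%:R.
Proof. by rewrite /lin_arg hornerD hornerZ hornerX hornerC. Qed.

Section ConstantTerm.
Variable rho : {rmorphism R -> K}.
Hypothesis rho_th : forall x, rho (th D cst p x) = 0.
Hypothesis rho_cst : forall c, rho (cst c) = c.
Hypothesis rho_z : rho z = 0.
Hypothesis rho_om : rho om = 1.

Let w : 'cV[K]_n := \col_k al ^+ k.

(** At z = 0 the matrix [At] is the companion matrix of [hypden], for which the powers of the root
    a_j form an eigenvector. *)
Let wP : map_mx (fun _ : K => 0) w + al *: w = map_mx rho (At cst p z om h a) *m w.
Proof.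
apply/matrixP => i k; rewrite !mxE add0r -exprS.
case: (ltnP i.+1 n) => hi.
  rewrite (bigD1 (Ordinal hi)) //= big1 ?addr0 => [|l il]; rewrite !mxE hi.
    by rewrite eqxx rmorph1 mul1r.
  by rewrite (negbTE (_ : (l : nat) != i.+1)) // rmorph0 mul0r.
have -> : i.+1 = n by apply/eqP; rewrite eqn_leq hi ltn_ord.
have := hypden_root; rewrite (@horner_coef_wide _ n.+1); last first.
  by apply/leq_sizeP => l; exact: (lin_prod_coef _).2.
rewrite big_ord_recr /= (lin_prod_coef _).1 mul1r => /eqP; rewrite addrC addr_eq0 => /eqP ->.
rewrite -sumrN; apply: eq_bigr => l _; rewrite !mxE ltnNge hi /=.
by rewrite rmorphM rmorphB rmorphM rmorphXn /= rho_z rho_om !rho_cst expr0n gtn_eqF // mul0r sub0r mul1r mulNr.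
Qed.

(** At z = 0 only the summand r = 0 of [frob_row] survives. *)
Lemma pairing_row_const i :
  \sum_k rho (frow 'X^i 0 k) * al ^+ k = (p%:R * al) ^+ i * (H 0%N).[al].
Proof.
have add0 : forall x y : K, 0 = 0 + 0 :> K by move=> _ _; rewrite addr0.
have mul0 : forall x y : K, 0 = 0 * y + x * 0 :> K by move=> x y; rewrite mul0r mulr0 addr0.
have pr G : pairing rho w (redh G) = G.[al].
  rewrite (pairing_red (th' := fun _ => 0) add0 mul0 rho_th wP) horner_coef.
  apply: eq_bigr => l _; rewrite rho_cst; congr (_ * _).
  elim: (nat_of_ord l) => [|m IH]; first by rewrite /= mxE.
  by rewrite iterS IH add0r exprS.
have -> : \sum_k rho (frow 'X^i 0 k) * al ^+ k = pairing rho w (frow 'X^i).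
  by rewrite /pairing mxE; apply: eq_bigr => k _; rewrite !mxE.
rewrite /frob_row pairing_sum; case: p p_gt0 pr => // p' _ pr.
rewrite big_ord_recl big1 ?addr0 => [|r _]; rewrite pairingZ rmorphXn /= rho_z.
  rewrite expr0 mul1r pr hornerM; congr (_ * _).
  by rewrite comp_Xn_poly horner_exp horner_lin_arg addr0.
by rewrite exprS !mul0r.
Qed.

End ConstantTerm.

Section SeriesValues.
Variable rho : {rmorphism R -> ps K}.
Hypothesis rho_D : forall x, rho (D x) = ps_D (rho x).
Hypothesis rho_cst : forall c, rho (cst c) = ps_const c.
Hypothesis rho_z : rho z = ps_of_poly 'X.
Hypothesis rho_om : rho om = ps_geom K p.

Variables (f f' : nat -> K).
Hypothesis f_rec : forall e,
  (hypden a).[e.+1%:R + al] * f e.+1 = (hypnum h a).[e%:R + al] * f e.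
Local Notation num' := (lin_prod (fun k => p%:R * h - p%:R * a k)).
Local Notation den' := (lin_prod (fun k => - (p%:R * a k))).
Hypothesis f'_rec : forall d,
  den'.[d.+1%:R + p%:R * al] * f' d.+1 = num'.[d%:R + p%:R * al] * f' d.
Hypothesis den'_neq0 : forall d, den'.[d.+1%:R + p%:R * al] != 0.
Hypothesis f0 : f 0%N = 1.
Hypothesis f'0 : f' 0%N = 1.
Hypothesis H_step : forall r, (r.+1 < p)%N ->
  (den' \Po lin_arg K p r.+1) * H r.+1 = (num' \Po lin_arg K p r) * H r.
Hypothesis H_wrap : (num' \Po lin_arg K p p.-1) * H p.-1 =
  p%:R ^+ n *: (hypnum h a * (H 0%N \Po ('X + 1%:P))).

Definition ps_subst (g : nat -> K) : ps K := fun d => if (p %| d)%N then g (d %/ p)%N else 0.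

Let th' (x : ps K) : ps K := ps_const p%:R^-1 * ps_D x.
Let wk k : ps K := ps_subst (fun e => (e%:R + al) ^+ k * f e).
Let w : 'cV[ps K]_n := \col_k wk k.

Let th'_add x y : th' (x + y) = th' x + th' y.
Proof.
have := ps_DB (x + y) y; rewrite addrK => e.
by rewrite /th' e mulrBr subrK.
Qed.
Let th'_mul x y : th' (x * y) = th' x * y + x * th' y.
Proof. by rewrite /th' ps_DM; ring. Qed.
Let rho_th x : rho (th D cst p x) = th' (rho x).
Proof. by rewrite /th rmorphM /= rho_cst rho_D. Qed.

Lemma th'_subst (g : nat -> K) c : th' (ps_subst g) + ps_const c * ps_subst g =
  ps_subst (fun e => (e%:R + c) * g e).
Proof.
apply/funext => d; rewrite /th' psD !ps_constM /ps_D /ps_subst; case: ifP => pd; last first.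
  by rewrite mul0rn !mulr0 addr0.
have dE : d%:R = (d %/ p)%:R * p%:R :> K by rewrite -natrM divnK.
rewrite -[g _ *+ d]mulr_natr dE mulrDl; congr (_ + _).
by rewrite mulrC -!mulrA mulfV // mulr1 mulrC.
Qed.

Let wkS k : th' (wk k) + ps_const al * wk k = wk k.+1.
Proof.
rewrite th'_subst; congr ps_subst; apply/funext => e.
by rewrite exprS mulrA.
Qed.

Lemma ps_subst_sum (P : {poly K}) m : (size P <= m)%N ->
  \sum_(l < m) ps_const P`_l * wk l = ps_subst (fun e => P.[e%:R + al] * f e).
Proof.
move=> hm; apply/funext => d; rewrite ps_sum /ps_subst.
under eq_bigr do rewrite ps_constM /wk /ps_subst.
case: ifP => pd; last by rewrite big1 // => l _; rewrite mulr0.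
by rewrite (horner_coef_wide _ hm) mulr_suml; apply: eq_bigr => l _; rewrite mulrA.
Qed.

Let equation : \sum_(l < n.+1) (ps_of_poly 'X^p * ps_const (hypnum h a)`_l
  - ps_const (hypden a)`_l) * wk l = 0.
Proof.
have sz (c : 'I_n -> K) : (size (lin_prod c) <= n.+1)%N.
  by apply/leq_sizeP => l; exact: (@lin_prod_coef K n' c).2.
under eq_bigr do rewrite mulrBl -mulrA.
rewrite sumrB -mulr_sumr !ps_subst_sum ?sz //.
apply/funext => d; rewrite psB ps_XnM /ps_subst.
have [pd|npd] := boolP (p %| d)%N; last first.
  rewrite subr0; case: leqP => // le_pd; case: ifP => // pd.
  by case/negP: npd; rewrite -(subnK le_pd) dvdn_addl.
case/dvdnP: pd => -[|e] ->.
  by rewrite mul0n leqNgt p_gt0 div0n (add0r al) hypden_root mul0r subrr.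
by rewrite leq_pmull // mulSn addKn dvdn_mull // -mulSn !mulnK // f_rec subrr.
Qed.

Let wP : map_mx th' w + ps_const al *: w = map_mx rho (At cst p z om h a) *m w.
Proof.
apply/matrixP => i k; rewrite !mxE.
rewrite [LHS](wkS i); case: (ltnP i.+1 n) => hi.
  rewrite (bigD1 (Ordinal hi)) //= big1 ?addr0 => [|l il]; rewrite !mxE hi.
    by rewrite eqxx rmorph1 mul1r.
  by rewrite (negbTE (_ : (l : nat) != i.+1)) // rmorph0 mul0r.
have -> : i.+1 = n by apply/eqP; rewrite eqn_leq hi ltn_ord.
have := equation; rewrite big_ord_recr /= !(lin_prod_coef _).1.
rewrite /ps_const rmorph1 mulr1 => /eqP; rewrite addr_eq0 -mulNr opprB => /eqP e1.
(* Writing 1 as the geometric series times 1 - z^p divides the equation by its leading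
   coefficient. *)
rewrite -[LHS]mul1r -(ps_geomP _ p_gt0) -mulrA rmorphB rmorph1 /= -e1 mulr_sumr.
apply: eq_bigr => l _; rewrite !mxE ltnNge hi /=.
by rewrite rmorphM rmorphB rmorphM (rmorphXn rho) /= rho_z rho_om !rho_cst mulrA -rmorphXn.
Qed.

Let pr G : pairing rho w (redh G) = ps_subst (fun e => G.[e%:R + al] * f e).
Proof.
rewrite (pairing_red th'_add th'_mul rho_th wP) -(ps_subst_sum (leqnn (size G))).
apply: eq_bigr => l _; rewrite rho_cst; congr (_ * _).
elim: (nat_of_ord l) => [|m IH]; first by rewrite /= mxE.
by rewrite iterS IH wkS.
Qed.

(** Both sides agree at d = 0 and satisfy the same first-order recursion in d, whose leading factor
    does not vanish. The left side follows it by [H_step] within a block of length p, and by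
    [H_wrap] together with [f_rec] at a carry. *)
Lemma frob_poly_values d :
  (H (d %% p)%N).[(d %/ p)%:R + al] * f (d %/ p)%N = (H 0%N).[al] * f' d.
Proof.
elim: d => [|d IH]; first by rewrite mod0n div0n add0r f0 f'0.
apply: (mulfI (den'_neq0 d)); rewrite [RHS]mulrCA f'_rec [RHS]mulrCA -IH.
set e := (d %/ p)%N in IH *; set r := (d %% p)%N in IH *.
have rp : (r < p)%N by rewrite ltn_mod.
have dE : d = (e * p + r)%N by exact: divn_eq.
have dx : d%:R + p%:R * al = p%:R * (e%:R + al) + r%:R :> K by rewrite {1}dE natrD natrM; ring.
have [rp1|rp1] := ltnP r.+1 p.
  have -> : (d.+1 %/ p = e)%N by rewrite dE -addnS divnMDl // divn_small // addn0.
  have -> : (d.+1 %% p = r.+1)%N by rewrite dE -addnS modnMDl modn_small.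
  have := congr1 (fun P : {poly K} => P.[e%:R + al]) (H_step rp1).
  rewrite /= !hornerM !horner_comp !horner_lin_arg -dx !mulrA => <-; congr (_.[_] * _ * _).
  by rewrite -!natr1 addrAC dx addrA.
(* In the remaining case d + 1 is a multiple of p, so the quotient increases and the residue returns
   to 0. *)
have rE : r = p.-1 by apply/eqP; rewrite eqn_leq -ltnS prednK // rp -ltnS prednK.
have -> : (d.+1 %/ p = e.+1)%N.
  by rewrite dE -addnS rE prednK // -mulSnr mulnK.
have -> : (d.+1 %% p = 0)%N by rewrite dE -addnS rE prednK // -mulSnr modnMl.
have := congr1 (fun P : {poly K} => P.[e%:R + al]) H_wrap.
rewrite /= -rE hornerZ !hornerM !horner_comp horner_lin_arg -dx hornerD hornerX hornerC => e1.
rewrite [RHS]mulrA e1; have -> : e%:R + al + 1 = e.+1%:R + al by rewrite -natr1 addrAC.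
have -> : den'.[d.+1%:R + p%:R * al] = p%:R ^+ n * (hypden a).[e.+1%:R + al].
  have -> : p%:R ^+ n = \prod_(i < n) p%:R :> K by rewrite prodr_const card_ord.
  rewrite !horner_lin_prod -big_split; apply: eq_bigr => i _ /=.
  have -> : d.+1%:R = p%:R * e.+1%:R :> K.
    by rewrite dE -addnS rE prednK // -mulSnr natrM mulrC.
  ring.
transitivity (p%:R ^+ n * (H 0%N).[e.+1%:R + al] * ((hypden a).[e.+1%:R + al] * f e.+1)).
  by ring.
by rewrite f_rec; ring.
Qed.

Lemma pairing_row_series i d :
  (\sum_k rho (frow 'X^i 0 k) * wk k) d =
  (H 0%N).[al] * ((d%:R + p%:R * al) ^+ i * f' d).
Proof.
have -> : \sum_k rho (frow 'X^i 0 k) * wk k = pairing rho w (frow 'X^i).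
  by rewrite /pairing mxE; apply: eq_bigr => k _; rewrite !mxE.
rewrite /frob_row pairing_sum ps_sum.
have rp : (d %% p < p)%N by rewrite ltn_mod.
(* The summand of index r is z^r times a series in z^p, so degree d only sees r = d mod p. *)
have term (r : 'I_p) : pairing rho w (z ^+ r *: redh (('X^i \Po lin_arg K p r) * H r)) d =
   if (r == d %% p :> nat)%N then
     (d%:R + p%:R * al) ^+ i * ((H r).[(d %/ p)%:R + al] * f (d %/ p)%N) else 0.
  rewrite pairingZ rmorphXn /= rho_z -rmorphXn ps_XnM pr /ps_subst.
  case: leqP => rd; last first.
    by case: eqP => // e; move: rd; rewrite e ltnNge leq_mod.
  have -> : (p %| d - r)%N = (r == d %% p :> nat)%N.
    by rewrite -eqn_mod_dvd // eq_sym modn_small // eq_sym.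
  case: eqP => // rE; have dE : (d - r = d %/ p * p)%N.
    by rewrite {1}(divn_eq d p) rE addnK.
  rewrite dE mulnK // hornerM comp_Xn_poly horner_exp horner_lin_arg mulrA.
  congr (_ ^+ _ * _ * _); rewrite [in RHS](divn_eq d p) -rE natrD natrM; ring.
rewrite (bigD1 (Ordinal rp)) // big1 ?addr0 => [|r rE].
  by rewrite term /= eqxx frob_poly_values addr0 mulrCA.
by rewrite term; case: eqP => // e; case/eqP: rE; apply: val_inj.
Qed.

End SeriesValues.

End PairingValues.

(** * Limits of sequences *)

Section SequenceLimits.
Variables (F : fieldType) (v : absval F).

Definition converges (u : nat -> F) (y : F) : Prop :=
  forall e, 0 < e -> exists N, forall n, (N <= n)%N -> v (u n - y) < e.

Lemma cvg_uniq u y y' : converges u y -> converges u y' -> y = y'.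
Proof.
move=> hy hy'; apply/eqP; rewrite -subr_eq0; apply/eqP; apply: (@av_le_eps _ v) => e e0.
have [N hN] := hy e e0; have [M hM] := hy' e e0.
have -> : y - y' = (u (maxn N M) - y') - (u (maxn N M) - y) by ring.
by apply: absballB; apply: ltW; [apply: hM; exact: leq_maxr|apply: hN; exact: leq_maxl].
Qed.

Lemma cvg_cst c : converges (fun _ => c) c.
Proof. by move=> e e0; exists 0%N => n _; rewrite subrr av0. Qed.

Lemma cvgD u u' y y' : converges u y -> converges u' y' -> converges (fun n => u n + u' n) (y + y').
Proof.
move=> hy hy' e e0; have [N hN] := hy e e0; have [M hM] := hy' e e0.
exists (maxn N M) => n; rewrite geq_max => /andP[a b].
by rewrite opprD addrACA; apply: avD_lt; [exact: hN|exact: hM].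
Qed.

Lemma cvgM u u' y y' : converges u y -> converges u' y' -> converges (fun n => u n * u' n) (y * y').
Proof.
move=> hy hy' e e0.
have y0 := av_ge0 v y; have y'0 := av_ge0 v y'.
pose c := 1 + v y + v y'; have c0 : 0 < c by rewrite /c; lra.
have d0 : 0 < Num.min 1 (e / c) by rewrite lt_min ltr01 divr_gt0.
have [N hN] := hy _ d0; have [M hM] := hy' _ d0.
exists (maxn N M) => n; rewrite geq_max => /andP[/hN h1 /hM h2].
have -> : u n * u' n - y * y' = (u n - y) * (u' n - y') + (u n - y) * y' + y * (u' n - y') by ring.
move: h1 h2; rewrite !lt_min !ltr_pdivlMr // => /andP[h1 h1'] /andP[h2 h2'].
have a1 := av_ge0 v (u n - y); have a2 := av_ge0 v (u' n - y').
by apply: avD_lt; [apply: avD_lt|]; rewrite avM; rewrite /c in h1' h2'; nra.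
Qed.

Lemma cvg_sum I (r : seq I) (P : pred I) (u : I -> nat -> F) y :
  (forall i, P i -> converges (u i) (y i)) ->
  converges (fun n => \sum_(i <- r | P i) u i n) (\sum_(i <- r | P i) y i).
Proof.
move=> h; elim: r => [|i r IH].
  by have -> : (fun n => \sum_(i <- [::] | P i) u i n) = (fun _ => 0);
    [apply/funext => n; rewrite big_nil|rewrite big_nil; exact: cvg_cst].
have -> : (fun n => \sum_(j <- i :: r | P j) u j n) =
    (fun n => (if P i then u i n else 0) + \sum_(j <- r | P j) u j n).
  by apply/funext => n; rewrite big_cons; case: ifP => //; rewrite add0r.
rewrite big_cons; case: ifP => Pi; first exact: cvgD (h i Pi) IH.
by rewrite -[X in converges _ X]add0r; exact: cvgD (cvg_cst 0) IH.
Qed.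

Lemma cvg_prod I (r : seq I) (P : pred I) (u : I -> nat -> F) y :
  (forall i, P i -> converges (u i) (y i)) ->
  converges (fun n => \prod_(i <- r | P i) u i n) (\prod_(i <- r | P i) y i).
Proof.
move=> h; elim: r => [|i r IH].
  by have -> : (fun n => \prod_(i <- [::] | P i) u i n) = (fun _ => 1);
    [apply/funext => n; rewrite big_nil|rewrite big_nil; exact: cvg_cst].
have -> : (fun n => \prod_(j <- i :: r | P j) u j n) =
    (fun n => (if P i then u i n else 1) * \prod_(j <- r | P j) u j n).
  by apply/funext => n; rewrite big_cons; case: ifP => //; rewrite mul1r.
rewrite big_cons; case: ifP => Pi; first exact: cvgM (h i Pi) IH.
by rewrite -[X in converges _ X]mul1r; exact: cvgM (cvg_cst 1) IH.
Qed.

End SequenceLimits.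

Lemma prod_mul_eq (R : comNzRingType) (I : finType) (x y z t : R) (f1 f2 g1 g2 : I -> R) :
  x = \prod_i f1 i -> y = \prod_i f2 i -> z = \prod_i g1 i -> t = \prod_i g2 i ->
  (forall i, f1 i * f2 i = g1 i * g2 i) -> x * y = z * t.
Proof. by move=> -> -> -> -> h; rewrite -!big_split; apply: eq_bigr => i _; exact: h. Qed.

(** * Hypergeometric coefficients and matrices of power series *)

Section HypergeometricCoefficients.
Variables (p : nat) (hp : prime p).
Local Notation K := (Q_p hp).
Local Notation v := (pabs hp).
Variable n' : nat.
Local Notation n := n'.+1.
Implicit Types (h : K) (a : 'I_n -> K).

Lemma hyp_f0 h a j : hyp_f h a j 0 = 1.
Proof. by rewrite /hyp_f big1 // => k _; rewrite /pochhammer !big_ord0 divr1. Qed.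

Lemma hyp_f_rec h a j e : (forall k, e.+1%:R + a j - a k != 0) ->
  (hypden a).[e.+1%:R + a j] * hyp_f h a j e.+1 = (hypnum h a).[e%:R + a j] * hyp_f h a j e.
Proof.
move=> hne.
apply: (prod_mul_eq (horner_lin_prod _ _) erefl (horner_lin_prod _ _) erefl) => k.
have := hne k; rewrite /pochhammer !big_ord_recr /=.
have gen (F : fieldType) (x y P Q hh E : F) : E + 1 + x - y != 0 ->
   (E + 1 + x - y) * ((P * (x - y + hh + E)) / (Q * (x - y + 1 + E))) = (E + x + (hh - y)) * (P / Q).
  move=> E0; have e1 : x - y + 1 + E = E + 1 + x - y by ring.
  have -> : x - y + hh + E = E + x + (hh - y) by ring.
  rewrite e1; move: (E + 1 + x - y) (E + x + (hh - y)) E0 => q s q0; rewrite invfM.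
  by transitivity ((q / q) * (s * (P / Q))); [ring|rewrite mulfV // mul1r].
by rewrite -natr1; exact: gen.
Qed.

Lemma generic_hypden a j e : (forall k, a k \in Z_p) -> generic a ->
  forall k, e.+1%:R + a j - a k != 0.
Proof.
move=> ha ga k; have [->|kj] := eqVneq k j; first by rewrite addrK Qp_natr_eq0.
have jk : j != k by rewrite eq_sym.
apply: contra (ga j k jk (- e.+1%:Z)) => /eqP h0.
by rewrite rmorphN /= -pmulrn -addr_eq0 addrC addrA h0.
Qed.

(** If p divides d + 1, a factor p comes out and genericity of a applies; otherwise d + 1 is a unit
    and dominates p(a_j - a_k). *)
Lemma generic_pscale a j d : (forall k, a k \in Z_p) -> generic a ->
  forall k, d.+1%:R + pscale a j - pscale a k != 0.
Proof.
move=> ha ga k; rewrite /pscale -addrA -mulrBr.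
have [/dvdnP [[//|q] ->]|pd] := boolP (p %| d.+1)%N.
  rewrite mulnC natrM -mulrDr mulf_neq0 ?Qp_p_neq0 // addrA.
  exact: generic_hypden.
rewrite -(av_eq0 v); rewrite (@av_eq_near _ v _ d.+1%:R); first by rewrite av_eq0 Qp_natr_eq0.
rewrite addrAC subrr add0r avM pabs_p (pabs_nat_coprime hp pd).
apply: le_lt_trans (pabs_p_lt1 hp); rewrite ler_piMr ?invr_ge0 ?ler0n //.
by have := ha j; have := ha k; rewrite !inE => h1 h2; exact: absballB.
Qed.

Lemma cvg_hyp_f (u : nat -> K) h a j d : converges v u h ->
  converges v (fun N => hyp_f (u N) a j d) (hyp_f h a j d).
Proof.
move=> hu; apply: cvg_prod => k _; apply: cvgM; last exact: cvg_cst.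
apply: cvg_prod => i _; apply: cvgD; last exact: cvg_cst.
by apply: cvgD => //; exact: cvg_cst.
Qed.

Lemma iter_ps_D_plus c (f : nat -> K) i d :
  iter i (ps_D_plus c) f d = (d%:R + c) ^+ i * f d.
Proof. by elim: i d => [|i IH] d; rewrite ?expr0 ?mul1r // iterS /ps_D_plus IH exprS mulrA. Qed.

Lemma PsiE h a d k j : Psi h a d k j = (d%:R + a j) ^+ k * hyp_f h a j d.
Proof. by rewrite mxE iter_ps_D_plus. Qed.

(** A power series of matrices becomes a matrix of power series, where associativity is that of
    matrices over a commutative ring. *)
Definition to_ps (A : nat -> 'M[K]_n) : 'M[ps K]_n := \matrix_(i, j) ((fun d => A d i j) : ps K).

Lemma to_ps_inj : injective to_ps.
Proof.
move=> A B h; apply/funext => d; apply/matrixP => i j.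
by have := congr1 (fun M : 'M[ps K]_n => M i j d) h; rewrite !mxE.
Qed.

Lemma to_ps_mul A B : to_ps (mps_mul A B) = to_ps A *m to_ps B.
Proof.
apply/matrixP => i j; rewrite !mxE; apply/funext => d; rewrite ps_sum /mps_mul summxE.
under eq_bigr do rewrite mxE; rewrite exchange_big; apply: eq_bigr => k _.
by rewrite psM; apply: eq_bigr => l _; rewrite !mxE.
Qed.

Lemma to_ps_one : to_ps (mps_one hp n) = 1%:M.
Proof.
apply/matrixP => i j; rewrite !mxE; apply/funext => d; rewrite /mps_one.
by case: eqVneq => [->|dn]; rewrite ?eqxx ?mxE; case: (i == j) => //;
  rewrite ?mulr1n ?mulr0n ?ps1 ?(negbTE dn).
Qed.

Lemma mps_mul_div (V M P : nat -> 'M[K]_n) : M 0%N \in unitmx -> mps_mul V M = P -> V = mps_mul P (mps_inv M).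
Proof.
move=> M0 <-; apply: to_ps_inj; rewrite !to_ps_mul -mulmxA -to_ps_mul mps_mulV //.
by rewrite to_ps_one mulmx1.
Qed.

Lemma Vandermonde_unit a : injective a -> (\matrix_(k, j) a j ^+ k : 'M[K]_n) \in unitmx.
Proof.
move=> ia; have -> : (\matrix_(k, j) a j ^+ k : 'M[K]_n) = Vandermonde n (\row_j a j).
  by apply/matrixP => k j; rewrite !mxE.
rewrite unitmxE det_Vandermonde unitfE; apply/prodf_neq0 => i _; apply/prodf_neq0 => j ij.
by rewrite !mxE subr_eq0 (inj_eq ia) eq_sym neq_ltn ij.
Qed.

Lemma generic_inj a : generic a -> injective a.
Proof.
move=> ga i j aij; apply/eqP; case: eqVneq => // ij.
by have := ga i j ij 0; rewrite aij subrr rmorph0 eqxx.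
Qed.

Lemma scale_unit : (diag_mx (\row_(i < n) p%:R ^+ i) : 'M[K]_n) \in unitmx.
Proof.
rewrite unitmxE det_diag unitfE; apply/prodf_neq0 => i _.
by rewrite mxE expf_neq0 // Qp_p_neq0.
Qed.

End HypergeometricCoefficients.

(** * The Frobenius matrix, its equality with U and its determinant *)

Section FrobeniusMatrix.
Variables (p : nat) (hp : prime p) (n' : nat).
Local Notation n := n'.+1.
Local Notation K := (Q_p hp).
Local Notation W := (aseries hp).
Local Notation v := (pabs hp).
Local Notation fv := (abs_filtration v).
Local Notation fa := (a_filtration hp).
Local Notation pi := (p%:R^-1 : rat).

Lemma aser_th (x : W) : aser (th (@aD p hp) (@aconst p hp) p x) 0%N = 0.
Proof. by rewrite /th aserM aser_const ps_constM aser_D /ps_D mulr0n mulr0. Qed.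

Lemma frobN_const m (a : 'I_n -> K) j i :
  \sum_k aser (frobN m a i 0 k) 0%N * a j ^+ k = (p%:R * a j) ^+ i * (frob_poly p m a 0).[a j].
Proof.
apply: (@pairing_row_const K p (prime_gt0 hp) W (@aD p hp) (@aconst p hp) (az hp) (ageom hp) n' m.+1%:R a j
  (frob_poly p m a) (@ps_coef0 K \o @aser p hp)).
- exact: aser_th.
- by move=> c; rewrite /= /ps_coef0 aser_const /ps_const /ps_of_poly coefC.
- by rewrite /= /ps_coef0 aser_z /ps_of_poly coefX.
- by rewrite /= /ps_coef0 aser_geom /ps_geom dvdn0.
Qed.

(** The k-th power of th applied to z^(p a_j) f_j(h, a, z^p), with the factor z^(p a_j) removed. *)
Definition psol (h : K) (a : 'I_n -> K) j k : ps K :=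
  ps_subst p (fun e => (e%:R + a j) ^+ k * hyp_f h a j e).

Lemma frobN_series m (a : 'I_n -> K) j i d : (forall k, a k \in Z_p) -> generic a ->
  (\sum_k aser (frobN m a i 0 k) * psol m.+1%:R a j k) d =
  (frob_poly p m a 0).[a j] *
    ((d%:R + p%:R * a j) ^+ i * hyp_f (p%:R * m.+1%:R) (pscale a) j d).
Proof.
move=> aZ ga.
have h1 := fun e => @hyp_f_rec p hp n' m.+1%:R a j e (generic_hypden j e aZ ga).
have h2 := fun e => @hyp_f_rec p hp n' (p%:R * m.+1%:R) (pscale a) j e (generic_pscale j e aZ ga).
have h3 e : (hypden (pscale a)).[e.+1%:R + pscale a j] != 0.
  have -> := horner_lin_prod (fun k => - pscale a k) (e.+1%:R + pscale a j).
  by apply/prodf_neq0 => k _; exact: (generic_pscale j e aZ ga k).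
exact: (@pairing_row_series K p (prime_gt0 hp) (Qp_p_neq0 hp) W (@aD p hp) (@aconst p hp) (az hp)
  (ageom hp) n' m.+1%:R a j (frob_poly p m a) (@aser p hp) (@aser_D p hp) (@aser_const p hp)
  (aser_z hp) (aser_geom hp) (hyp_f m.+1%:R a j) (hyp_f (p%:R * m.+1%:R) (pscale a) j) h1 h2 h3
  (hyp_f0 _ _ _) (hyp_f0 _ _ _) (fun r => @frob_poly_step p K n' m a r) (frob_poly_wrap hp m a)).
Qed.

Lemma frob_poly0 m (a : 'I_n -> K) j : (frob_poly p m a 0).[a j] =
  \prod_k ((gpoly p K m.+1).[a j - a k] / gval p K m.+1).
Proof.
rewrite /frob_poly horner_prod; apply: eq_bigr => k _.
by rewrite horner_comp hornerD hornerX hornerC krat0 hornerZ mulrC.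
Qed.

Variable h : K.
Hypothesis hZ : h \in Z_p.

Let pi_gt0 N : 0 < pi ^+ N. Proof. by rewrite exprn_gt0 // invr_gt0 ltr0n prime_gt0. Qed.

Let below_eps e : 0 < e -> exists N, forall m, (N <= m)%N -> pi ^+ m < e.
Proof.
move=> e0; have [N hN] := small_power hp e0; exists N => m Nm.
by apply: le_lt_trans hN; rewrite ler_wiXn2l ?pabs_p_le1 // invr_ge0 ler0n.
Qed.

Lemma cvg_happ : converges v (fun N => (happ hZ N).+1%:R) h.
Proof.
move=> e /below_eps [N hN]; exists N => m /hN hm.
by apply: le_lt_trans hm; exact: happP.
Qed.

Lemma cvg_frobN (a : 'I_n -> K) i k d : (forall l, a l \in Z_p) ->
  converges v (fun N => aser (frobN (happ hZ N) a i 0 k) d) (aser (frobL hZ a i k) d).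
Proof.
move=> aZ e /below_eps [N hN]; exists N => m /hN hm; apply: le_lt_trans hm.
have [_ _] := frobL_cong hZ i k m aZ; move/(_ d).
by rewrite aserB psB avBC.
Qed.

Definition Lam (a : 'I_n -> K) j : K := \prod_k g h (a j - a k).

Lemma Zp_sub (x y : K) : x \in Z_p -> y \in Z_p -> x - y \in Z_p.
Proof. by rewrite !inE; exact: absballB. Qed.

Lemma cvg_frob_poly0 (a : 'I_n -> K) j : (forall l, a l \in Z_p) ->
  converges v (fun N => (frob_poly p (happ hZ N) a 0).[a j]) (Lam a j).
Proof.
move=> aZ.
have -> : (fun N => (frob_poly p (happ hZ N) a 0).[a j]) = (fun N =>
   \prod_k ((gpoly p K (happ hZ N).+1).[a j - a k] / gval p K (happ hZ N).+1)).
  by apply/funext => N; exact: frob_poly0.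
apply: cvg_prod => k _ e /below_eps [N hN]; exists N => m /hN hm.
apply: le_lt_trans hm; apply: g_approx => //; [exact: Zp_sub|exact: happP].
Qed.

Lemma frobL_const (a : 'I_n -> K) j i : (forall l, a l \in Z_p) ->
  \sum_(k < n) aser (frobL hZ a i k) 0%N * a j ^+ k = (p%:R * a j) ^+ i * Lam a j.
Proof.
move=> aZ; apply: (@cvg_uniq _ v (fun N => \sum_(k < n) aser (frobN (happ hZ N) a i 0 k) 0%N * a j ^+ k)).
  by apply: cvg_sum => k _; apply: cvgM; [exact: cvg_frobN|exact: cvg_cst].
have -> : (fun N => \sum_(k < n) aser (frobN (happ hZ N) a i 0 k) 0%N * a j ^+ k) =
  (fun N => (p%:R * a j) ^+ i * (frob_poly p (happ hZ N) a 0).[a j]).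
  by apply/funext => N; exact: frobN_const.
by apply: cvgM; [exact: cvg_cst|exact: cvg_frob_poly0].
Qed.

Lemma frobL_series (a : 'I_n -> K) j i d : (forall k, a k \in Z_p) -> generic a ->
  (\sum_(k < n) aser (frobL hZ a i k) * psol h a j k) d =
  Lam a j * ((d%:R + p%:R * a j) ^+ i * hyp_f (p%:R * h) (pscale a) j d).
Proof.
move=> aZ ga.
apply: (@cvg_uniq _ v (fun N =>
  (\sum_(k < n) aser (frobN (happ hZ N) a i 0 k) * psol (happ hZ N).+1%:R a j k) d)).
  have E (x : 'I_n -> ps K) (y : nat -> ps K) : (\sum_(k < n) x k * y k) d =
     \sum_(k < n) \sum_(l < d.+1) x k l * y k (d - l)%N.
    by rewrite ps_sum; apply: eq_bigr => k _; rewrite psM.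
  rewrite (E (fun k => aser (frobL hZ a i k)) (psol h a j)).
  have -> : (fun N => (\sum_(k < n) aser (frobN (happ hZ N) a i 0 k) * psol (happ hZ N).+1%:R a j k) d)
    = (fun N => \sum_(k < n) \sum_(l < d.+1) aser (frobN (happ hZ N) a i 0 k) l *
         psol (happ hZ N).+1%:R a j k (d - l)%N).
    by apply/funext => N; rewrite ps_sum; apply: eq_bigr => k _; rewrite psM.
  apply: cvg_sum => k _; apply: cvg_sum => l _; apply: cvgM; first exact: cvg_frobN.
  rewrite /psol /ps_subst; case: ifP => _; last exact: cvg_cst.
  by apply: cvgM; [exact: cvg_cst|apply: cvg_hyp_f; exact: cvg_happ].
have -> : (fun N => (\sum_(k < n) aser (frobN (happ hZ N) a i 0 k) * psol (happ hZ N).+1%:R a j k) d)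
  = (fun N => (frob_poly p (happ hZ N) a 0).[a j] *
    ((d%:R + p%:R * a j) ^+ i * hyp_f (p%:R * (happ hZ N).+1%:R) (pscale a) j d)).
  by apply/funext => N; exact: frobN_series.
apply: cvgM; first exact: cvg_frob_poly0.
apply: cvgM; first exact: cvg_cst.
by apply: cvg_hyp_f; apply: cvgM; [exact: cvg_cst|exact: cvg_happ].
Qed.

(** The factors p^-k pass from the basis th^k F to the basis D^k F. *)
Definition frob_mx (a : 'I_n -> K) : 'M[W]_n :=
  \matrix_(i, k) (aconst (p%:R ^- k) * frobL hZ a i k).

Definition frob_coef (a : 'I_n -> K) (d : nat) : 'M[K]_n :=
  \matrix_(i, k) aser (frob_mx a i k) d.

Lemma frob_coefE a d i k : frob_coef a d i k = p%:R ^- k * aser (frobL hZ a i k) d.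
Proof. by rewrite !mxE aserM aser_const ps_constM. Qed.

(** U is determined by its product with the matrix that is inverted in its definition, whose
    constant term contains a Vandermonde matrix of distinct a_j. This product is given by
    [frobL_series], the factors p^-k cancelling the diagonal matrix of the p^k. *)
Lemma U_genericE (a : 'I_n -> K) : (forall k, a k \in Z_p) -> generic a ->
  U_generic h a = frob_coef a.
Proof.
move=> aZ ga; apply/esym; apply: mps_mul_div.
  rewrite unitmx_mul scale_unit /= /mps_subst dvdn0 div0n.
  have -> : Psi h a 0 = \matrix_(k, j) a j ^+ k.
    by apply/matrixP => k j; rewrite PsiE mxE hyp_f0 mulr1 add0r.
  exact/Vandermonde_unit/generic_inj.
apply/funext => d; apply/matrixP => i j.
transitivity ((\sum_(k < n) aser (frobL hZ a i k) * psol h a j k) d); last first.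
  rewrite frobL_series // /Lambda mul_mx_diag !mxE mulrC; congr (_ * _).
  exact/esym/iter_ps_D_plus.
rewrite /mps_mul summxE ps_sum.
under eq_bigr do rewrite mxE; rewrite exchange_big; apply: eq_bigr => k _ /=.
rewrite psM; apply: eq_bigr => l _; rewrite frob_coefE mul_diag_mx !mxE.
have -> : mps_subst (Psi h a) (d - l) k j = psol h a j k (d - l)%N.
  rewrite /mps_subst /psol /ps_subst; case: ifP => _; [exact: PsiE|by rewrite mxE].
have cancel (F : fieldType) (x y t : F) : x != 0 -> x^-1 * y * (x * t) = y * t.
  by move=> x0; rewrite mulrACA mulVf // mul1r.
by apply: cancel; rewrite expf_neq0 // Qp_p_neq0.
Qed.

(** The same natural h_N approximates both sides, so that only the dependence on a remains. *)
Lemma frob_coef_lip (a b : 'I_n -> K) d i k e : (forall l, a l \in Z_p) -> (forall l, b l \in Z_p) ->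
  0 < e -> (forall l, v (b l - a l) <= e) ->
  cong fv e (aser (frobL hZ b i k) d) (aser (frobL hZ a i k) d).
Proof.
move=> aZ bZ e0 hab; have [N hN] := small_power hp e0.
have c l : cong fv e (b l) (a l).
  by apply: abs_cong => //; [have := bZ l|have := aZ l]; rewrite inE.
have e0' := ltW e0.
have close c' : (forall l, c' l \in Z_p) -> cong fa e (frobL hZ c' i k) (frobN (happ hZ N) c' i 0 k).
  move=> cZ; have [h1 h2 h3] := frobL_cong hZ i k N cZ; split=> //.
  exact: (aballW (ltW hN)).
have [h1 h2 h3] : cong fa e (frobL hZ b i k) (frobL hZ a i k).
  apply: (cong_trans e0' (close _ bZ)); apply: (cong_trans e0' _ (cong_sym e0' (close _ aZ))).
  by apply: cong_frobN => //; rewrite subrr av0.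
exact: (abs_cong (h1 d) (h2 d) (h3 d)).
Qed.

Lemma frob_coef_near (a : 'I_n -> K) d i k e : (forall l, a l \in Z_p) -> 0 < e ->
  exists2 delta, 0 < delta & forall b, (forall l, b l \in Z_p) ->
    (forall l, v (b l - a l) < delta) -> v (frob_coef b d i k - frob_coef a d i k) < e.
Proof.
(* The factor p^-k of the entry enlarges distances by p^k. *)
move=> aZ e0; pose c : rat := p%:R ^+ k.
have c0 : 0 < c by rewrite exprn_gt0 // ltr0n prime_gt0.
have d0 : 0 < e / 2 / c by rewrite !divr_gt0.
exists (e / 2 / c) => // b bZ hb.
have [_ _ hd] := frob_coef_lip d i k aZ bZ d0 (fun l => ltW (hb l)).
rewrite !frob_coefE -mulrBr avM avV avX pabs_p exprVn invrK.
apply: (@le_lt_trans _ _ (c * (e / 2 / c))); first by apply: ler_wpM2l; [exact: ltW|exact: hd].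
have -> : c * (e / 2 / c) = e / 2 by rewrite mulrC divfK // gt_eqF.
by rewrite ltr_pdivrMr // ltr_pMr // ltr1n.
Qed.

Lemma U_tends (a : 'I_n -> K) d i k : (forall l, a l \in Z_p) ->
  tends_to (near_within (@generic p hp n) a) (fun b => U_generic h b d i k) (frob_coef a d i k).
Proof.
move=> aZ e e0; have [dl dl0 hdl] := frob_coef_near d i k aZ e0.
by exists dl => // b [bZ gb hb]; rewrite U_genericE //; exact: hdl.
Qed.

(** [frob_coef] is continuous in a and equals [U_generic] at generic points; these are dense, so it
    gives the limit defining U elsewhere. *)
Lemma U_frob_coef (a : 'I_n -> K) d : (forall l, a l \in Z_p) -> U h a d = frob_coef a d.
Proof.
move=> aZ; rewrite /U; case: asboolP => ga; first by rewrite U_genericE.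
apply/matrixP => i k; rewrite mxE; apply: plimE.
- move=> d1 d2 b d12 [h1 h2 h3]; split=> // l; exact: lt_le_trans (h3 l) d12.
- by move=> d1 d10; exact: generic_dense.
- exact: U_tends.
Qed.

Lemma frob_coef0_fixed (a : 'I_n -> K) : (forall l, a l \in Z_p) ->
  acts_on_fixed_points (gamma_class h) a (frob_coef a 0).
Proof.
move=> aZ j; apply/matrixP => i k; rewrite !mxE gamma_classE // -/(Lam a j).
transitivity (\sum_(k < n) aser (frobL hZ a i k) 0%N * a j ^+ k).
  apply: eq_bigr => l _; rewrite frob_coefE mxE.
  have cancel (F : fieldType) (x y c : F) m : x != 0 -> x ^- m * y * (x * c) ^+ m = y * c ^+ m.
    by move=> x0; rewrite exprMn mulrACA mulVf ?mul1r // expf_neq0.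
  by apply: cancel; exact: Qp_p_neq0.
by rewrite frobL_const // mulrC.
Qed.

Lemma Lam_unit (a : 'I_n -> K) j : (forall l, a l \in Z_p) -> v (Lam a j) = 1.
Proof.
by move=> aZ; rewrite /Lam av_prod big1 // => k _; apply: g_unit => //; exact: Zp_sub.
Qed.

Definition fixed_points (a : 'I_n -> K) : 'M[K]_n := \matrix_(k, j) (p%:R * a j) ^+ k.

Lemma fixed_points_unit (a : 'I_n -> K) : injective a -> fixed_points a \in unitmx.
Proof.
by move=> ia; apply: (@Vandermonde_unit p hp n' (pscale a)) => i j /(mulfI (Qp_p_neq0 hp)) /ia.
Qed.

Lemma acts_unique (c : ('I_n -> K) -> K -> K) (a : 'I_n -> K) (M N : 'M[K]_n) : injective a ->
  acts_on_fixed_points c a M -> acts_on_fixed_points c a N -> M = N.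
Proof.
move=> ia hM hN; apply: (can_inj (mulmxK (fixed_points_unit ia))).
apply/matrixP => i j.
have col (L : 'M[K]_n) : (L *m fixed_points a) i j = (L *m fixed_point a j) i 0.
  by rewrite !mxE; apply: eq_bigr => k _; rewrite !mxE.
by rewrite !col hM hN.
Qed.

Definition frob_num (a : 'I_n -> K) : 'M[K]_n := \matrix_(i, k) aser (frobL hZ a i k) 0%N.

(** By [frobL_const], multiplying by the Vandermonde matrix V of the a_j gives diag(p^i) V
    diag(Lambda_j) with Lambda_j units; the determinant of V then cancels. *)
Lemma det_frob_num (a : 'I_n -> K) : (forall l, a l \in Z_p) -> injective a ->
  v (\det (frob_num a)) = \prod_(k < n) pi ^+ k.
Proof.
move=> aZ ia; pose V0 : 'M[K]_n := \matrix_(k, j) a j ^+ k.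
have V0u : \det V0 != 0 by have := Vandermonde_unit ia; rewrite unitmxE unitfE.
have e1 : frob_num a *m V0 =
    diag_mx (\row_(i < n) p%:R ^+ i) *m V0 *m diag_mx (\row_j Lam a j).
  apply/matrixP => i j; rewrite mul_mx_diag mul_diag_mx !mxE.
  rewrite -exprMn -frobL_const //; apply: eq_bigr => k _; by rewrite !mxE.
have := congr1 (fun M : 'M[K]_n => v (\det M)) e1.
rewrite /= !det_mulmx !avM mulrAC !det_diag !av_prod.
have v0 : v (\det V0) != 0 by rewrite av_eq0.
move/(mulIf v0) => ->.
rewrite [X in _ * X]big1 => [|j _]; last by rewrite mxE Lam_unit.
by rewrite mulr1; apply: eq_bigr => k _; rewrite mxE avX pabs_p.
Qed.

Lemma cong_det e (M N : 'M[K]_n) : 0 <= e -> (forall i j, cong fv e (M i j) (N i j)) ->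
  cong fv e (\det M) (\det N).
Proof.
move=> e0 hMN; apply: cong_sum => // s _; apply: congM => //.
  by apply: congX => //; apply: congN => //; exact: cong1.
exact: cong_prod.
Qed.

(** When some a_i coincide, compare with a generic b so near that the determinant moves by at most
    half its absolute value at b, which is the same for all b. *)
Lemma frob_num_unit (a : 'I_n -> K) : (forall l, a l \in Z_p) -> \det (frob_num a) != 0.
Proof.
move=> aZ; pose c : rat := \prod_(k < n) pi ^+ k.
have c0 : 0 < c by apply: prodr_gt0 => k _; exact: pi_gt0.
have c20 : 0 < c / 2 by rewrite divr_gt0.
have [b [bZ gb hb]] := generic_dense aZ c20.
have [_ _ /= hc] : cong fv (c / 2) (\det (frob_num b)) (\det (frob_num a)).
  apply: cong_det => [|i k]; first exact: ltW.
  by rewrite !mxE; apply: frob_coef_lip => // l; exact: ltW.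
have hdb := det_frob_num bZ (generic_inj gb); rewrite -/c in hdb.
rewrite -(av_eq0 v) (@av_eq_near _ v _ (\det (frob_num b))) ?hdb ?gt_eqF //.
by rewrite avBC; apply: le_lt_trans hc _; rewrite ltr_pdivrMr // ltr_pMr // ltr1n.
Qed.

Lemma frob_mx_det (a : 'I_n -> K) : (forall l, a l \in Z_p) -> \det (frob_mx a) != 0.
Proof.
move=> aZ; apply/eqP => d0.
have := congr1 (fun x : W => ps_coef0 (aser x)) d0; rewrite /= -!det_map_mx.
have -> : map_mx (@ps_coef0 K) (map_mx (@aser p hp) (frob_mx a)) =
    frob_num a *m diag_mx (\row_(k < n) p%:R ^- k).
  apply/matrixP => i k; rewrite mul_mx_diag !mxE /ps_coef0 aserM aser_const ps_constM mulrC.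
  by [].
rewrite det_mulmx det_diag => /eqP; rewrite mulf_eq0 (negbTE (frob_num_unit aZ)) /=.
apply/negP/prodf_neq0 => k _; rewrite mxE invr_neq0 // expf_neq0 // Qp_p_neq0 //.
Qed.

End FrobeniusMatrix.

(** * The intertwining property over E_p *)

Section Intertwiner.
Variables (p : nat) (hp : prime p) (n' : nat).
Local Notation n := n'.+1.
Local Notation K := (Q_p hp).
Local Notation E := (E_p hp).
Variables (h : K) (a : 'I_n -> K).
Hypothesis hZ : h \in Z_p.
Hypothesis aZ : forall l, a l \in Z_p.

Lemma aE_pK (k : nat) : aE (aconst (p%:R ^- k) : aseries hp) = p%:R ^- k.
Proof. by rewrite aE_const fmorphV rmorphXn rmorph_nat. Qed.

Lemma E_p_neq0 : p%:R != 0 :> E.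
Proof. by rewrite -(rmorph_nat (@const_E p hp)) fmorph_eq0 Qp_p_neq0. Qed.

Lemma aE_geomP : aE (ageom hp) * (1 - zE hp ^+ p) = 1.
Proof.
have := congr1 (@aE p hp) (ageomP hp).
by rewrite aEM aEB (rmorphXn (@aE p hp)) rmorph1.
Qed.

Lemma zE_sub1_neq0 : zE hp - 1 != 0.
Proof.
rewrite subr_eq0; apply/eqP => z1; have := aE_geomP.
by rewrite z1 expr1n subrr mulr0 => /eqP; rewrite eq_sym oner_eq0.
Qed.

Definition frob_mxE : 'M[E]_n := map_mx (@aE p hp) (frob_mx hZ a).

Lemma frob_mx_in_E i j : series_in_E (fun d => U h a d i j) (frob_mxE i j).
Proof.
have eU : (fun d => U h a d i j) = aser (frob_mx hZ a i j).
  by apply/funext => d; rewrite (U_frob_coef hZ d aZ) mxE.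
have eE : frob_mxE i j = aE (frob_mx hZ a i j) by exact: mxE.
by rewrite eU eE; exact: aseries_in_E.
Qed.

Let X (i : nat) : 'rV[E]_n := \row_k aE (frobL hZ a i k).
Let t (j : 'I_n) : E := aE (ageom hp) *
  (zE hp ^+ p * const_E (hypnum h a)`_j - const_E (hypden a)`_j).
Let l (j : nat) : E := aE (eqn_coef h a j).

Lemma aE_entry (x y : K) :
  aE (ageom hp * (az hp ^+ p * aconst x - aconst y)) =
  aE (ageom hp) * (zE hp ^+ p * const_E x - const_E y).
Proof. by rewrite aEM aEB aEM (rmorphXn (@aE p hp)). Qed.

Lemma aE_lead (x y : K) : x = 1 -> y = 1 ->
  aE (az hp * aconst x - aconst y) = zE hp - 1.
Proof. by move=> -> ->; rewrite rmorph1 mulr1 aEB. Qed.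

Lemma aE_lincomb m (x y : 'I_m -> aseries hp) :
  aE (\sum_j x j * y j) = \sum_j aE (x j) * aE (y j).
Proof. by rewrite rmorph_sum; apply: eq_bigr => j _; exact: aEM. Qed.

Lemma aE_step (x : aseries hp) m (y w : 'I_m -> aseries hp) :
  aE (aD x + aconst p%:R * \sum_j y j * w j) =
  DE (aE x) + p%:R * \sum_j aE (y j) * aE (w j).
Proof. by rewrite rmorphD /= aEM aE_const rmorph_nat aE_lincomb. Qed.

(** It is applied with c = p and q = z^p: the operator in p^-1 D has leading coefficient p^-n (z^p -
    1), and [om] is minus the inverse of z^p - 1. *)
Lemma companion_quotient (F : fieldType) (c q om x : F) j m : c != 0 -> om * (1 - q) = 1 ->
  - ((c^-1 ^+ j * x) / (c^-1 ^+ m * (q - 1))) = c ^+ m * c ^- j * (om * x).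
Proof.
move=> c0 omq; have q0 : q - 1 != 0.
  apply/eqP => q1; have : om * (1 - q) = 0 by rewrite -opprB q1 oppr0 mulr0.
  by rewrite omq => /eqP; rewrite oner_eq0.
have -> : om = - (q - 1)^-1 by apply: (mulIf q0); rewrite mulNr mulVf // -(opprB 1 q) mulrN omq.
rewrite !exprVn invfM invrK; ring.
Qed.

Lemma hyp_system_zpE (i j : 'I_n) : hyp_system_zp h a i j =
  if (i.+1 < n)%N then (j == i.+1 :> nat)%:R else p%:R ^+ n * p%:R ^- j * t j.
Proof.
rewrite /hyp_system_zp /companion_system mxE; case: ifP => // _.
rewrite -(companion_quotient _ j n E_p_neq0 aE_geomP); congr (- (_ / _)).
  exact: (hyp_op_coef (@const_E p hp)).
exact: (hyp_op_lead (@const_E p hp)).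
Qed.

Lemma hyp_systemE (i j : 'I_n) : hyp_system (p%:R * h) (pscale a) i j =
  if (i.+1 < n)%N then (j == i.+1 :> nat)%:R else - (l j / l n).
Proof.
rewrite /hyp_system /companion_system mxE; case: ifP => // _.
have c k : (hyp_op 1 (zE hp) (p%:R * h) (pscale a))`_k = l k.
  have := hyp_op_coef (@const_E p hp) (p%:R * h) (pscale a) 1 (zE hp) k.
  by rewrite expr1n mul1r.
by rewrite (c j) (c n).
Qed.

Lemma frob_mxE_intertwiner : frobenius_intertwiner h a frob_mxE.
Proof.
split.
  (* Since [aE] is injective, the determinant can be tested on the power series side. *)
  rewrite unitmxE det_map_mx unitfE; apply/eqP => d0.
  by have /eqP := frob_mx_det hZ aZ; apply; apply: (@aE_inj p hp); rewrite d0 rmorph0.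
move=> S phi D hD hphi w hw; apply: (gauge_solution hD hphi _ hw).
apply: (@gauge_identity E (@DE p hp) n' p%:R (@DEM p hp) _ E_p_neq0 X
  (map_mx (@aE p hp) (Atil h a)) t l).
- by move=> k; rewrite -aE_pK aE_const DE_const.
- move=> i j; rewrite !mxE; case: ifP => _; first by rewrite rmorph_nat.
  exact: aE_entry.
- move=> i; apply/rowP => k.
  have e1 := etrans (esym (aE_step _ _ _)) (congr1 (@aE p hp) (frobL_step hZ aZ i k)).
  apply: (etrans _ (etrans e1 _)); last by rewrite mxE.
  rewrite !mxE; congr (_ + _ * _); apply: eq_bigr => j _; by rewrite !mxE.
- apply/rowP => k; rewrite summxE [RHS]mxE.
  have e2 := etrans (esym (aE_lincomb _ _)) (congr1 (@aE p hp) (frobL_eqn hZ aZ k)).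
  apply: (etrans _ e2).
  by apply: eq_bigr => j _; rewrite !mxE.
- have -> : l n = zE hp - 1 := aE_lead (lin_prod_coef _).1 (lin_prod_coef _).1.
  exact: zE_sub1_neq0.
- by move=> i k; rewrite !mxE aEM aE_pK.
- exact: hyp_system_zpE.
- exact: hyp_systemE.
Qed.

End Intertwiner.

Theorem theorem6p1 (p : nat) (hp : prime p) (n : nat) (hn : (0 < n)%N)
    (a : 'I_n -> Q_p hp) (h : Q_p hp)
    (ha : forall i, a i \in Z_p) (hh : h \in Z_p) :
  [/\ U_limits_exist h a,
      exists V : 'M[E_p hp]_n,
        (forall i j, series_in_E (fun d => U h a d i j) (V i j)) /\
        frobenius_intertwiner h a V &
      multiplication_by (gamma_class h) a (U h a 0%N)].
Proof.
case: n hn a ha => // n' _ a ha; split.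
- move=> _ d i j; exists (frob_coef hh a d i j); exact: U_tends.
- exists (frob_mxE a hh); split; last exact: frob_mxE_intertwiner.
  exact: frob_mx_in_E.
rewrite (U_frob_coef hh 0%N ha); split=> [_|_ e e0].
  exact: frob_coef0_fixed.
pose near_ij i j dl := forall b : 'I_n'.+1 -> Q_p hp, (forall l, b l \in Z_p) ->
  (forall l, pabs hp (b l - a l) < dl) ->
  pabs hp (frob_coef hh b 0 i j - frob_coef hh a 0 i j) < e.
have H (ij : 'I_n'.+1 * 'I_n'.+1) : exists dl : rat, 0 < dl /\ near_ij ij.1 ij.2 dl.
  by have [dl dl0 hdl] := frob_coef_near hh 0 ij.1 ij.2 ha e0; exists dl.
pose dl ij := projT1 (cid (H ij)).
have dlP ij : 0 < dl ij /\ near_ij ij.1 ij.2 (dl ij) := projT2 (cid (H ij)).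
(* Continuity provides one radius for each entry; the minimum serves for the finitely many of
   them. *)
exists (\big[Num.min/1]_ij dl ij).
  by apply: (big_ind (fun x : rat => 0 < x)) => // [x y x0 y0|ij _]; [rewrite lt_min x0|case: (dlP ij)].
move=> b N [bZ ib hb] hN i j.
(* As the b_i are distinct, N must be the constant term of the Frobenius matrix at b, to which
   continuity in a applies. *)
rewrite (acts_unique ib hN (frob_coef0_fixed hh bZ)).
apply: (dlP (i, j)).2 => // k; apply: lt_le_trans (hb k) _.
exact: bigmin_le_cond.
Qed.
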